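(* Let $\Phi$ be a stationary point process in $\mathbb{R}^d$ of unit intensity such that for every $1\le j\le d+1$ the joint intensity $\rho^{(j)}$ is almost everywhere continuous, scaling functions $f^j,g^j_\rho$ for $\rho^{(j)}$ (as defined in the context) exist with $g^j_\rho$ almost everywhere continuous, and $f^{j+1}=O(f^j)$ as $r\to0$. Let $r_n\to0$ and write $\mathbf{y}=(0,y_1,\ldots,y_k)$, $d\mathbf{y}=dy_1\cdots dy_k$. Then, for $1\le k\le d$, $$\lim_{n\to\infty}\frac{\mathbb{E}\{N_k(\Phi_n,r_n)\}}{n r_n^{dk}f^{k+1}(r_n)}=\nu_k(\Phi,0):=\frac1{(k+1)!}\int_{\mathbb{R}^{dk}}h_1(\mathbf{y})\,g^{k+1}_\rho(\mathbf{y})\,d\mathbf{y}.$$ Further, $\mathrm{Var}(N_k(\Phi_n,r_n))=O(\mathbb{E}\{N_k(\Phi_n,r_n)\})$ if $\Phi$ is negatively associated.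
   Context: A point process $\Phi$ in $\mathbb{R}^d$ is a random locally finite counting measure, identified with its random set of points; $\Phi(B)$ is the number of points in $B$. The $k$th joint intensity $\rho^{(k)}$ is the Lebesgue density of the intensity measure of the set $\Phi^{(k)}$ of ordered $k$-tuples of pairwise distinct points of $\Phi$. Standing assumptions: point processes are simple and all joint intensities exist. Stationary means translation invariant in law; unit intensity means $\rho^{(1)}\equiv1$. $W_n=[-n^{1/d}/2,n^{1/d}/2]^d$, $\Phi_n=\Phi\cap W_n$; $B_x(r)$ is the ball of radius $r$ centred at $x$. $\Phi$ is negatively associated if $\mathrm{Cov}(f(\Phi(B_1),\ldots,\Phi(B_k)),g(\Phi(B_{k+1}),\ldots,\Phi(B_l)))\le0$ for all bounded Borel $B_1,\ldots,B_l$ with $(B_1\cup\cdots\cup B_k)\cap(B_{k+1}\cup\cdots\cup B_l)=\varnothing$ and all increasing bounded continuous $f,g$. Scaling functions for $\rho^{(j)}$: if $\rho^{(j)}(0,\ldots,0)=0$, functions $f^j:\mathbb{R}_+\to\mathbb{R}_+$ and $g^j_\rho:(B_0(j))^j\to\mathbb{R}_+$ with $\rho^{(j)}(r\mathbf{y})=\Theta(f^j(r))$ and $\lim_{r\to0}\rho^{(j)}(r\mathbf{y})/f^j(r)=g^j_\rho(\mathbf{y})$ for all $\mathbf{y}=(0,y_2,\ldots,y_j)$; if $\rho^{(j)}(0,\ldots,0)>0$, $f^j\equiv1$ and $g^j_\rho\equiv\rho^{(j)}(0,\ldots,0)$. Critical points: for a locally finite point set $P$, $d_P(x)=\min_{X\in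 P}\|x-X\|$. A point $c\in\mathbb{R}^d$ is a critical point of $d_P$ of index $k$, $1\le k\le d$, if there are $k+1$ distinct points $X_1,\ldots,X_{k+1}\in P$ such that: (1) $d_P(c)=\|c-X_i\|$ for all $i$ and $d_P(c)<\|c-Y\|$ for all $Y\in P\setminus\{X_1,\ldots,X_{k+1}\}$; (2) $X_1,\ldots,X_{k+1}$ are in general position (not contained in a $(k-1)$-dimensional affine space); (3) $c$ lies in the (relative) interior $\mathrm{conv}^o(X_1,\ldots,X_{k+1})$ of their convex hull. $N_k(P,r)$ is the number of critical points $c$ of index $k$ of $d_P$ with $d_P(c)\le r$. For $\mathbf{x}$ a $(k+1)$-tuple of points in general position, $C(\mathbf{x})$ and $R(\mathbf{x})$ are the centre and radius of the unique $(k-1)$-dimensional sphere (in the affine span) containing the points, and $h_r(\mathbf{x})=\mathbf{1}[C(\mathbf{x})\in\mathrm{conv}^o(\mathbf{x})]\,\mathbf{1}[R(\mathbf{x})\le r]$.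
   Formalization: The joint intensities are taken in their translation-invariant version; the Θ upper bound is uniform in y and its lower bound holds for almost every y; the scaling relation is also required when ρ^{(j)}(0,…,0)>0; scaling functions are assumed up to order d+2; r_n>0. *)

(* Defs.v *)
From HB Require Import structures.
From mathcomp Require Import all_boot all_order all_algebra.
From mathcomp Require Import all_classical all_reals all_analysis.
From mathcomp Require Import measurable_realfun.

Set Implicit Arguments.
Unset Strict Implicit.
Unset Printing Implicit Defensive.
Import Order.TTheory GRing.Theory Num.Theory.
Import numFieldNormedType.Exports.

Local Open Scope classical_set_scope.
Local Open Scope ring_scope.

(* A point of R^d is a row vector and an m-tuple of points of R^d is an m x d
   matrix whose rows are the points.  The library norm on matrices is the max
   norm; the Euclidean norm is [enorm] below. *)

Section borel.
Variables (R : realType) (m n : nat).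
Let borel0 : <<s @open 'M[R]_(m, n) >> set0.
Proof. exact: sigma_algebra0. Qed.
Let borelC A : <<s @open 'M[R]_(m, n) >> A -> <<s @open 'M[R]_(m, n) >> (~` A).
Proof. exact: sigma_algebraC. Qed.
Let borelU (F : (set 'M[R]_(m, n))^nat) : (forall i, <<s @open 'M[R]_(m, n) >> (F i)) ->
  <<s @open 'M[R]_(m, n) >> (\bigcup_i F i).
Proof. exact: sigma_algebra_bigcup. Qed.
HB.instance Definition _ := @isMeasurable.Build (sigma_display (@open 'M[R]_(m, n)))
  'M[R]_(m, n) <<s @open 'M[R]_(m, n) >> borel0 borelC borelU.
End borel.

Lemma measurable_mxP (R : realType) (m n : nat) (d : measure_display)
    (T : measurableType d) (f : T -> 'M[R]_(m, n)) :
  (forall i j, measurable_fun setT (fun t => f t i j : measurableTypeR R)) ->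
  measurable_fun setT f.
Proof.
move=> mf; apply: (@measurability _ _ T 'M[R]_(m, n) setT f (@open 'M[R]_(m, n))) => //.
move=> _ [U oU <-]; rewrite setTI.
pose q2r (q : 'M[rat]_(m, n)) : 'M[R]_(m, n) := map_mx ratr q.
have -> : U = \bigcup_(p : 'M[rat]_(m, n) * nat)
   [set x | (forall i j, ball (q2r p.1 i j) p.2.+1%:R^-1 (x i j)) /\
            ball (q2r p.1) p.2.+1%:R^-1 `<=` U].
  apply/seteqP; split=> [x Ux|x [[q k] _ [/= qx]]]; last first.
    by apply; split=> //=; rewrite invr_gt0.
  have := open_nbhs_nbhs (conj oU Ux).
  rewrite -nbhs_ballE => -[e /= e0 xeU].
  have [k ke] : exists k : nat, k.+1%:R^-1 < e / 2.
    have e20 : 0 < e / 2 by rewrite divr_gt0.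
    exists (Num.truncn (e / 2)^-1).
    by rewrite invf_plt ?posrE// truncnS_gt.
  have k0 : 0 < k.+1%:R^-1 :> R by rewrite invr_gt0.
  have exq i j : exists r : rat, ball (x i j) k.+1%:R^-1 (ratr r).
    have := @rat_in_itvoo R (x i j - k.+1%:R^-1) (x i j + k.+1%:R^-1).
    rewrite ltrBlDr -addrA ltrDl addr_gt0// => /(_ isT)[r].
    rewrite in_itv/= => /andP[r1 r2]; exists r.
    by rewrite /ball/= ltr_distlC r1 r2.
  pose q := \matrix_(i < m, j < n) sval (cid (exq i j)).
  exists (q, k) => //=; split=> [i j|y [_ qy]].
    by rewrite !mxE; case: cid => r /= /ball_sym.
  apply: xeU; split=> // i j.
  rewrite (splitr e).
  have xq : ball (x i j) k.+1%:R^-1 (q2r q i j) by rewrite !mxE; case: cid.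
  by apply: (ball_triangle (le_ball (ltW ke) xq)); exact: (le_ball (ltW ke)).
rewrite preimage_bigcup; apply: countable_bigcupT_measurable => // -[q k].
have [sub|nsub] := pselect (ball (q2r q) k.+1%:R^-1 `<=` U); last first.
  by rewrite [X in measurable X](_ : _ = set0)// -subset0 => t [].
rewrite [X in measurable X](_ : _ = \bigcap_(ij in [set: 'I_m * 'I_n])
    ((fun t => f t ij.1 ij.2 : measurableTypeR R) @^-1` ball (q2r q ij.1 ij.2) k.+1%:R^-1)).
  apply: fin_bigcap_measurable => // -[i j] _ /=.
  rewrite -[X in measurable X]setTI; apply: mf => //.
  by rewrite ball_itv; exact: measurable_itv.
apply/seteqP; split=> [t [/= + _] [i j] _|t h] /=; first exact.
by split=> // i j; exact: (h (i, j)).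
Qed.

Lemma measurable_coord (R : realType) (m n : nat) (i : 'I_m) (j : 'I_n) :
  measurable_fun [set: 'M[R]_(m, n)] (fun x => x i j : measurableTypeR R).
Proof.
apply: (measurability _ (RGenOpens.measurableE R)).
move=> _ [_ [a [b ->]] <-]; rewrite setTI; apply: sub_sigma_algebra.
apply: open_comp => [x _|]; [exact: coord_continuous | exact: interval_open].
Qed.

Lemma pushforward_sigma_finite (R : realType) (d1 d2 : measure_display)
    (T1 : measurableType d1) (T2 : measurableType d2)
    (mu : {sigma_finite_measure set T1 -> \bar R}) (f : T1 -> T2) (g : T2 -> T1) :
  measurable_fun setT g -> cancel f g -> 
  sigma_finite setT (pushforward mu f).
Proof.
move=> mg fK; have [F FT mF] := sigma_finiteT mu.
exists (fun n => g @^-1` F n); first by rewrite -preimage_bigcup -FT preimage_setT.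
move=> n; have [mFn muFn] := mF n; split.
  by rewrite -[X in measurable X]setTI; exact: mg.
rewrite /pushforward (_ : f @^-1` _ = F n)//.
by apply/seteqP; split=> x /=; rewrite fK.
Qed.

Lemma product_sigma_finite (R : realType) (d1 d2 : measure_display)
    (T1 : measurableType d1) (T2 : measurableType d2)
    (m1 : {sigma_finite_measure set T1 -> \bar R})
    (m2 : {sigma_finite_measure set T2 -> \bar R}) :
  sigma_finite setT (m1 \x m2)%E.
Proof.
have /sigma_finiteP[F [TF ndF Foo]] := sigma_finiteT m1.
have /sigma_finiteP[G [TG ndG Goo]] := sigma_finiteT m2.
exists (fun n => F n `*` G n).
  rewrite -setXTT TF TG predeqE => -[x y]; split=> [[/= [n _ Fnx] [k _ Gky]]|].
    exists (maxn n k) => //; split.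
    - by move: x Fnx; exact/subsetPset/ndF/leq_maxl.
    - by move: y Gky; exact/subsetPset/ndG/leq_maxr.
  by move=> [n _ [/= Fnx Gny]]; split; exists n.
move=> k; have [mFk Fkoo] := Foo k; have [mGk Gkoo] := Goo k.
split; first exact: measurableX.
by rewrite product_measure1E// lte_mul_pinfty// ge0_fin_numE.
Qed.

Fixpoint lebesgue_tuple (R : realType) (n : nat) :
    set (n.-tuple (measurableTypeR R)) -> \bar R :=
  match n with
  | 0 => dirac [tuple]
  | n'.+1 => pushforward (lebesgue_measure \x lebesgue_tuple (n := n'))%E
      (fun p : measurableTypeR R * n'.-tuple (measurableTypeR R) =>
         [the n'.+1.-tuple _ of p.1 :: p.2])
  end.
Lemma bundle_sigma_finite (R : realType) (d : measure_display)
    (T : measurableType d) (mu : {measure set T -> \bar R}) :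
  sigma_finite setT mu ->
  exists nu : {sigma_finite_measure set T -> \bar R}, nu = mu :> (set T -> \bar R).
Proof.
move=> sf.
pose sfm := isSFinite.Build _ _ _ (Measure.sort mu) (sfinite_measure_sigma_finite sf).
pose sgf := isSigmaFinite.Build _ _ _ (Measure.sort mu) sf.
pose nu : {sigma_finite_measure set T -> \bar R} :=
  HB.pack (Measure.sort mu) (Measure.class mu) sfm sgf.
by exists nu.
Qed.


Lemma pushforward_sigma_finite_measure (R : realType) (d1 d2 : measure_display)
    (T1 : measurableType d1) (T2 : measurableType d2)
    (mu : {sigma_finite_measure set T1 -> \bar R}) (f : T1 -> T2) (g : T2 -> T1) :
  measurable_fun setT f -> measurable_fun setT g -> cancel f g -> 
  exists nu : {sigma_finite_measure set T2 -> \bar R}, 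
    nu = pushforward mu f :> (set T2 -> \bar R).
Proof.
move=> mf mg fK.
have [nu nuE] := @bundle_sigma_finite _ _ _
  (measure_function.measure_function_pushforward__canonical__measure_function_Measure mu mf)
  (pushforward_sigma_finite mu mg fK).
by exists nu.
Qed.

Lemma lebesgue_tuple_sigma_finite (R : realType) (n : nat) :
  exists mu : {sigma_finite_measure set (n.-tuple (measurableTypeR R)) -> \bar R},
    mu = @lebesgue_tuple R n :> (set _ -> \bar R).
Proof.
elim: n => [|n [mu muE]].
  have [|nu nuE] := @bundle_sigma_finite R _ _
    (\d_[tuple] : {measure set (0.-tuple (measurableTypeR R)) -> \bar R});
    last by exists nu.
  by apply: fin_num_fun_sigma_finite => //; rewrite measure0.
pose leb : {sigma_finite_measure set (measurableTypeR R) -> \bar R} := @lebesgue_measure R.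
have [prodm prodmE] := @bundle_sigma_finite _ _ _ (leb \x mu)%E (product_sigma_finite leb mu).
have [||x|nu nuE] := @pushforward_sigma_finite_measure R _ _ _ _
    prodm
   (fun p : measurableTypeR R * n.-tuple (measurableTypeR R) =>
      [the n.+1.-tuple _ of p.1 :: p.2])
   (fun t => (thead t, [tuple of behead t])).
- exact: measurable_cons.
- apply/measurable_fun_pairP; split; first exact: measurable_tnth.
  exact: measurable_behead.
- case: x => x t; congr pair; exact: val_inj.
- by exists nu; rewrite nuE prodmE /= -muE.
Qed.

Definition mx_of_tuple (R : realType) (m n : nat)
    (t : (m * n).-tuple (measurableTypeR R)) : 'M[R]_(m, n) :=
  \matrix_(i < m, j < n) tnth t (mxvec_index i j).

(* Lebesgue measure on R^(m * n); see [lebesgue_mx_box]. *)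
Definition lebesgue_mx (R : realType) (m n : nat) : set 'M[R]_(m, n) -> \bar R :=
  pushforward (@lebesgue_tuple R (m * n)) (@mx_of_tuple R m n).

Lemma lebesgue_mx_sigma_finite (R : realType) (m n : nat) :
  exists mu : {sigma_finite_measure set 'M[R]_(m, n) -> \bar R},
    mu = @lebesgue_mx R m n :> (set _ -> \bar R).
Proof.
have [mu muE] := lebesgue_tuple_sigma_finite R (m * n).
rewrite /lebesgue_mx -muE.
apply: (@pushforward_sigma_finite_measure R _ _ _ _ mu (@mx_of_tuple R m n)
   (fun A => [tuple (mxvec A ord0 k : measurableTypeR R) | k < m * n])).
- apply: measurable_mxP => i j; under eq_fun do rewrite mxE.
  exact: measurable_tnth.
- apply/measurable_fun_tnthP => k; rewrite /comp/=.
  case/mxvec_indexP: k => i j.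
  under eq_fun do rewrite tnth_mktuple mxvecE.
  exact: measurable_coord.
- move=> t; apply: eq_from_tnth => k; case/mxvec_indexP: k => i j.
  by rewrite tnth_mktuple mxvecE mxE.
Qed.

Section lebesgue_mx_measure.
Variables (R : realType) (m n : nat).
Let lebesgue_mx0 : @lebesgue_mx R m n set0 = 0%E.
Proof. by have [mu <-] := lebesgue_mx_sigma_finite R m n; rewrite measure0. Qed.
Let lebesgue_mx_ge0 A : (0 <= @lebesgue_mx R m n A)%E.
Proof. by have [mu <-] := lebesgue_mx_sigma_finite R m n. Qed.
Let lebesgue_mx_sigma_additive : semi_sigma_additive (@lebesgue_mx R m n).
Proof.
have [mu <-] := lebesgue_mx_sigma_finite R m n.
exact: measure_semi_sigma_additive.
Qed.
HB.instance Definition _ := isMeasure.Build _ _ _ (@lebesgue_mx R m n)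
  lebesgue_mx0 lebesgue_mx_ge0 lebesgue_mx_sigma_additive.
Let lebesgue_mx_sf : sigma_finite setT (@lebesgue_mx R m n).
Proof. by have [mu <-] := lebesgue_mx_sigma_finite R m n; exact: sigma_finiteT. Qed.
HB.instance Definition _ := Measure_isSigmaFinite.Build _ _ _
  (@lebesgue_mx R m n) lebesgue_mx_sf.
End lebesgue_mx_measure.

Lemma lebesgue_tuple_box (R : realType) (n : nat)
    (A : 'I_n -> set (measurableTypeR R)) :
  (forall i, measurable (A i)) ->
  lebesgue_tuple [set t : n.-tuple (measurableTypeR R) | forall i, A i (tnth t i)] =
  (\prod_(i < n) lebesgue_measure (A i))%E.
Proof.
elim: n A => [|n IHn] A mA.
  by rewrite big_ord0 /= diracE mem_set//= => -[].
rewrite big_ord_recl -IHn //= /pushforward.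
have [mu muE] := lebesgue_tuple_sigma_finite R n; rewrite -muE.
rewrite -[RHS](product_measure1E (@lebesgue_measure R) mu)//.
  congr product_measure1; apply/seteqP; split=> -[x t] /= h.
    by split=> [|i]; [exact: (h ord0) | have := h (lift ord0 i); rewrite tnthS].
  case: h => Ax At i; case: (unliftP ord0 i) => [j ->|-> //].
  by rewrite tnthS; exact: At.
rewrite [X in measurable X](_ : _ = \bigcap_(i in [set: 'I_n])
    ((@tnth _ _ ^~ i) @^-1` A (lift ord0 i))).
  apply: fin_bigcap_measurable => // i _; rewrite -[X in measurable X]setTI.
  exact: measurable_tnth.
by apply/seteqP; split=> [t h i _|t h i]; exact: h.
Qed.

Lemma lebesgue_mx_box (R : realType) (m n : nat)
    (A : 'I_m -> 'I_n -> set (measurableTypeR R)) :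
  (forall i j, measurable (A i j)) ->
  lebesgue_mx [set x : 'M[R]_(m, n) | forall i j, A i j (x i j)] =
  (\prod_(i < m) \prod_(j < n) lebesgue_measure (A i j))%E.
Proof.
move=> mA; rewrite pair_big/=.
pose B (k : 'I_(m * n)) := A (enum_val (cast_ord (esym (mxvec_cast m n)) k)).1
                             (enum_val (cast_ord (esym (mxvec_cast m n)) k)).2.
have BE i j : B (mxvec_index i j) = A i j.
  by rewrite /B /mxvec_index cast_ordK enum_rankK.
rewrite (eq_bigr (fun p => lebesgue_measure (B (uncurry (@mxvec_index m n) p)))); last first.
  by move=> [i j] _ /=; rewrite BE.
rewrite -(reindex (uncurry (@mxvec_index m n)) (P := xpredT) (F := fun k => lebesgue_measure (B k)))/=; last first.
  by have [g gK Kg] := curry_mxvec_bij m n; exists g => x xP; rewrite ?gK ?Kg. 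
rewrite -(lebesgue_tuple_box (A := B)) => [|k]; last exact: mA.
congr lebesgue_tuple; apply/seteqP; split=> t /= h => [k|i j].
  by case/mxvec_indexP: k => i j; rewrite BE; have := h i j; rewrite mxE.
by rewrite mxE -BE.
Qed.

Section geometry.
Variables (R : realType) (d : nat).
Implicit Types (P : set 'rV[R]_d) (c v : 'rV[R]_d).

Definition enorm v : R := Num.sqrt (\sum_(i < d) v ord0 i ^+ 2).

Definition dist_to P c : R := inf [set enorm (c - X) | X in P].

Definition affine_hull m (X : 'M[R]_(m, d)) : set 'rV[R]_d :=
  [set v | exists2 l : 'rV[R]_m, \sum_i l ord0 i = 1 & v = l *m X].

Definition convex_hull m (X : 'M[R]_(m, d)) : set 'rV[R]_d :=
  [set v | exists2 l : 'rV[R]_m,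
    (forall i, 0 <= l ord0 i) /\ \sum_i l ord0 i = 1 & v = l *m X].

Definition relint_convex_hull m (X : 'M[R]_(m, d)) : set 'rV[R]_d :=
  [set c | convex_hull X c /\ exists2 e, 0 < e &
    forall v, affine_hull X v -> enorm (v - c) < e -> convex_hull X v].

(* [p + U] is an affine subspace of dimension [\rank U] *)
Definition general_position k (X : 'M[R]_(k.+1, d)) : Prop :=
  ~ exists p : 'rV[R]_d, exists2 U : 'M[R]_d,
      (\rank U).+1 = k & forall i, (row i X - p <= U)%MS.

Definition critical_point k P c : Prop :=
  exists X : 'M[R]_(k.+1, d),
    [/\ (forall i, P (row i X)) /\ injective (fun i => row i X),
        forall i, dist_to P c = enorm (c - row i X),
        forall Y, P Y -> (forall i, Y <> row i X) -> dist_to P c < enorm (c - Y),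
        general_position X &
        relint_convex_hull X c].

Definition num_critical k P (r : R) : \bar R :=
  counting [set c | critical_point k P c /\ dist_to P c <= r].

Definition circumcenter k (X : 'M[R]_(k.+1, d)) : 'rV[R]_d :=
  get [set c | affine_hull X c /\ exists s, forall i, enorm (row i X - c) = s].

Definition circumradius k (X : 'M[R]_(k.+1, d)) : R :=
  enorm (row ord0 X - circumcenter X).

(* extended by 0 to the tuples that are not in general position *)
Definition hfun k (r : R) (X : 'M[R]_(k.+1, d)) : R :=
  \1_[set X : 'M[R]_(k.+1, d) | [/\ general_position X,
        relint_convex_hull X (circumcenter X) & circumradius X <= r]] X.

Definition window (n : nat) : set 'rV[R]_d :=
  [set x | forall i, `|x ord0 i| <= n%:R `^ d%:R^-1 / 2].

Definition balls m (s : R) : set 'M[R]_(m, d) :=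
  [set x | forall i, enorm (row i x) <= s].

Definition cons0 k (y : 'M[R]_(k, d)) : 'M[R]_(k.+1, d) :=
  col_mx (0 : 'rV[R]_d) y.

End geometry.

Section point_processes.
Variables (R : realType) (d : nat).

(* The sigma-algebra on point configurations generated by the evaluations
   C |-> #(C `&` B), B Borel.  A simple point process is a random element of
   [config R d] whose values are locally finite sets. *)
Definition evaluation_events : set (set (set 'rV[R]_d)) :=
  [set E | exists2 B : set 'rV[R]_d, measurable B &
           exists2 U : set (\bar R), measurable U &
             E = (fun C => counting (C `&` B)) @^-1` U].

Definition config := g_sigma_algebraType evaluation_events.

Definition locally_finite (C : set 'rV[R]_d) : Prop :=
  forall B, bounded_set B -> finite_set (C `&` B).

Definition translate (a : 'rV[R]_d) (C : config) : config :=
  [set x + a | x in C].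

Variables (disp : measure_display) (Omega : measurableType disp).
Variables (P : probability Omega R) (Phi : {RV P >-> config}).

Definition stationary : Prop :=
  forall (a : 'rV[R]_d) (E : set config), measurable E ->
    pushforward P (fun w => translate a (Phi w)) E = distribution P Phi E.

(* the ordered j-tuples of pairwise distinct points, one point per row *)
Definition distinct_tuples j (C : set 'rV[R]_d) : set 'M[R]_(j, d) :=
  [set x | (forall i, C (row i x)) /\ injective (fun i => row i x)].

Definition joint_intensity j (rho : 'M[R]_(j, d) -> R) : Prop :=
  [/\ measurable_fun setT rho, forall x, 0 <= rho x &
      forall A : set 'M[R]_(j, d), measurable A ->
        (\int[P]_w counting (distinct_tuples (Phi w) `&` A) =
         \int[lebesgue_mx (n := d)]_(x in A) (rho x)%:E)%E].

Definition counts m (B : 'I_m -> set 'rV[R]_d) (w : Omega) : 'rV[R]_m :=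
  \row_i fine (counting (Phi w `&` B i)).

Definition increasing m (F : 'rV[R]_m -> R) : Prop :=
  forall x y : 'rV[R]_m, (forall i, x ord0 i <= y ord0 i) -> F x <= F y.

Definition negatively_associated : Prop :=
  forall (p q : nat) (B : 'I_p -> set 'rV[R]_d) (D : 'I_q -> set 'rV[R]_d)
    (F : 'rV[R]_p -> R) (G : 'rV[R]_q -> R),
  (forall i, measurable (B i) /\ bounded_set (B i)) ->
  (forall i, measurable (D i) /\ bounded_set (D i)) ->
  (\bigcup_i B i) `&` (\bigcup_i D i) = set0 ->
  increasing F -> continuous F -> bounded_fun F ->
  increasing G -> continuous G -> bounded_fun G ->
  (covariance P (fun w => F (counts B w)) (fun w => G (counts D w)) <= 0)%E.

End point_processes.

Definition translation_invariant (R : realType) (d j : nat)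
    (rho : 'M[R]_(j, d) -> R) : Prop :=
  forall (a : 'rV[R]_d) x, rho (x + \matrix_(i < j) a) = rho x.

(* Scaling functions f, g for the joint intensity of order j.+1.  A tuple
   (0, y_2, ..., y_{j+1}) is [cons0 y].  The relation rho(r y) = Theta(f(r)) is
   split into an upper bound, uniform in y, and a lower bound for almost every
   y: if [rho 0 = 0] the lower bound fails at y = 0, and typically wherever two
   of the points coincide. *)
Record scaling_functions (R : realType) (d j : nat)
    (rho : 'M[R]_(j.+1, d) -> R) (f : R -> R) (g : 'M[R]_(j.+1, d) -> R)
    : Prop := ScalingFunctions {
  scaling_f_ge0 : forall r, 0 <= r -> 0 <= f r ;
  scaling_f_gt0 : \forall r \near 0^'+, 0 < f r ;
  scaling_g_ge0 : forall x, balls j.+1%:R x -> 0 <= g x ;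
  scaling_bigO : exists C, \forall r \near 0^'+, forall y,
    balls j.+1%:R y -> rho (r *: cons0 y) <= C * f r ;
  scaling_bigOmega : {ae lebesgue_mx (n := d), forall y, balls j.+1%:R y ->
    exists2 c, 0 < c & \forall r \near 0^'+, c * f r <= rho (r *: cons0 y)} ;
  scaling_cvg : forall y, balls j.+1%:R y ->
    rho (r *: cons0 y) / f r @[r --> 0^'+] --> g (cons0 y) ;
  scaling_pos : 0 < rho 0 ->
    (forall r, 0 <= r -> f r = 1) /\ (forall x, balls j.+1%:R x -> g x = rho 0)
}.

(* g matters only on tuples of [balls k.+1%:R]: elsewhere [hfun 1] vanishes. *)
Definition nu (R : realType) (d k : nat) (g : 'M[R]_(k.+1, d) -> R) : \bar R :=
  ((k.+1)`!%:R^-1%:E *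
   \int[lebesgue_mx (n := d)]_y (hfun 1 (cons0 y) * g (cons0 y))%:E)%E.

(* Main.v *)
Require Import Defs.
From HB Require Import structures.
From mathcomp Require Import all_boot all_order all_algebra.
From mathcomp Require Import all_classical all_reals all_analysis.
From mathcomp Require Import measurable_realfun.
From mathcomp Require Import fingroup perm finmap ring lra zify.
Import Order.TTheory GRing.Theory Num.Theory.
Import numFieldNormedType.Exports.
Local Open Scope classical_set_scope.
Local Open Scope ring_scope.
Set Implicit Arguments.
Unset Strict Implicit.
Unset Printing Implicit Defensive.

(** A critical point of index k at height at most r is the circumcentre of a tuple X of
k+1 distinct points that encloses its circumcentre, has circumradius at most r, and whose
closed circumball contains no further point; it arises from exactly (k+1)! tuples, the
orderings of its nearest points ([num_critical_tuples]).  Hence (k+1)! N = S - E, where S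
counts the tuples with h_r(X) = 1 and E counts those among them that are spoiled by a
further point in their closed circumball.

Expectation.  The mean of S is the integral of h_r rho over the tuples of the window.  The
substitution X = (a, a + r y) ([integral_shear]) and translation invariance turn it into
n r^(dk) f(r) times the integral of h_1(0,y) (rho(r (0,y)) / f(r)) theta_n(y), where
theta_n(y) is the proportion of the window in which a tuple of shape r y fits.  It tends
to 1, and dominated convergence yields the integral that defines nu
([integral_window_cvg]).  A spoiled tuple belongs to k+2 points at distances O(r), so the
mean of E is O(n r^(d(k+1)) f^(k+2)(r)), which is negligible since f^(k+2) = O(f^(k+1))
([mean_spoiled_le], [expectation_limit]).

Variance.  It suffices to bound the variances of S and of E, which are both increasing in
the configuration.  The window is cut into cells of side r.  The tuples whose first point
lies in a given cell, and the points that may spoil them, lie in a halo of side 5r around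
the cell.  Colouring the cells by their indices modulo 5 gives 5^d colours, and halos of
distinct cells of one colour are disjoint; negative association then makes the
contributions of these cells negatively correlated, so that the variance is bounded by a
constant times the sum of the second moments of the cells ([variance_coloured],
[tuples_cells]).

Negative association is about continuous functions of finitely many counts.  It extends to
tuple counts because a tuple count evaluated on the occupied cells of a grid is such a
function, and agrees with the tuple count itself once the grid is fine enough for the given
finite configuration ([tupset_discretisation], [na_ntuples]).  This needs sets of tuples
that can be recognised from nearby tuples ([approximable]); boolean combinations of
polynomial inequalities have this property, and h_r is of this kind by Cramer's rule.

The second moment in a cell is at most a constant times the factorial moment of order k+1
of the number of points in its halo: negative association gives
E N^(m+1) <= |A| E N^(m) for falling factorials ([fmomentS_le]), so that low factorial
moments dominate the high ones in a small set ([pmoment_le]).  That moment is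
O(r^(d(k+1)) f(5dr)).  Two facts conclude: f(L r) = O(f(r)), because (0,y) at scale L r is
(0,L y) at scale r ([scaling_dilation]), and nu > 0 ([nu_gt0]), so that n r^(dk) f(r) is
O(E N). *)

(** * Lebesgue measure on tuples of points *)

Section lebesgue_matrix.
Variable R : realType.
Implicit Types (m n d : nat).

Definition open_box m n (a b : 'M[R]_(m, n)) : set 'M[R]_(m, n) :=
  [set x | forall i j, a i j < x i j < b i j].

Lemma measurable_entries m n (A : 'I_m -> 'I_n -> set R) :
  (forall i j, measurable (A i j : set (measurableTypeR R))) ->
  measurable [set x : 'M[R]_(m, n) | forall i j, A i j (x i j)].
Proof.
move=> mA; rewrite [X in measurable X](_ : _ = \bigcap_(ij in [set: 'I_m * 'I_n])
    ((fun x : 'M[R]_(m, n) => x ij.1 ij.2 : measurableTypeR R) @^-1` A ij.1 ij.2)).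
  apply: fin_bigcap_measurable => // -[i j] _ /=.
  by rewrite -[X in measurable X]setTI; apply: measurable_coord.
by apply/seteqP; split=> [t h [i j] _|t h i j] /=; [exact: h|exact: (h (i, j))].
Qed.

Lemma measurable_itv_box m n (l u : bool) (a b : 'M[R]_(m, n)) :
  measurable [set x : 'M[R]_(m, n) | forall i j,
    x i j \in Interval (BSide l (a i j)) (BSide u (b i j))].
Proof.
by apply: (@measurable_entries _ _ (fun i j => [set` Interval (BSide l (a i j)) (BSide u (b i j))])).
Qed.

Lemma lebesgue_mx_itv_box m n (l u : bool) (a b : 'M[R]_(m, n)) :
  lebesgue_mx [set x : 'M[R]_(m, n) | forall i j,
    x i j \in Interval (BSide l (a i j)) (BSide u (b i j))] =
  (\prod_(i < m) \prod_(j < n) Num.max 0 (b i j - a i j))%:E.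
Proof.
rewrite (@lebesgue_mx_box R m n (fun i j => [set` Interval (BSide l (a i j)) (BSide u (b i j))]))//.
rewrite -prodEFin; apply: eq_bigr => i _; rewrite -prodEFin; apply: eq_bigr => j _.
rewrite lebesgue_measure_itv/= lte_fin; case: ltP => h.
  by rewrite max_r// subr_ge0 ltW.
by rewrite max_l// subr_le0.
Qed.

Lemma open_boxE m n (a b : 'M[R]_(m, n)) : open_box a b =
  [set x | forall i j, x i j \in Interval (BSide false (a i j)) (BSide true (b i j))].
Proof. by apply/seteqP; split=> x h i j; have := h i j; rewrite in_itv. Qed.

Lemma measurable_open_box m n (a b : 'M[R]_(m, n)) : measurable (open_box a b).
Proof. by rewrite open_boxE; exact: measurable_itv_box. Qed.

Lemma lebesgue_mx_open_box m n (a b : 'M[R]_(m, n)) :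
  lebesgue_mx (open_box a b) =
  (\prod_(i < m) \prod_(j < n) Num.max 0 (b i j - a i j))%:E.
Proof. by rewrite open_boxE lebesgue_mx_itv_box. Qed.

Lemma entries_bound m n (x : 'M[R]_(m, n)) : exists N : nat, forall i j, `|x i j| < N%:R.
Proof.
exists (\sum_i \sum_j (Num.truncn `|x i j|).+1)%N => i j.
apply: lt_le_trans (_ : (Num.truncn `|x i j|).+1%:R <= _); first exact: truncnS_gt.
by rewrite ler_nat (bigD1 i)//= (bigD1 j)//= -addnA leq_addr.
Qed.

(** The strip of the matrices with a < x_ij < b is the union over N of the boxes whose
    other sides are ]-N, N[, and such strips generate the Borel sets. *)
Lemma measurable_mx_open_box m n : (@measurable _ 'M[R]_(m, n)) =
  <<s [set A | exists a b, A = open_box a b] >>.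
Proof.
apply/seteqP; split; last first.
  apply: smallest_sub; first exact: sigma_algebra_measurable.
  by move=> A [a [b ->]]; exact: measurable_open_box.
set G := [set _ | _].
suff mid : measurable_fun [set: g_sigma_algebraType G]
    (fun x : g_sigma_algebraType G => (x : 'M[R]_(m, n))).
  by move=> A mA; have := mid measurableT _ mA; rewrite setTI.
apply: measurable_mxP => i j.
apply: (measurability _ (RGenOpens.measurableE R)).
move=> _ [_ [a [b ->]] <-]; rewrite setTI.
pose A (N : nat) : 'M[R]_(m, n) :=
  \matrix_(i', j') if (i' == i) && (j' == j) then a else - N%:R.
pose B (N : nat) : 'M[R]_(m, n) :=
  \matrix_(i', j') if (i' == i) && (j' == j) then b else N%:R.
rewrite [X in measurable X](_ : _ = \bigcup_N open_box (A N) (B N)).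
  apply: bigcup_measurable => N _; apply: sub_sigma_algebra.
  by exists (A N), (B N).
apply/seteqP; split=> [x|x [N _] h] /=; last first.
  by have := h i j; rewrite !mxE !eqxx in_itv.
rewrite in_itv/= => xab.
have [N Nx] := entries_bound x.
exists N => // i' j'; rewrite !mxE; case: ifPn => [/andP[/eqP-> /eqP->]//|_].
by rewrite -ltr_norml.
Qed.

Lemma lebesgue_mx_unique m n (mu : {measure set 'M[R]_(m, n) -> \bar R}) :
  (forall a b, mu (open_box a b) = lebesgue_mx (open_box a b)) ->
  forall A, measurable A -> mu A = lebesgue_mx A.
Proof.
move=> h.
apply: (measure_unique [set A | exists a b, A = open_box a b]
  (fun N => open_box (const_mx (- N%:R)) (const_mx N%:R))).
- exact: measurable_mx_open_box.
- move=> _ _ [a [b ->]] [a' [b' ->]].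
  exists (\matrix_(i, j) Num.max (a i j) (a' i j)),
         (\matrix_(i, j) Num.min (b i j) (b' i j)).
  apply/seteqP; split=> x.
    case=> h1 h2 i j; rewrite !mxE gt_max lt_min.
    by case/andP: (h1 i j) => -> ->; case/andP: (h2 i j) => -> ->.
  move=> H; split=> i j; have := H i j; rewrite !mxE gt_max lt_min.
    by case/andP => /andP[-> _] /andP[-> _].
  by case/andP => /andP[_ ->] /andP[_ ->].
- by move=> N; exists (const_mx (- N%:R)), (const_mx N%:R).
- apply/seteqP; split=> // x _.
  by have [N Nx] := entries_bound x; exists N => // i j; rewrite !mxE -ltr_norml.
- by move=> _ [a [b ->]]; exact: h.
- by move=> N; rewrite h lebesgue_mx_open_box ltry.
Qed.

Lemma lebesgue_mx_le m n (A B : set 'M[R]_(m, n)) : measurable A -> measurable B ->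
  A `<=` B -> (lebesgue_mx A <= lebesgue_mx B)%E.
Proof.
by move=> mA mB AB; apply: (le_measure (lebesgue_mx (R := R) (m := m) (n := n))) => //;
  exact: mem_set.
Qed.

Definition shear k d (r : R) (p : 'M[R]_(k, d) * 'rV[R]_d) : 'M[R]_(k.+1, d) :=
  r *: cons0 p.1 + \matrix_(i < k.+1) p.2.

Lemma shear0 k d r p j : @shear k d r p ord0 j = p.2 ord0 j.
Proof.
rewrite !mxE; case: splitP => [i' _|i' //]; last first.
by rewrite !mxE mulr0 add0r.
Qed.

Lemma shearS k d r p i j :
  @shear k d r p (lift ord0 i) j = p.2 ord0 j + r * p.1 i j.
Proof.
rewrite !mxE; case: splitP => [i'|i' /= /eqP].
  by rewrite ord1.
by rewrite /bump /= add1n add1n eqSS => /eqP/val_inj ->; rewrite addrC.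
Qed.

Lemma measurable_shear k d r : measurable_fun setT (@shear k d r).
Proof.
apply: measurable_mxP => i j.
case: (unliftP ord0 i) => [i' ->|->].
  under eq_fun do rewrite shearS.
  apply: measurable_funD.
    by apply: (measurableT_comp (@measurable_coord R _ _ _ _)); exact: measurable_snd.
  apply: measurable_funM => //.
  by apply: (measurableT_comp (@measurable_coord R _ _ _ _)); exact: measurable_fst.
under eq_fun do rewrite shear0.
by apply: (measurableT_comp (@measurable_coord R _ _ _ _)); exact: measurable_snd.
Qed.

(** For a fixed first point the other points are dilated by r and translated, hence the
    Jacobian r^(kd). *)
Lemma lebesgue_shear_box k d (r : R) (a b : 'M[R]_(k.+1, d)) : 0 < r ->
  ((r ^+ (k * d))%:E *
    (lebesgue_mx (m := k) (n := d) \x lebesgue_mx (m := 1) (n := d))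
      (shear r @^-1` open_box a b))%E = lebesgue_mx (open_box a b).
Proof.
move=> r0; set A := shear r @^-1` _.
have mA : measurable A.
  rewrite -[A]setTI; apply: measurable_shear => //; exact: measurable_open_box.
rewrite -(setIT A) -integral_indic// fubini_tonelli2//; last first.
  by apply/measurable_EFinP; exact: measurable_indic.
pose c := \prod_(i < k) \prod_(j < d) (Num.max 0 (b (lift ord0 i) j - a (lift ord0 i) j) / r).
pose B := open_box (\row_j a ord0 j) (\row_j b ord0 j).
have inner x0 : fubini_G (lebesgue_mx (n := d)) (EFin \o \1_A) x0 = (c * \1_B x0)%:E :> \bar R.
  rewrite /fubini_G /=.
  have [Bx|nBx] := pselect (B x0); last first.
    rewrite indicE memNset// mulr0.
    apply: integral0_eq => y _; rewrite indicE memNset// => Ay; apply: nBx => i j.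
    by have := Ay ord0 j; rewrite /= shear0 !mxE (ord1 i).
  rewrite indicE mem_set// mulr1.
  pose C := open_box (\matrix_(i < k, j < d) ((a (lift ord0 i) j - x0 ord0 j) / r))
     (\matrix_(i < k, j < d) ((b (lift ord0 i) j - x0 ord0 j) / r)).
  have AC y : A (y, x0) <-> C y.
    split=> [h i j|h i j].
      have := h (lift ord0 i) j; rewrite shearS !mxE/= ltr_pdivrMr// ltr_pdivlMr//.
      by rewrite ltrBlDr ltrBrDr mulrC addrC.
    case: (unliftP ord0 i) => [i' ->|->].
      rewrite shearS /=.
      have := h i' j; rewrite !mxE/= ltr_pdivrMr// ltr_pdivlMr//.
      by rewrite ltrBlDr ltrBrDr mulrC addrC.
    by rewrite shear0; have := Bx ord0 j; rewrite !mxE.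
  under eq_integral.
    move=> y _.
    have -> : \1_A (y, x0) = \1_C y :> R.
      rewrite !indicE; congr (_%:R); congr nat_of_bool.
      by apply/idP/idP => /set_mem/AC/mem_set.
    over.
  rewrite integral_indic//; last exact: measurable_open_box.
  rewrite setIT -[LHS]/(lebesgue_mx C) lebesgue_mx_open_box; congr EFin.
  apply: eq_bigr => i _; apply: eq_bigr => j _; rewrite !mxE.
  rewrite -mulrBl opprB addrA subrK maxr_pMl ?invr_ge0 ?ltW//.
  by rewrite mul0r.
under eq_integral do rewrite inner.
under eq_integral do rewrite EFinM.
rewrite ge0_integralZl//; last 2 first.
- by apply/measurable_EFinP; apply: measurable_indic; exact: measurable_open_box.
- rewrite lee_fin; apply: prodr_ge0 => i _; apply: prodr_ge0 => j _.
  by apply: divr_ge0; [rewrite le_max lexx|exact: ltW].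
rewrite integral_indic//; last exact: measurable_open_box.
rewrite setIT -[X in (_ * (_ * X))%E]/(lebesgue_mx B) !lebesgue_mx_open_box -!EFinM; congr EFin.
rewrite big_ord1 big_ord_recl mulrA [RHS]mulrC; congr (_ * _); last first.
  by apply: eq_bigr => j _; rewrite !mxE.
rewrite /c; under eq_bigr do rewrite big_split/=.
rewrite big_split/= mulrCA; under [X in _ * (_ * X)]eq_bigr do rewrite prodr_const card_ord.
by rewrite prodr_const card_ord exprVn exprVn -exprM mulnC mulfV ?mulr1// expf_neq0// gt_eqF.
Qed.

(** Substituting x = (a, a + r y_1, ..., a + r y_k): the first point sweeps space and
    the others are seen from it at scale r. *)
Lemma integral_shear k d (r : R) (F : 'M[R]_(k.+1, d) -> \bar R) : 0 < r ->
  measurable_fun setT F -> (forall x, 0 <= F x)%E ->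
  (\int[lebesgue_mx (m := k.+1) (n := d)]_x F x = (r ^+ (k * d))%:E *
    \int[lebesgue_mx (m := k) (n := d)]_y \int[lebesgue_mx (m := 1) (n := d)]_a
      F (shear r (y, a)))%E.
Proof.
move=> r0 mF F0.
have rk0 : 0 <= r ^+ (k * d) by rewrite exprn_ge0// ltW.
pose prodm := product_measure1 (lebesgue_mx (m := k) (n := d) : {measure set 'M[R]_(k, d) -> \bar R}) (lebesgue_mx (R := R) (m := 1) (n := d)).
pose push := pushforward prodm (@shear k d r).
pose pm : {measure set _ -> \bar R} :=
  measure_function.measure_function_pushforward__canonical__measure_function_Measure
   (lebesgue_mx (m := k) (n := d) \x lebesgue_mx (m := 1) (n := d))%E (@measurable_shear k d r).
rewrite (@eq_measure_integral _ _ _ _ (mscale (NngNum rk0) pm)); last first.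
  move=> A mA _; apply/esym/lebesgue_mx_unique => // a b.
  rewrite /mscale/=; exact: lebesgue_shear_box.
rewrite ge0_integral_mscale//.
rewrite ge0_integral_pushforward//; last exact: measurable_shear.
rewrite preimage_setT fubini_tonelli1//.
- by apply: measurableT_comp => //; exact: measurable_shear.
- by move=> p; exact: F0.
Qed.

End lebesgue_matrix.

(** * Circumcentres in barycentric coordinates *)

Section geometry.
Variables (R : realType) (k d : nat).
Implicit Types (X : 'M[R]_(k.+1, d)) (v c : 'rV[R]_d) (a : 'rV[R]_k).

Definition sqn v : R := \sum_(i < d) v ord0 i ^+ 2.

Lemma sqn_ge0 v : 0 <= sqn v.
Proof. by apply: sumr_ge0 => i _; exact: sqr_ge0. Qed.

Lemma sqnE v : sqn v = (v *m v^T) ord0 ord0.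
Proof. by rewrite mxE; apply: eq_bigr => i _; rewrite mxE expr2. Qed.

Lemma sqn_eq0 v : sqn v = 0 -> v = 0.
Proof.
move=> /psumr_eq0P h; apply/rowP => i; rewrite mxE.
have /eqP := h (fun j _ => sqr_ge0 _) i isT.
by rewrite sqrf_eq0 => /eqP.
Qed.

Lemma sqnN v : sqn (- v) = sqn v.
Proof. by apply: eq_bigr => i _; rewrite mxE sqrrN. Qed.

Lemma sqnZ (t : R) v : sqn (t *: v) = t ^+ 2 * sqn v.
Proof. by rewrite mulr_sumr; apply: eq_bigr => i _; rewrite mxE exprMn. Qed.

Lemma sqnB_le v c : sqn (v - c) <= 2 * (sqn v + sqn c).
Proof.
rewrite -big_split/= mulr_sumr; apply: ler_sum => i _; rewrite !mxE.
rewrite -subr_ge0.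
rewrite (_ : _ - _ = (v ord0 i + c ord0 i) ^+ 2); first exact: sqr_ge0.
by ring.
Qed.

Lemma enorm_ge0 v : 0 <= enorm v. Proof. exact: sqrtr_ge0. Qed.

Lemma enorm_sqr v : enorm v ^+ 2 = sqn v.
Proof. by rewrite sqr_sqrtr// sqn_ge0. Qed.

Lemma enormB v c : enorm (v - c) = enorm (c - v).
Proof. by rewrite /enorm -!/(sqn _) -sqnN opprB. Qed.

Lemma enorm_le v (r : R) : 0 <= r -> (enorm v <= r) = (sqn v <= r ^+ 2).
Proof. by move=> r0; rewrite -enorm_sqr ler_pXn2r// nnegrE enorm_ge0. Qed.

Lemma enorm_lt v (r : R) : 0 <= r -> (enorm v < r) = (sqn v < r ^+ 2).
Proof. by move=> r0; rewrite -enorm_sqr ltr_pXn2r// nnegrE enorm_ge0. Qed.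

Lemma enorm_eq v c : (enorm v = enorm c) <-> (sqn v = sqn c).
Proof.
by split=> [h|h]; [rewrite -!enorm_sqr h|rewrite /enorm -!/(sqn _) h].
Qed.

Lemma coord_le_enorm v i : `|v ord0 i| <= enorm v.
Proof.
rewrite -(@ler_pXn2r _ 2)// ?nnegrE ?enorm_ge0// enorm_sqr real_normK ?num_real//.
by rewrite /sqn (bigD1 i)//= lerDl; apply: sumr_ge0 => j _; exact: sqr_ge0.
Qed.

Lemma enorm_le_coord v (t : R) : 0 <= t -> (forall i, `|v ord0 i| <= t) ->
  enorm v <= d%:R * t.
Proof.
move=> t0 h; rewrite enorm_le ?mulr_ge0//.
apply: (@le_trans _ _ (\sum_(i < d) t ^+ 2)).
  apply: ler_sum => i _; rewrite -real_normK ?num_real//.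
  by rewrite ler_pXn2r// nnegrE.
rewrite sumr_const card_ord -[leLHS]mulr_natl exprMn ler_wpM2r ?sqr_ge0//.
by rewrite -natrX ler_nat; case: d => // n; rewrite expnS expn1 leq_pmulr.
Qed.

Lemma small_scale v (e : R) : 0 < e -> exists2 t, 0 < t & enorm (t *: v) < e.
Proof.
move=> e0; have v0 := enorm_ge0 v.
exists (e / (1 + enorm v)); first by rewrite divr_gt0// ltr_pwDl.
have e'0 := ltW e0.
rewrite enorm_lt// sqnZ -enorm_sqr -exprMn ltr_pXn2r// ?nnegrE//.
  by rewrite -mulrA gtr_pMr// ltr_pdivrMl ?mulr1 ?ltrDr// ltr_pwDl.
by rewrite mulr_ge0// divr_ge0 ?addr_ge0.
Qed.

Definition edges X : 'M[R]_(k, d) :=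
  \matrix_(i < k) (row (lift ord0 i) X - row ord0 X).

Definition gram X : 'M[R]_k := edges X *m (edges X)^T.

Definition half_sqn X : 'rV[R]_k := \row_i (gram X i i / 2).

(** The barycentric weights of the circumcentre on the points other than the first:
    row 0 of X plus a combination a of the edges is equidistant from all the points
    exactly when a solves this linear system. *)
Definition bary X : 'rV[R]_k := half_sqn X *m invmx (gram X).

Definition ccenter X : 'rV[R]_d := row ord0 X + bary X *m edges X.

Definition sqradius X : R := (bary X *m (half_sqn X)^T) ord0 ord0.

Lemma row_edges X i : row i (edges X) = row (lift ord0 i) X - row ord0 X.
Proof. by rewrite rowK. Qed.

Lemma gram_unit X : row_free (edges X) = (gram X \in unitmx).
Proof.
apply/idP/idP => [fX|uX].
  rewrite -row_free_unit; apply/inj_row_free => v.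
  rewrite /gram mulmxA => h.
  have : sqn (v *m edges X) = 0 by rewrite sqnE trmx_mul mulmxA h mul0mx mxE.
  by move=> /sqn_eq0 /eqP; rewrite mulmx_free_eq0// => /eqP.
rewrite -[row_free _]/(\rank _ == k) eqn_leq rank_leq_row/=.
move: uX; rewrite -row_full_unit => /eqP rG.
by rewrite -{1}rG mxrankM_maxl.
Qed.

(** The definition asks for an affine space of dimension exactly k-1, hence the completion
    of the span of dependent edges to rank k-1, which exists because k <= d. *)
Lemma general_positionE X : (0 < k <= d)%N ->
  general_position X <-> row_free (edges X).
Proof.
move=> /andP[k0 kd]; split=> [gp|fX].
  rewrite -row_leq_rank leqNgt; apply/negP => rk; apply: gp.
  have rk' : (\rank (edges X) <= k.-1)%N by rewrite -ltnS prednK.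
  exists (row ord0 X), (pid_mx k.-1 *m row_ebase (edges X)).
    rewrite mxrankMfree; last by rewrite row_free_unit row_ebase_unit.
    by rewrite rank_pid_mx ?prednK// (leq_trans _ kd)// leq_pred.
  suff sub : (edges X <= (pid_mx k.-1 : 'M[R]_d) *m row_ebase (edges X))%MS.
    move=> i; case: (unliftP ord0 i) => [j ->|->]; last by rewrite subrr sub0mx.
    by rewrite -row_edges; apply: submx_trans sub; exact: row_sub.
  rewrite -{1}(mulmx_ebase (edges X)) -mulmxA.
  have -> : (pid_mx (\rank (edges X)) : 'M[R]_(k, d)) =
      (pid_mx (\rank (edges X)) : 'M[R]_(k, d)) *m (pid_mx k.-1 : 'M[R]_d).
    rewrite mul_pid_mx; congr pid_mx; apply/esym.
    by rewrite (minn_idPl rk') (minn_idPr _)// (leq_trans (ltnW rk)).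
  by rewrite -mulmxA mulmxA submxMl.
move=> [p [U rU sub]].
have : (edges X <= U)%MS.
  apply/row_subP => i; rewrite row_edges.
  have -> : row (lift ord0 i) X - row ord0 X =
    (row (lift ord0 i) X - p) - (row ord0 X - p) by rewrite opprB addrA subrK.
  by rewrite addmx_sub// eqmx_opp.
move=> /mxrankS; move: fX => /eqP ->; rewrite -rU ltnn//.
Qed.

Lemma mul_row_edges (l : 'rV[R]_(k.+1)) X : \sum_i l ord0 i = 1 ->
  l *m X = row ord0 X + (\row_i l ord0 (lift ord0 i)) *m edges X.
Proof.
rewrite big_ord_recl => l1.
rewrite [l *m X]mulmx_sum_row big_ord_recl mulmx_sum_row.
have -> : l ord0 ord0 = 1 - \sum_(i < k) l ord0 (lift ord0 i) by rewrite -l1 addrK.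
rewrite scalerBl scale1r -addrA; congr (_ + _).
rewrite scaler_suml addrC -sumrB; apply: eq_bigr => i _.
by rewrite row_edges mxE scalerBr.
Qed.

(** The last k barycentric weights determine the first one. *)
Definition weights a : 'rV[R]_(k.+1) :=
  \row_i if unlift ord0 i is Some j then a ord0 j else 1 - \sum_j a ord0 j.

Lemma weights0 a : weights a ord0 ord0 = 1 - \sum_j a ord0 j.
Proof. by rewrite mxE unlift_none. Qed.

Lemma weightsS a i : weights a ord0 (lift ord0 i) = a ord0 i.
Proof. by rewrite mxE liftK. Qed.

Lemma sum_weights a : \sum_i weights a ord0 i = 1.
Proof.
rewrite big_ord_recl weights0 [X in _ + X](eq_bigr (a ord0)) ?subrK// => i _.
exact: weightsS.
Qed.

Lemma mul_weights a X : weights a *m X = row ord0 X + a *m edges X.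
Proof.
rewrite mul_row_edges ?sum_weights//; congr (_ + _ *m _).
by apply/rowP => i; rewrite mxE weightsS.
Qed.

Lemma affine_hullE X v :
  affine_hull X v <-> exists a, v = row ord0 X + a *m edges X.
Proof.
split=> [[l l1 ->]|[a ->]].
  by exists (\row_i l ord0 (lift ord0 i)); rewrite mul_row_edges.
by exists (weights a); [exact: sum_weights|rewrite mul_weights].
Qed.

Lemma convex_hullE X v : convex_hull X v <->
  exists a, [/\ forall i, 0 <= a ord0 i, \sum_i a ord0 i <= 1 &
                v = row ord0 X + a *m edges X].
Proof.
split=> [[l [l0 l1] ->]|[a [a0 a1 ->]]].
  exists (\row_i l ord0 (lift ord0 i)); rewrite mul_row_edges//; split=> //.
    by move=> i; rewrite mxE.
  by under eq_bigr do rewrite mxE; rewrite -l1 big_ord_recl lerDr.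
exists (weights a); last by rewrite mul_weights.
split; last exact: sum_weights.
move=> i; case: (unliftP ord0 i) => [j ->|->]; first by rewrite weightsS.
by rewrite weights0 subr_ge0.
Qed.

Lemma edges_inj X a b : row_free (edges X) ->
  row ord0 X + a *m edges X = row ord0 X + b *m edges X -> a = b.
Proof. by move=> fX /addrI /(row_free_inj fX). Qed.

Lemma sqn_comb X a : sqn (a *m edges X) = (a *m gram X *m a^T) ord0 ord0.
Proof. by rewrite sqnE trmx_mul !mulmxA. Qed.

Lemma gram_diag X i : gram X i i = sqn (row i (edges X)).
Proof. by rewrite mxE; apply: eq_bigr => j _; rewrite !mxE expr2. Qed.

(** In the difference of the squared distances to two vertices the quadratic terms cancel,
    so that equidistance is a linear condition on the weights. *)
Lemma sqn_edgeB X a i :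
  sqn (row i (edges X) - a *m edges X) =
  sqn (a *m edges X) + 2 * (half_sqn X ord0 i - (a *m gram X) ord0 i).
Proof.
have -> : (a *m gram X) ord0 i = \sum_j (a *m edges X) ord0 j * edges X i j.
  by rewrite mulmxA mxE; apply: eq_bigr => j _; rewrite [X in _ * X]mxE.
rewrite mxE mulrBr mulrCA divff ?mulr1 ?pnatr_eq0// gram_diag.
rewrite mulr_sumr -sumrB -big_split/=; apply: eq_bigr => j _; rewrite !mxE.
ring.
Qed.

Lemma equidistantE X a : row_free (edges X) ->
  (exists s, forall i, enorm (row i X - (row ord0 X + a *m edges X)) = s) <->
  a = bary X.
Proof.
move=> fX; have uX : gram X \in unitmx by rewrite -gram_unit.
have dS i : row (lift ord0 i) X - (row ord0 X + a *m edges X) =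
    row i (edges X) - a *m edges X by rewrite row_edges opprD addrA.
have d0 : row ord0 X - (row ord0 X + a *m edges X) = - (a *m edges X).
  by rewrite opprD addrA subrr add0r.
transitivity (a *m gram X = half_sqn X); last first.
  by rewrite /bary; split=> [<-|->]; [rewrite mulmxK|rewrite mulmxKV].
split=> [[s hs]|h].
  apply/rowP => i.
  have := hs (lift ord0 i); rewrite -(hs ord0) dS d0 => /enorm_eq.
  rewrite sqnN sqn_edgeB -[RHS]addr0 => /addrI /eqP.
  by rewrite mulf_eq0 pnatr_eq0/= subr_eq0 => /eqP.
exists (enorm (a *m edges X)) => i.
case: (unliftP ord0 i) => [j ->|->]; apply/enorm_eq.
  by rewrite dS sqn_edgeB h subrr mulr0 addr0.
by rewrite d0 sqnN.
Qed.

Lemma equidistant_center X c : row_free (edges X) -> affine_hull X c ->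
  (exists s, forall i, enorm (row i X - c) = s) -> c = ccenter X.
Proof.
by move=> fX /affine_hullE[a ->] /(equidistantE _ fX) ->.
Qed.

Lemma circumcenterE X : row_free (edges X) -> circumcenter X = ccenter X.
Proof.
move=> fX; rewrite /circumcenter.
have [h1 h2] : [set c | affine_hull X c /\
    exists s, forall i, enorm (row i X - c) = s]
    (get [set c | affine_hull X c /\ exists s, forall i, enorm (row i X - c) = s]).
  apply: getPex; exists (ccenter X); split.
    by apply/affine_hullE; exists (bary X).
  exact/equidistantE.
exact: equidistant_center.
Qed.

Lemma sqn_bary X : row_free (edges X) -> sqn (bary X *m edges X) = sqradius X.
Proof.
move=> fX; rewrite sqn_comb {1}/bary mulmxKV -?gram_unit// /sqradius.
have -> : half_sqn X *m (bary X)^T = (bary X *m (half_sqn X)^T)^T.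
  by rewrite [RHS]trmx_mul trmxK.
by rewrite mxE.
Qed.

Lemma sqradiusE X : row_free (edges X) -> circumradius X ^+ 2 = sqradius X.
Proof.
move=> fX; rewrite /circumradius enorm_sqr circumcenterE// /ccenter.
by rewrite opprD addrA subrr add0r sqnN sqn_bary.
Qed.

Lemma sqn_ccenter X i : row_free (edges X) -> sqn (row i X - ccenter X) = sqradius X.
Proof.
move=> fX; have [_ /(_ erefl)[s hs]] := equidistantE (bary X) fX.
rewrite -sqn_bary//; rewrite -[X in sqn X = _]/(row i X - (row ord0 X + bary X *m edges X)).
rewrite -enorm_sqr hs -(hs ord0) enorm_sqr -sqnN opprB addrAC subrr add0r//.
Qed.

(** The weights parametrise the affine hull by a linear isomorphism, so that the relative
    interior corresponds to the interior of the simplex of weights. *)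
Lemma relint_convex_hullE X a : row_free (edges X) ->
  relint_convex_hull X (row ord0 X + a *m edges X) <->
  (forall i, 0 < a ord0 i) /\ \sum_i a ord0 i < 1.
Proof.
move=> fX; split.
  case=> /convex_hullE[b [b0 b1 /(edges_inj fX) ab]]; subst b; case=> e e0 he.
  have move_in (w : 'rV[R]_k) : exists2 t, 0 < t & (forall i, 0 <= a ord0 i + t * w ord0 i) /\
      \sum_i (a ord0 i + t * w ord0 i) <= 1.
    have [t t0 ht] := small_scale (w *m edges X) e0.
    exists t => //.
    have /he : affine_hull X (row ord0 X + (a + t *: w) *m edges X).
      by apply/affine_hullE; exists (a + t *: w).
    rewrite opprD addrACA subrr add0r -mulmxBl addrAC subrr add0r -scalemxAl.
    move=> /(_ ht) /convex_hullE[b' [b0' b1' /(edges_inj fX) E]].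
    by subst b'; split=> [i|]; [have := b0' i|move: b1'; under eq_bigr do rewrite !mxE]; rewrite ?mxE.
  split.
    (* moving away from a vertex of zero weight leaves the hull *)
    move=> i; rewrite lt_neqAle b0 andbT; apply/eqP => ai0.
    have [t t0 [/(_ i) + _]] := move_in (- delta_mx ord0 i).
    by rewrite -ai0 !mxE !eqxx mulrN mulr1 add0r oppr_ge0 leNgt t0.
  rewrite lt_neqAle b1 andbT; apply/eqP => a1.
  have [t t0 [_]] := move_in a.
  by rewrite big_split/= -mulr_sumr a1 mulr1 gerDl leNgt t0.
move=> [a0 a1]; split.
  by apply/convex_hullE; exists a; split=> // [i|]; exact: ltW.
(* M inverts the parametrisation by weights, K bounds the size of M, and delta is the
   smallest weight, the first one included *)
pose M := (edges X)^T *m invmx (gram X).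
pose K := 1 + \sum_(i < k) \sum_(j < d) `|M j i|.
have K0 : 0 < K by rewrite ltr_pwDl// sumr_ge0// => i _; rewrite sumr_ge0.
pose delta := \big[Num.min/(1 - \sum_i a ord0 i)]_i a ord0 i.
have delta0 : 0 < delta by rewrite lt_bigmin ?subr_gt0//.
exists (delta / K); first exact: divr_gt0.
move=> v /affine_hullE[b ->].
rewrite opprD addrACA subrr add0r -mulmxBl => hw.
apply/convex_hullE; exists b.
pose w := (b - a) *m edges X.
have baE : b - a = w *m M.
  by rewrite /w /M mulmxA -[_ *m _ *m (edges X)^T]mulmxA mulmxK// -gram_unit.
have wK : \sum_i `|(b - a) ord0 i| <= delta.
  apply: (@le_trans _ _ (enorm w * K)); last by rewrite -ler_pdivlMr// ltW.
  rewrite mulrDr mulr1; apply: ler_wpDl; first exact: enorm_ge0.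
  rewrite mulr_sumr; apply: ler_sum => i _; rewrite baE mxE mulr_sumr.
  apply: (le_trans (ler_norm_sum _ _ _)); apply: ler_sum => j _.
  by rewrite normrM ler_wpM2r// coord_le_enorm.
have bE i : b ord0 i = a ord0 i + (b - a) ord0 i.
  by rewrite [X in _ + X]mxE [X in _ + (_ + X)]mxE addrCA subrr addr0.
split=> //.
  move=> i; rewrite bE.
  rewrite addrC -lerBlDr sub0r.
  have : `|(b - a) ord0 i| <= a ord0 i.
    apply: le_trans (bigmin_le_cond _ _ (isT : xpredT i)).
    apply: le_trans wK; rewrite (bigD1 i)//= lerDl; exact: sumr_ge0.
  by rewrite ler_norml => /andP[].
have -> : \sum_i b ord0 i = \sum_i a ord0 i + \sum_i (b - a) ord0 i.
  by rewrite -big_split/=; apply: eq_bigr => i _.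
rewrite addrC -lerBrDr; apply: le_trans (bigmin_le_id _ _ _ _).
apply: le_trans wK; apply: ler_sum => i _; exact: ler_norm.
Qed.

(** The tuples on which the indicator h_r equals 1. *)
Definition hset (r : R) : set 'M[R]_(k.+1, d) :=
  [set X | [/\ general_position X, relint_convex_hull X (circumcenter X) &
            circumradius X <= r]].

Lemma hsetP (r : R) X : (0 < k <= d)%N -> 0 <= r ->
  hset r X <-> [/\ gram X \in unitmx, forall i, 0 < bary X ord0 i,
     \sum_i bary X ord0 i < 1 & sqradius X <= r ^+ 2].
Proof.
move=> kd r0; rewrite /hset/=; split.
  move=> [/(general_positionE _ kd) fX].
  rewrite circumcenterE// => /(relint_convex_hullE _ fX)[h1 h2] hr.
  split=> //; first by rewrite -gram_unit.
  by rewrite -sqradiusE// ler_pXn2r// nnegrE enorm_ge0.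
rewrite -gram_unit => -[fX h1 h2 hr]; split.
- exact/general_positionE.
- by rewrite circumcenterE//; apply/relint_convex_hullE.
- by rewrite -(@ler_pXn2r _ 2)// ?nnegrE ?enorm_ge0// sqradiusE.
Qed.

Lemma hset_center (r : R) X : (0 < k <= d)%N -> 0 <= r -> hset r X ->
  [/\ row_free (edges X), sqradius X <= r ^+ 2 &
   forall i, sqn (row i X - ccenter X) = sqradius X].
Proof.
move=> kd r0 /(hsetP _ kd r0)[]; rewrite -gram_unit => fX _ _ hr.
by split=> // i; exact: sqn_ccenter.
Qed.

Lemma enorm_le_2r (r : R) u v : 0 <= r -> sqn u <= r ^+ 2 -> sqn v <= r ^+ 2 ->
  enorm (u - v) <= 2 * r.
Proof.
move=> r0 hu hv; rewrite enorm_le ?mulr_ge0//.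
apply: (le_trans (sqnB_le _ _)); rewrite exprMn; lra.
Qed.

Lemma hset_diam (r : R) X i j : (0 < k <= d)%N -> 0 <= r -> hset r X ->
  enorm (row i X - row j X) <= 2 * r.
Proof.
move=> kd r0 /(hset_center kd r0)[fX hr hE].
have -> : row i X - row j X = (row i X - ccenter X) - (row j X - ccenter X).
  by rewrite opprB addrA subrK.
by apply: enorm_le_2r; rewrite ?hE.
Qed.

Lemma edges_sim (r : R) x0 X : edges (r *: X + \matrix_(i < k.+1) x0) = r *: edges X.
Proof. by apply/matrixP => i j; rewrite !mxE; ring. Qed.

Lemma hset_sim (r s : R) x0 X : (0 < k <= d)%N -> 0 < r -> 0 <= s ->
  hset (r * s) (r *: X + \matrix_(i < k.+1) x0) <-> hset s X.
Proof.
move=> kd r0 s0; have rn0 : r != 0 by rewrite gt_eqF.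
have r2u : r ^+ 2 \is a GRing.unit by rewrite unitfE expf_neq0.
have r2n0 : 0 < r ^+ 2 by rewrite exprn_gt0.
set Y := _ + _.
have gE : gram Y = r ^+ 2 *: gram X.
  by rewrite /gram edges_sim linearZ/= -scalemxAl -scalemxAr scalerA expr2.
have hE : half_sqn Y = r ^+ 2 *: half_sqn X.
  apply/rowP => i; rewrite /half_sqn gE !mxE; exact/esym/mulrA.
have uE : (gram Y \in unitmx) = (gram X \in unitmx).
  by rewrite gE unitmxZ.
rewrite !hsetP//; last by rewrite mulr_ge0// ltW.
have bE : gram X \in unitmx -> bary Y = bary X.
  move=> uX; rewrite /bary hE gE -scalemxAl invmxZ//.
    by rewrite -scalemxAr scalerA mulfV ?scale1r// gt_eqF.
  by rewrite unitmxZ.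
have rE : gram X \in unitmx -> sqradius Y = r ^+ 2 * sqradius X.
  by move=> uX; rewrite /sqradius bE// hE linearZ/= -scalemxAr mxE.
rewrite uE; split=> -[uX].
  by rewrite bE// rE// exprMn ler_pM2l.
by split=> //; rewrite ?bE// rE// exprMn ler_pM2l.
Qed.

End geometry.

(** * Sets of tuples that can be recognised from nearby tuples *)

Section regular_sets.
Variable R : realType.

(** Membership of X in U is decided by every X' close enough to X, through sets that do not
    depend on X.  For open U one takes the X' with a whole ball inside U.  A configuration
    can then be replaced by the grid cells that it occupies. *)
Definition approximable m n (U : set 'M[R]_(m, n)) :=
  exists Up : nat -> set 'M[R]_(m, n), forall X, \forall p \near \oo,
    forall X', ball X p.+1%:R^-1 X' -> (Up p X' <-> U X).

Lemma approximable_open m n (U : set 'M[R]_(m, n)) : open U -> approximable U.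
Proof.
move=> oU; exists (fun p X => ball X p.+1%:R^-1 `<=` U) => X.
have [UX|nUX] := pselect (U X); last first.
  apply: nearW => p X' XX'; split=> // h; exfalso; apply: nUX; apply: h; exact: ball_sym.
have := open_nbhs_nbhs (conj oU UX); rewrite -nbhs_ballE => -[e /= e0 Xe].
have e20 : 0 < e / 2 by rewrite divr_gt0.
apply: filterS (near_infty_natSinv_lt (PosNum e20)) => p /= pe X' XX'.
split=> // _ Y X'Y; apply: Xe; rewrite (splitr e).
by apply: ball_triangle (le_ball (ltW pe) XX') (le_ball (ltW pe) X'Y).
Qed.

Lemma approximableC m n (U : set 'M[R]_(m, n)) : approximable U -> approximable (~` U).
Proof.
move=> [Up h]; exists (fun p => ~` Up p) => X.
by apply: filterS (h X) => p hp X' /hp H; split=> nU /H.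
Qed.

Lemma approximableI m n (U V : set 'M[R]_(m, n)) :
  approximable U -> approximable V -> approximable (U `&` V).
Proof.
move=> [Up hU] [Vp hV]; exists (fun p => Up p `&` Vp p) => X.
apply: filterS2 (hU X) (hV X) => p h1 h2 X' XX'.
by have H1 := h1 _ XX'; have H2 := h2 _ XX'; split=> -[/H1 ? /H2 ?].
Qed.

(** Boolean combinations of strict polynomial inequalities are regular. *)
Definition regular m n (U : set 'M[R]_(m, n)) := approximable U /\ measurable U.

Lemma regular_open m n (U : set 'M[R]_(m, n)) : open U -> regular U.
Proof. by move=> oU; split; [exact: approximable_open|exact: sub_sigma_algebra]. Qed.

Lemma regularC m n (U : set 'M[R]_(m, n)) : regular U -> regular (~` U).
Proof. by move=> [aU mU]; split; [exact: approximableC|exact: measurableC]. Qed.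

Lemma regularI m n (U V : set 'M[R]_(m, n)) : regular U -> regular V -> regular (U `&` V).
Proof. by move=> [? ?] [? ?]; split; [exact: approximableI|exact: measurableI]. Qed.

Lemma regularT m n : regular [set: 'M[R]_(m, n)].
Proof. by apply: regular_open; exact: openT. Qed.

Lemma forall_closed (T : Type) (Q : set T -> Prop) (I : finType) (U : I -> set T) :
  Q setT -> (forall A B, Q A -> Q B -> Q (A `&` B)) -> (forall i, Q (U i)) ->
  Q [set X | forall i, U i X].
Proof.
move=> QT QI QU.
suff H (s : seq I) : Q [set X | forall i, i \in s -> U i X].
  have := H (enum I); congr Q; apply/seteqP.
  by split=> X /= hX i => [|_]; apply: hX; rewrite mem_enum.
elim: s => [|i s IHs].
  by have := QT; congr Q; apply/seteqP; split=> X.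
have := QI _ _ (QU i) IHs; congr Q; apply/seteqP; split=> X /=.
  by case=> hi hs j; rewrite inE => /orP[/eqP->//|]; exact: hs.
move=> hX; split; first by apply: hX; rewrite inE eqxx.
by move=> j js; apply: hX; rewrite inE js orbT.
Qed.

Lemma regular_forall m n (I : finType) (U : I -> set 'M[R]_(m, n)) :
  (forall i, regular (U i)) -> regular [set X | forall i, U i X].
Proof. by apply: forall_closed; [exact: regularT|move=> *; exact: regularI]. Qed.

Lemma open_lt (T : topologicalType) (f g : T -> R) : continuous f -> continuous g ->
  open [set X | f X < g X].
Proof.
move=> cf cg.
have -> : [set X | f X < g X] = (g \- f) @^-1` [set x | 0 < x].
  by apply/seteqP; split=> X /=; rewrite subr_gt0.
apply: open_comp; last exact: open_gt.
by move=> X _; apply: (@continuousB R R^o); [exact: cg|exact: cf].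
Qed.

Lemma open_forall (T : topologicalType) (I : finType) (U : I -> set T) :
  (forall i, open (U i)) -> open [set X | forall i, U i X].
Proof. by apply: forall_closed; [exact: openT|move=> *; exact: openI]. Qed.

Lemma regular_lt m n (f g : 'M[R]_(m, n) -> R) : continuous f -> continuous g ->
  regular [set X | f X < g X].
Proof. by move=> cf cg; apply: regular_open; exact: open_lt. Qed.

Lemma regular_le m n (f g : 'M[R]_(m, n) -> R) : continuous f -> continuous g ->
  regular [set X | f X <= g X].
Proof.
move=> cf cg; have := regularC (regular_lt cg cf).
by congr regular; apply/seteqP; split=> X /=; rewrite leNgt => /negP.
Qed.

Lemma continuousMR (T : topologicalType) (f g : T -> R) :
  continuous f -> continuous g -> continuous (fun x => f x * g x).
Proof. by move=> cf cg x; apply: cvgM; [exact: cf|exact: cg]. Qed.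

Lemma continuousDR (T : topologicalType) (f g : T -> R) :
  continuous f -> continuous g -> continuous (fun x => f x + g x).
Proof. by move=> cf cg x; apply: cvgD; [exact: cf|exact: cg]. Qed.

Lemma continuous_maxR (T : topologicalType) (f g : T -> R) :
  continuous f -> continuous g -> continuous (fun x => Num.max (f x) (g x)).
Proof. by move=> cf cg x; apply: (@continuous_max _ _ f g); [exact: cf|exact: cg]. Qed.

Lemma continuousBR (T : topologicalType) (f g : T -> R) :
  continuous f -> continuous g -> continuous (fun x => f x - g x).
Proof. by move=> cf cg x; apply: cvgB; [exact: cf|exact: cg]. Qed.

Lemma continuous_cstR (T : topologicalType) (c : R) : continuous (fun _ : T => c).
Proof. by move=> x; exact: cvg_cst. Qed.

Section continuity.
Variable T : topologicalType.

Lemma continuous_bigsum (I : Type) (s : seq I) (f : I -> T -> R) :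
  (forall i, continuous (f i)) -> continuous (fun x => \sum_(i <- s) f i x).
Proof.
move=> cf; elim: s => [|i s IHs] x.
  under eq_fun do rewrite big_nil; exact: cvg_cst.
under eq_fun do rewrite big_cons; apply: cvgD; [exact: cf|exact: IHs].
Qed.

Lemma continuous_bigprod (I : Type) (s : seq I) (f : I -> T -> R) :
  (forall i, continuous (f i)) -> continuous (fun x => \prod_(i <- s) f i x).
Proof.
move=> cf; elim: s => [|i s IHs] x.
  under eq_fun do rewrite big_nil; exact: cvg_cst.
under eq_fun do rewrite big_cons; apply: cvgM; [exact: cf|exact: IHs].
Qed.

Definition entry_continuous p q (F : T -> 'M[R]_(p, q)) :=
  forall i j, continuous (fun x => F x i j).

Lemma entry_continuous_mul p q s (F : T -> 'M[R]_(p, q)) (G : T -> 'M[R]_(q, s)) :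
  entry_continuous F -> entry_continuous G -> entry_continuous (fun x => F x *m G x).
Proof.
move=> cF cG i j; under eq_fun do rewrite mxE.
by apply: continuous_bigsum => l x; apply: cvgM; [exact: cF|exact: cG].
Qed.

Lemma entry_continuous_tr p q (F : T -> 'M[R]_(p, q)) :
  entry_continuous F -> entry_continuous (fun x => (F x)^T).
Proof. by move=> cF i j; under eq_fun do rewrite mxE; exact: cF. Qed.

Lemma entry_continuousB p q (F G : T -> 'M[R]_(p, q)) :
  entry_continuous F -> entry_continuous G -> entry_continuous (fun x => F x - G x).
Proof.
move=> cF cG i j; under eq_fun do rewrite !mxE.
by move=> x; apply: cvgB; [exact: cF|exact: cG].
Qed.

Lemma entry_continuousZ p q (f : T -> R) (F : T -> 'M[R]_(p, q)) :
  continuous f -> entry_continuous F -> entry_continuous (fun x => f x *: F x).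
Proof.
move=> cf cF i j; under eq_fun do rewrite mxE.
by move=> x; apply: cvgM; [exact: cf|exact: cF].
Qed.

Lemma entry_continuous_row p q (F : T -> 'M[R]_(p, q)) i :
  entry_continuous F -> entry_continuous (fun x => row i (F x)).
Proof. by move=> cF i' j; under eq_fun do rewrite mxE; exact: cF. Qed.

Lemma continuous_det p (F : T -> 'M[R]_p) :
  entry_continuous F -> continuous (fun x => \det (F x)).
Proof.
move=> cF; rewrite /determinant; apply: continuous_bigsum => s x.
apply: cvgM; first exact: cvg_cst.
by apply: continuous_bigprod => i; exact: cF.
Qed.

Lemma entry_continuous_adj p (F : T -> 'M[R]_p) :
  entry_continuous F -> entry_continuous (fun x => \adj (F x)).
Proof.
move=> cF i j; under eq_fun do rewrite mxE; rewrite /cofactor.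
move=> x; apply: cvgM; first exact: cvg_cst.
apply: continuous_det => i' j'; under eq_fun do rewrite !mxE; exact: cF.
Qed.

End continuity.

Section hset_regular.
Variables (T : topologicalType) (k d : nat).
Variable F : T -> 'M[R]_(k.+1, d).
Hypothesis cF : entry_continuous F.

Lemma entry_continuous_edges : entry_continuous (fun x => edges (F x)).
Proof.
by move=> i j; under eq_fun do rewrite !mxE; move=> x; apply: cvgB; exact: cF.
Qed.

Lemma entry_continuous_gram : entry_continuous (fun x => gram (F x)).
Proof.
apply: entry_continuous_mul; first exact: entry_continuous_edges.
apply: entry_continuous_tr; exact: entry_continuous_edges.
Qed.

Lemma entry_continuous_half_sqn : entry_continuous (fun x => half_sqn (F x)).
Proof.
move=> i j; under eq_fun do rewrite mxE; move=> x.
by apply: cvgM; [exact: entry_continuous_gram|exact: cvg_cst].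
Qed.

End hset_regular.

Section hset_polynomial.
Variables (k d : nat).
Implicit Types X : 'M[R]_(k.+1, d).

(** By Cramer's rule the weights of the circumcentre and its squared radius are fractions
    with denominator gdet; their numerators are polynomials in the coordinates. *)
Definition gdet X := \det (gram X).
Definition bary_num X := half_sqn X *m \adj (gram X).
Definition radius_num X := (bary_num X *m (half_sqn X)^T) ord0 ord0.

Lemma gram_unitE X : (gram X \in unitmx) = (gdet X != 0).
Proof. by rewrite unitmxE unitfE. Qed.

Lemma baryE X : gdet X != 0 -> bary X = (gdet X)^-1 *: bary_num X.
Proof.
move=> u; rewrite /bary /invmx gram_unitE u -scalemxAr.
by rewrite -/(gdet X).
Qed.

Lemma sqradius_num X : gdet X != 0 -> sqradius X = (gdet X)^-1 * radius_num X.
Proof. by move=> u; rewrite /sqradius baryE// -scalemxAl mxE. Qed.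

(** Clearing denominators turns membership in the support of h_r into polynomial
    inequalities between the coordinates. *)
Lemma hset_numP (r : R) X : (0 < k <= d)%N -> 0 <= r -> hset r X <->
  [/\ 0 < gdet X ^+ 2, forall i, 0 < gdet X * bary_num X ord0 i,
    gdet X * \sum_i bary_num X ord0 i < gdet X ^+ 2 &
    gdet X * radius_num X <= gdet X ^+ 2 * r ^+ 2].
Proof.
move=> kd r0; rewrite hsetP//.
have [D0|Dn0] := eqVneq (gdet X) 0.
  split=> [[]|[]]; first by rewrite gram_unitE D0 eqxx.
  by rewrite D0 expr0n/= ltxx.
have D2 : 0 < gdet X ^+ 2 by rewrite exprn_even_gt0.
have mulDD x : gdet X * x = gdet X ^+ 2 * ((gdet X)^-1 * x).
  by rewrite expr2 -mulrA mulVKf.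
have sE : \sum_i bary X ord0 i = (gdet X)^-1 * \sum_i bary_num X ord0 i.
  by rewrite baryE// mulr_sumr; apply: eq_bigr => i _; rewrite mxE.
rewrite gram_unitE Dn0 D2 sE sqradius_num// !mulDD ler_pM2l//.
rewrite gtr_pMr//.
split=> -[_ h1 h2 h3]; split=> // i; have := h1 i.
  by rewrite baryE// mxE => ?; rewrite mulDD pmulr_rgt0.
by rewrite mulDD pmulr_rgt0// baryE// [X in _ -> 0 < X]mxE.
Qed.

Definition in_circumball X : set 'rV[R]_d :=
  [set y | sqn (y - ccenter X) <= sqradius X].

Lemma in_circumball_numP X y : gdet X != 0 -> in_circumball X y <->
  sqn (gdet X *: (y - row ord0 X) - bary_num X *m edges X) <= gdet X * radius_num X.
Proof.
move=> Dn0; rewrite /in_circumball/= /ccenter opprD addrA baryE// sqradius_num//.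
have D2 : 0 < gdet X ^+ 2 by rewrite exprn_even_gt0.
rewrite -(ler_pM2l D2) -sqnZ scalerBr -scalemxAl scalerA mulfV// scale1r.
by rewrite expr2 -mulrA mulVKf.
Qed.

End hset_polynomial.

Section regularity.
Variables (k d : nat).
Hypothesis kd : (0 < k <= d)%N.

Let cid : entry_continuous (fun X : 'M[R]_(k.+1, d) => X).
Proof. by move=> i j; exact: coord_continuous. Qed.

Lemma continuous_gdet (T : topologicalType) (F : T -> 'M[R]_(k.+1, d)) :
  entry_continuous F -> continuous (fun x => gdet (F x)).
Proof. by move=> cF; apply: continuous_det; exact: entry_continuous_gram. Qed.

Lemma entry_continuous_bary_num (T : topologicalType) (F : T -> 'M[R]_(k.+1, d)) :
  entry_continuous F -> entry_continuous (fun x => bary_num (F x)).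
Proof.
move=> cF; apply: entry_continuous_mul; first exact: entry_continuous_half_sqn.
by apply: entry_continuous_adj; exact: entry_continuous_gram.
Qed.

Lemma continuous_radius_num (T : topologicalType) (F : T -> 'M[R]_(k.+1, d)) :
  entry_continuous F -> continuous (fun x => radius_num (F x)).
Proof.
move=> cF; apply: entry_continuous_mul; first exact: entry_continuous_bary_num.
by apply: entry_continuous_tr; exact: entry_continuous_half_sqn.
Qed.

Lemma regular_hset (r : R) : 0 <= r -> regular (@hset R k d r).
Proof.
move=> r0.
have cD := continuous_gdet cid; have cD2 := continuousMR cD cD.
have cB := entry_continuous_bary_num cid.
have H1 := regular_lt (continuous_cstR (c := 0)) cD2.
have H2 := regular_forall (fun i => regular_lt (continuous_cstR (c := 0))
  (continuousMR cD (cB ord0 i))).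
have H3 := regular_lt (continuousMR cD (continuous_bigsum (s := index_enum 'I_k)
   (fun i => cB ord0 i))) cD2.
have H4 := regular_le (continuousMR cD (continuous_radius_num cid))
  (continuousMR cD2 (continuous_cstR (c := r ^+ 2))).
have := regularI (regularI H1 H2) (regularI H3 H4).
congr regular; apply/seteqP; split=> X /=.
  by move=> [[h1 h2] [h3 h4]]; apply/hset_numP => //; rewrite expr2.
by move=> /(hset_numP _ kd r0); rewrite expr2 => -[].
Qed.

Definition consr m (y : 'rV[R]_d) (X : 'M[R]_(m, d)) : 'M[R]_(m.+1, d) :=
  \matrix_(i < m.+1) if unlift ord0 i is Some j then row j X else y.

Definition tailr m (Z : 'M[R]_(m.+1, d)) : 'M[R]_(m, d) :=
  \matrix_(i < m) row (lift ord0 i) Z.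

Lemma row_consr0 m y (X : 'M[R]_(m, d)) : row ord0 (consr y X) = y.
Proof. by rewrite rowK unlift_none. Qed.

Lemma row_consrS m y (X : 'M[R]_(m, d)) i : row (lift ord0 i) (consr y X) = row i X.
Proof. by rewrite rowK liftK. Qed.

Lemma consrK m y (X : 'M[R]_(m, d)) : tailr (consr y X) = X.
Proof. by apply/row_matrixP => i; rewrite rowK row_consrS. Qed.

(** The first row is a point that spoils the tuple formed by the other rows.  The ball is
    closed because at a critical point all further points are strictly farther away. *)
Definition circumball_set : set 'M[R]_(k.+2, d) :=
  [set Z | gdet (tailr Z) != 0 /\ in_circumball (tailr Z) (row ord0 Z)].

Lemma regular_circumball : regular circumball_set.
Proof.
have cid2 : entry_continuous (fun X : 'M[R]_(k.+2, d) => X).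
  by move=> i j; exact: coord_continuous.
have cT : entry_continuous (fun Z : 'M[R]_(k.+2, d) => tailr Z).
  by move=> i j; under eq_fun do rewrite !mxE; exact: cid2.
have cD := continuous_gdet cT; have cD2 := continuousMR cD cD.
have cN := entry_continuous_mul (entry_continuous_bary_num cT) (entry_continuous_edges cT).
have H1 := regular_lt (continuous_cstR (c := 0)) cD2.
have cl := entry_continuousB (entry_continuousZ cD
  (entry_continuousB (entry_continuous_row (i := ord0) cid2)
                     (entry_continuous_row (i := ord0) cT))) cN.
have H2 := regular_le (continuous_bigsum (s := index_enum 'I_d)
    (fun j => continuousMR (cl ord0 j) (cl ord0 j)))
  (continuousMR cD (continuous_radius_num cT)).
have := regularI H1 H2; congr regular; apply/seteqP; split=> Z /=; rewrite -expr2 exprn_even_gt0//=.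
  move=> [D h]; split=> //; apply/in_circumball_numP => //.

by move=> [D /(in_circumball_numP _ D) h]; split.
Qed.

End regularity.

End regular_sets.

(** * An open set of tuples that enclose their circumcentre *)

Section witness.
Variables (R : realType) (k d : nat).
Hypothesis kd : (0 < k <= d)%N.

(** All inequalities of [hset_numP] are strict here, so that the set is open. *)
Definition hset_open : set 'M[R]_(k.+1, d) := [set X |
  [/\ 0 < gdet X ^+ 2, forall i, 0 < gdet X * bary_num X ord0 i,
    gdet X * \sum_i bary_num X ord0 i < gdet X ^+ 2 &
    gdet X * radius_num X < gdet X ^+ 2]].

Lemma hset_open_sub : hset_open `<=` hset 1.
Proof.
by move=> X [h1 h2 h3 h4]; apply/hset_numP => //; split=> //; rewrite expr1n mulr1 ltW.
Qed.

Let J : 'M[R]_k := const_mx 1.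
Let K : R := k%:R.
(* this scale makes the circumradius of the simplex below smaller than 1 *)
Let s : R := (K + 3)^-1.

Let K0 : 0 < K. Proof. by rewrite ltr0n; case/andP: kd. Qed.

Let mulJ m : (const_mx 1 : 'M[R]_(m, k)) *m J = K *: const_mx 1.
Proof.
apply/matrixP => i j; rewrite !mxE; under eq_bigr do rewrite !mxE mulr1.
by rewrite sumr_const card_ord mulr1.
Qed.

(** The simplex with vertices 0 and s (e_i + e_1 + ... + e_k) is acute: its circumcentre
    gives every vertex a positive weight. *)
Definition acute : 'M[R]_(k, d) := s *: ((1%:M + J) *m pid_mx k).

Lemma cons00 (y : 'M[R]_(k, d)) j : cons0 y ord0 j = 0.
Proof. by rewrite mxE; case: splitP => // i' _; rewrite mxE. Qed.

Lemma cons0S (y : 'M[R]_(k, d)) i j : cons0 y (lift ord0 i) j = y i j.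
Proof.
rewrite mxE; case: splitP => [i'|i' /= /eqP]; first by rewrite ord1.
by rewrite /bump/= !add1n eqSS => /eqP/val_inj ->.
Qed.

Lemma edges_cons0 (y : 'M[R]_(k, d)) : edges (cons0 y) = y.
Proof.
apply/row_matrixP => i; rewrite row_edges; apply/rowP => j.
by rewrite !(mxE, cons00, cons0S) subr0 || rewrite 2!mxE cons0S mxE cons00 subr0 mxE.
Qed.

Let G : 'M[R]_k := 1%:M + (K + 2) *: J.

Lemma gram_acute : gram (cons0 acute) = s ^+ 2 *: G.
Proof.
rewrite /gram edges_cons0 /acute linearZ/= -scalemxAl -scalemxAr scalerA -expr2.
congr (_ *: _); rewrite trmx_mul mulmxA -[_ *m pid_mx k *m _]mulmxA.
rewrite tr_pid_mx pid_mx_id; last by case/andP: kd.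
rewrite pid_mx_1 mulmx1 linearD/= trmx1 trmx_const -/J.
rewrite mulmxDl !mulmxDr !mulmx1 !mul1mx mulJ /G -addrA; congr (_ + _).
by apply/matrixP => i j; rewrite !mxE; ring.
Qed.

(* the inverse of a rank-one perturbation of the identity, found from J J = k J *)
Let Ginv : 'M[R]_k := 1%:M - ((K + 2) / (1 + K) ^+ 2) *: J.

Let GGinv : G *m Ginv = 1%:M.
Proof.
have K1 : 1 + K != 0 by rewrite gt_eqF// ltr_pwDl// ltW.
rewrite /G /Ginv mulmxDl !mulmxBr !mulmx1 !mul1mx -!scalemxAl -!scalemxAr mulJ !scalerA.
rewrite -addrA -[RHS]addr0; congr (_ + _).
rewrite addrA -scaleNr -!scalerDl -scalerBl [X in X *: _](_ : _ = 0) ?scale0r//.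
by field.
Qed.

Lemma acute_hset : hset_open (cons0 acute).
Proof.
have K1 : 1 + K != 0 by rewrite gt_eqF// ltr_pwDl// ltW.
have K3 : 0 < K + 3 by rewrite addr_gt0.
have s0 : 0 < s by rewrite invr_gt0.
set X := cons0 acute.
have uX : gram X \in unitmx.
  rewrite gram_acute unitmxZ ?unitfE ?expf_neq0 ?gt_eqF//.
  by case/mulmx1_unit: GGinv.
have Dn0 : gdet X != 0 by rewrite -gram_unitE.
pose al := (K + 3) / (2 * (1 + K) ^+ 2).
pose u : 'rV[R]_k := const_mx 1.
have hE : half_sqn X = (s ^+ 2 * (K + 3) / 2) *: u.
  by apply/rowP => i; rewrite mxE gram_acute !mxE eqxx/=; field.
have bE : bary X = al *: u.
  rewrite /bary; apply: (canLR (mulmxK uX)); rewrite hE gram_acute /G.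
  rewrite -scalemxAr -scalemxAl mulmxDr mulmx1 -scalemxAr mulJ !scalerA.
  rewrite -[X in _ = _ *: (X + _)]scale1r -scalerDl !scalerA; congr (_ *: _).
  by rewrite /al; field.
have al0 : 0 < al by rewrite divr_gt0// mulr_gt0// exprn_gt0// addr_gt0.
have rE : sqradius X = K * al * (s ^+ 2 * (K + 3) / 2).
  rewrite /sqradius bE hE linearZ/= -scalemxAl -scalemxAr !mxE.
  under eq_bigr do rewrite !mxE mulr1.
  by rewrite sumr_const card_ord -/K; ring.
have D2 : 0 < gdet X ^+ 2 by rewrite exprn_even_gt0.
have mulDD x : gdet X * x = gdet X ^+ 2 * ((gdet X)^-1 * x).
  by rewrite expr2 -mulrA mulVKf.
have bi i : (gdet X)^-1 * bary_num X ord0 i = al.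
  have := congr1 (fun M : 'rV[R]_k => M ord0 i) bE.
  by rewrite baryE// [LHS]mxE => ->; rewrite !mxE mulr1.
split=> //.
- by move=> i; rewrite mulDD bi mulr_gt0.
- rewrite mulDD gtr_pMr// mulr_sumr (eq_bigr (fun=> al)); last by move=> i _; exact: bi.
  rewrite sumr_const card_ord -[al *+ k]mulr_natr -/K /al.
  rewrite mulrAC ltr_pdivrMr ?mul1r; last by rewrite mulr_gt0// exprn_gt0// addr_gt0.
  by move: K0; nra.
- rewrite mulDD gtr_pMr// -sqradius_num// rE /al /s.
  rewrite (_ : _ * _ = K / (4 * (1 + K) ^+ 2)); last first.
    by field; rewrite K1 gt_eqF.
  rewrite ltr_pdivrMr ?mul1r; last by rewrite mulr_gt0// exprn_gt0// addr_gt0.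
  by move: K0; nra.
Qed.

Lemma open_hset_open : open hset_open.
Proof.
have cid : entry_continuous (fun X : 'M[R]_(k.+1, d) => X).
  by move=> i j; exact: coord_continuous.
have cD := continuous_gdet cid; have cD2 := continuousMR cD cD.
have cB := entry_continuous_bary_num cid.
have H1 := open_lt (continuous_cstR (c := 0)) cD2.
have H2 i := open_lt (continuous_cstR (c := 0)) (continuousMR cD (cB ord0 i)).
have H3 := open_lt (continuousMR cD (continuous_bigsum (s := index_enum 'I_k)
   (fun i => cB ord0 i))) cD2.
have H4 := open_lt (continuousMR cD (continuous_radius_num cid)) cD2.
have := openI (openI H1 (open_forall H2)) (openI H3 H4).
congr open; apply/seteqP; split=> X /=; rewrite ?expr2; first by move=> [[? ?] [? ?]].
by move=> [].
Qed.

(** This open set of shapes is what makes the limit constant positive. *)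
Lemma hset_box : exists a b : 'M[R]_(k, d), (forall i j, a i j < b i j) /\
  forall y, open_box a b y -> hset 1 (cons0 y).
Proof.
have := open_nbhs_nbhs (conj open_hset_open acute_hset).
rewrite -nbhs_ballE => -[e /= e0 he].
exists (acute - const_mx e), (acute + const_mx e); split.
  by move=> i j; rewrite !mxE ltrBlDr -addrA ltrDl addr_gt0.
move=> y hy; apply: hset_open_sub; apply: he; split=> // i j.
case: (unliftP ord0 i) => [i' ->|->]; last by rewrite !cons00; exact: ballxx.
have E1 : (acute - const_mx e) i' j = acute i' j - e.
  by rewrite mxE [X in _ + X]mxE [X in - X]mxE.
have E2 : (acute + const_mx e) i' j = acute i' j + e by rewrite mxE [X in _ + X]mxE.
by rewrite !cons0S /ball/= ltr_distlC -E1 -E2.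
Qed.

End witness.

(** * Critical points as tuples with an empty circumball *)

Lemma finite_enum (T : choiceType) (A : set T) : finite_set A ->
  exists (n : nat) (c : 'I_n -> T), injective c /\ A = range c.
Proof.
move=> fA; pose s : seq T := enum_fset (fset_set A).
have us : uniq s by exact: fset_uniq.
have sA x : (x \in s) = (x \in A) by rewrite -in_fset_set.
exists (size s), (tnth (in_tuple s)); split; first exact/tuple_uniqP.
apply/seteqP; split=> x /= Ax.
  have /tnthP[i ->] : x \in in_tuple s by rewrite /= sA; exact: mem_set.
  by exists i.
case: Ax => i _ <-; have := mem_tnth i (in_tuple s).
by rewrite /= sA => /set_mem.
Qed.

Section counting.
Variable R : realType.

Lemma counting_seq (T : choiceType) (s : seq T) : uniq s ->
  counting [set` s] = (size s)%:R%:E :> \bar R.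
Proof.
move=> us; have fs : finite_set [set` s] by exact: finite_seq.
rewrite /counting asboolT//; congr (_%:R%:E).
rewrite -{2}(undup_id us) -card_fseq; congr (size (enum_fset _)).
apply/fsetP => x; rewrite in_fset_set// in_fset.
by apply/idP/idP => [/set_mem|h]; [|exact: mem_set].
Qed.

Lemma counting_image (T : choiceType) (I : finType) (D : {pred I}) (c : I -> T) :
  {in D &, injective c} -> counting [set c i | i in [set` D]] = #|D|%:R%:E :> \bar R.
Proof.
move=> ic; rewrite cardE -(size_map c) -counting_seq; last first.
  by rewrite map_inj_in_uniq ?enum_uniq// => i j; rewrite !mem_enum; exact: ic.
congr counting; apply/seteqP; split=> x /=.
  by move=> [i iD <-]; apply/mapP; exists i; rewrite ?mem_enum.
by move=> /mapP[i]; rewrite mem_enum => iD ->; exists i.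
Qed.

Lemma counting_range (T : choiceType) n (c : 'I_n -> T) : injective c ->
  counting (range c) = n%:R%:E :> \bar R.
Proof.
move=> ic; have -> : range c = [set c i | i in [set` predT]].
  by apply/seteqP; split=> x [i _ <-]; exists i.
by rewrite counting_image ?card_ord// => i j _ _; exact: ic.
Qed.

Lemma counting_fin_num (T : choiceType) (A : set T) : finite_set A ->
  (counting A : \bar R) \is a fin_num.
Proof. by move=> fA; rewrite /counting asboolT. Qed.

Lemma counting_ge0 (T : choiceType) (A : set T) : (0 <= (counting A : \bar R))%E.
Proof. by rewrite /counting; case: ifPn => _; rewrite ?lee_fin ?leey. Qed.

Lemma counting_le (T : choiceType) (A B : set T) : A `<=` B ->
  (counting A <= (counting B : \bar R))%E.
Proof.
move=> AB; rewrite {2}/counting; case: asboolP => fB; last by rewrite leey.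
have fA := sub_finite_set AB fB.
rewrite /counting asboolT// lee_fin ler_nat; apply: fsubset_leq_card.
by rewrite -fset_set_sub.
Qed.

Lemma counting_image_le (T U : choiceType) (f : T -> U) (A : set T) :
  (counting (f @` A) <= (counting A : \bar R))%E.
Proof.
rewrite [X in (_ <= X)%E]/counting; case: asboolP => fA; last by rewrite leey.
rewrite /counting asboolT; last exact: finite_image.
by rewrite lee_fin ler_nat fset_set_image//; exact: leq_imfset_card.
Qed.

Lemma counting_setD (T : choiceType) (A B : set T) : finite_set A -> B `<=` A ->
  (counting (A `\` B) + counting B = counting A :> \bar R)%E.
Proof.
move=> fA BA; have fB := sub_finite_set BA fA.
rewrite /counting !asboolT//; last exact: finite_setD.
rewrite -EFinD -natrD fset_setD//; congr (_%:R%:E).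
rewrite cardfsD -fset_setI// (setIidr BA) subnK// fsubset_leq_card//.
by rewrite -fset_set_sub.
Qed.

End counting.

Section critical_tuples.
Variables (R : realType) (k d : nat).
Hypothesis kd : (0 < k <= d)%N.
Implicit Types (C : set 'rV[R]_d) (U : set 'M[R]_(k.+1, d)) (V : set 'M[R]_(k.+2, d)).

(** With a = true these are the tuples of distinct points of C lying in U; with a = false
    only those for which some other point of C completes the tuple into V.  Both are
    increasing in C. *)
Definition tupset (a : bool) U V C : set 'M[R]_(k.+1, d) :=
  [set X | [/\ distinct_tuples C X, U X & a \/ exists y,
    [/\ C y, forall i, y <> row i X & V (consr y X)]]].

Lemma finite_distinct_tuples m C : finite_set C -> finite_set (distinct_tuples C : set 'M[R]_(m, d)).
Proof.
move=> fC; have [n [c [_ CE]]] := finite_enum fC.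
apply: (@sub_finite_set _ _ ((fun t : {ffun 'I_m -> 'I_n} => \matrix_i c (t i)) @` setT)).
  move=> X [XC _].
  have /choice[t ht] : forall i, exists j, c j = row i X.
    by move=> i; have := XC i; rewrite CE => -[j _ <-]; exists j.
  exists [ffun i => t i] => //; apply/row_matrixP => i.
  by rewrite rowK ffunE ht.
by apply: finite_image; exact: finite_finset.
Qed.

Lemma finite_tupset a U V C : finite_set C -> finite_set (tupset a U V C).
Proof.
by move=> /(@finite_distinct_tuples k.+1); apply: sub_finite_set => X [].
Qed.

Lemma tupset_sub a U V C : tupset a U V C `<=` tupset true U V C.
Proof. by move=> X [? ? _]; split=> //; left. Qed.

Section fixed_radius.
Variables (r : R) (r0 : 0 <= r) (C : set 'rV[R]_d).
Hypothesis fC : finite_set C.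

(* the tuples with an empty circumball *)
Let crit_tuples := tupset true (hset r) (@circumball_set R k d) C `\`
                   tupset false (hset r) (@circumball_set R k d) C.

Let crit_tuplesP X : crit_tuples X <->
  [/\ distinct_tuples C X, hset r X &
   forall y, C y -> (forall i, y <> row i X) ->
     enorm (row ord0 X - ccenter X) < enorm (ccenter X - y)].
Proof.
rewrite /crit_tuples; split.
  move=> [[dX hX _] nX]; split=> // y Cy yX.
  have [fX hr hE] := hset_center kd r0 hX.
  rewrite ltNge; apply/negP; rewrite enormB => ym; apply: nX; split=> //; right.
  exists y; split=> //; split.
    by rewrite consrK -gram_unitE -gram_unit.
  rewrite consrK row_consr0 /in_circumball/= -(hE ord0) -!enorm_sqr.
  by rewrite ler_pXn2r// nnegrE enorm_ge0.
move=> [dX hX hy]; split; first by split=> //; left.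
move=> [_ _ [//|[y [Cy yX [_]]]]].
have [fX hr hE] := hset_center kd r0 hX.
rewrite consrK row_consr0 /in_circumball/= -(hE ord0) -!enorm_sqr.
rewrite ler_pXn2r ?nnegrE ?enorm_ge0// leNgt => /negP; apply.
by rewrite [ltRHS]enormB; exact: hy.
Qed.

Let hset_dist (X : 'M[R]_(k.+1, d)) i : hset r X -> enorm (ccenter X - row i X) = enorm (row ord0 X - ccenter X).
Proof.
by move=> hX; have [fX hr hE] := hset_center kd r0 hX; rewrite enormB; apply/enorm_eq; rewrite !hE.
Qed.

Let dist_center X : crit_tuples X -> dist_to C (ccenter X) = enorm (row ord0 X - ccenter X).
Proof.
move=> /crit_tuplesP[[XC Xi] hX hy]; rewrite /dist_to.
have lb : lbound [set enorm (ccenter X - Y) | Y in C] (enorm (row ord0 X - ccenter X)).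
  move=> _ [y Cy <-].
  have [[i ->]|/forallNP ny] := pselect (exists i, y = row i X); first by rewrite hset_dist.
  by apply/ltW/hy.
apply/eqP; rewrite eq_le; apply/andP; split.
  apply: ge_inf; first by exists (enorm (row ord0 X - ccenter X)).
  by exists (row ord0 X); [exact: XC|exact: hset_dist].
apply: lb_le_inf lb; exists (enorm (ccenter X - row ord0 X)), (row ord0 X) => //; exact: XC.
Qed.

Let crit_critical X : crit_tuples X ->
  critical_point k C (ccenter X) /\ dist_to C (ccenter X) <= r.
Proof.
move=> cX; have dE := dist_center cX.
move: (cX) => /crit_tuplesP[dX hX hy].
have [fX hr hE] := hset_center kd r0 hX.
case: (hX) => gp ri hcr; rewrite circumcenterE// in ri; split; last first.
  by rewrite dE; move: hcr; rewrite /circumradius circumcenterE.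
exists X; split=> //; first by move=> i; rewrite dE hset_dist.
by move=> y Cy yX; rewrite dE; apply: hy => // i; exact/nesym || exact: yX.
Qed.

Let critical_crit c : critical_point k C c -> dist_to C c <= r ->
  exists2 X, crit_tuples X & ccenter X = c.
Proof.
move=> [X [dX hd hy gp ri]] hr.
have fX : row_free (edges X) by apply/general_positionE.
have cE : c = ccenter X.
  apply: equidistant_center => //; last first.
    by exists (dist_to C c) => i; rewrite (hd i) enormB.
  by case: ri => -[l [_ l1] ->] _; exists l.
exists X => //; apply/crit_tuplesP; split=> //.
  split=> //; first by rewrite circumcenterE// -cE.
  by rewrite /circumradius circumcenterE// -cE enormB -hd.
by move=> y Cy yX; rewrite -cE enormB -hd; apply: hy => // i; exact: yX.
Qed.

Let row_permK (s : 'S_k.+1) (X : 'M[R]_(k.+1, d)) i : row i (row_perm s X) = row (s i) X.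
Proof. by apply/rowP => j; rewrite !mxE. Qed.

Let row_permKV (s : 'S_k.+1) (X : 'M[R]_(k.+1, d)) :
  row_perm s^-1%g (row_perm s X) = X.
Proof. by apply/row_matrixP => i; rewrite !row_permK permKV. Qed.

Let comb_perm (s : 'S_k.+1) (X : 'M[R]_(k.+1, d)) (l : 'rV[R]_k.+1) :
  let l' := \row_i l ord0 (s^-1%g i) in
  \sum_i l' ord0 i = \sum_i l ord0 i /\ l *m row_perm s X = l' *m X.
Proof.
split; first rewrite [RHS](reindex_inj (@perm_inj _ s^-1%g)).
  by apply: eq_bigr => i _; rewrite mxE.
rewrite !mulmx_sum_row [LHS](reindex_inj (@perm_inj _ s^-1%g)).
by apply: eq_bigr => i _; rewrite mxE row_permK permKV.
Qed.

Let affine_hull_perm (s : 'S_k.+1) (X : 'M[R]_(k.+1, d)) :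
  affine_hull (row_perm s X) = affine_hull X.
Proof.
suff H (t : 'S_k.+1) (Y : 'M[R]_(k.+1, d)) : affine_hull (row_perm t Y) `<=` affine_hull Y.
  by apply/seteqP; split=> //; rewrite -{1}(row_permKV s X); exact: H.
move=> v [l l1 ->]; have [E1 E2] := comb_perm t Y l.
by exists (\row_i l ord0 (t^-1%g i)); rewrite ?E1.
Qed.

Let convex_hull_perm (s : 'S_k.+1) (X : 'M[R]_(k.+1, d)) :
  convex_hull (row_perm s X) = convex_hull X.
Proof.
suff H (t : 'S_k.+1) (Y : 'M[R]_(k.+1, d)) : convex_hull (row_perm t Y) `<=` convex_hull Y.
  by apply/seteqP; split=> //; rewrite -{1}(row_permKV s X); exact: H.
move=> v [l [l0 l1] ->]; have [E1 E2] := comb_perm t Y l.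
by exists (\row_i l ord0 (t^-1%g i)); rewrite ?E1//; split=> // i; rewrite mxE.
Qed.

Let circumcenter_perm (s : 'S_k.+1) (X : 'M[R]_(k.+1, d)) :
  circumcenter (row_perm s X) = circumcenter X.
Proof.
rewrite /circumcenter; congr get; apply/seteqP; split=> c /=; rewrite affine_hull_perm;
  move=> [h [t ht]]; split=> //; exists t => i.
  by rewrite -(ht (s^-1%g i)) row_permK permKV.
by rewrite row_permK.
Qed.

Let crit_perm (s : 'S_k.+1) X : crit_tuples X ->
  crit_tuples (row_perm s X) /\ ccenter (row_perm s X) = ccenter X.
Proof.
move=> /crit_tuplesP[[XC Xi] hX hy].
have [fX hr hE] := hset_center kd r0 hX.
have gp : general_position (row_perm s X).
  case: hX => gp _ _ [p [U rU sub]]; apply: gp; exists p, U => // i.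
  by have := sub (s^-1%g i); rewrite row_permK permKV.
have fsX : row_free (edges (row_perm s X)) by apply/general_positionE.
have cE : ccenter (row_perm s X) = ccenter X.
  by rewrite -(circumcenterE fsX) -(circumcenterE fX) circumcenter_perm.
have d0 : enorm (row ord0 (row_perm s X) - ccenter X) = enorm (row ord0 X - ccenter X).
  by rewrite row_permK; apply/enorm_eq; rewrite (hE (s ord0)) (hE ord0).
split; last exact: cE.
apply/crit_tuplesP; split.
- split; first by move=> i; rewrite row_permK.
  by move=> i j; rewrite !row_permK => /Xi /perm_inj.
- case: hX => _ ri; rewrite /hset/= /circumradius !circumcenter_perm => hcr; split=> //.
    by move: ri; rewrite /relint_convex_hull convex_hull_perm affine_hull_perm.
  by move: hcr; rewrite circumcenterE// d0.
- move=> y Cy yX; rewrite cE d0; apply: hy => // i.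
  by have := yX (s^-1%g i); rewrite row_permK permKV.
Qed.

Let crit_same X Y : crit_tuples X -> crit_tuples Y -> ccenter X = ccenter Y ->
  exists s : 'S_k.+1, Y = row_perm s X.
Proof.
move=> cX cY cE.
have dE : enorm (row ord0 X - ccenter X) = enorm (row ord0 Y - ccenter Y).
  by rewrite -(dist_center cX) -(dist_center cY) cE.
move: cX cY => /crit_tuplesP[[XC Xi] hX hy] /crit_tuplesP[[YC Yi] hY _].
have /choice[t ht] : forall i, exists j, row i Y = row j X.
  move=> i; apply: contrapT => /forallNP nj.
  have := hy _ (YC i) nj.
  by rewrite dE cE (hset_dist i hY) ltxx.
have ti : injective t by move=> i j ij; apply: Yi; rewrite /= (ht i) (ht j) ij.
by exists (perm ti); apply/row_matrixP => i; rewrite row_permK permE (ht i).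
Qed.

(** A critical point is the circumcentre of the (k+1)! orderings of the points nearest to
    it, and of no other tuple with an empty circumball: the rows of such a tuple are all
    the points that realise the distance. *)
Lemma num_critical_tuples :
  finite_set [set c | critical_point k C c /\ dist_to C c <= r] /\
  ((k.+1)`!%:R%:E * num_critical k C r +
    counting (tupset false (hset r) (@circumball_set R k d) C) =
   counting (tupset true (hset r) (@circumball_set R k d) C) :> \bar R)%E.
Proof.
set crit := [set c | _].
have fT : finite_set crit_tuples by apply: finite_setD; exact: finite_tupset.
have critE : crit = @ccenter R k d @` crit_tuples.
  apply/seteqP; split=> c /=; first by move=> [h1 h2]; have [X] := critical_crit h1 h2; exists X.
  by move=> [X cX <-]; exact: crit_critical.
have fcrit : finite_set crit by rewrite critE; exact: finite_image.
split=> //.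
rewrite -[RHS](counting_setD R (finite_tupset _ _ _ fC) (@tupset_sub false _ _ _)); congr (_ + _)%E.
have /choice[pick hpick] : forall c, exists X, crit c -> crit_tuples X /\ ccenter X = c.
  move=> c; have [cc|nc] := pselect (crit c); last by exists 0.
  by move: (cc); rewrite critE => -[X cX <-]; exists X.
have [n [c [ic cE]]] := finite_enum fcrit.
have cc i : crit (c i) by rewrite cE; exists i.
pose F (p : 'I_n * 'S_k.+1) := row_perm p.2 (pick (c p.1)).
have -> : tupset true (hset r) (@circumball_set R k d) C `\`
   tupset false (hset r) (@circumball_set R k d) C = [set F p | p in [set` predT]].
  apply/seteqP; split=> X.
    move=> cX; have : crit (ccenter X) by rewrite critE; exists X.
    rewrite {1}cE => -[i _ ciX].
    have [h1 h2] := hpick _ (cc i).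
    have [s ->] := crit_same h1 cX (etrans h2 ciX).
    by exists (i, s).
  by move=> [[i s] _ <-]; apply: (crit_perm s _).1; exact: (hpick _ (cc i)).1.
have -> : num_critical k C r = n%:R%:E.
  by rewrite /num_critical -/crit cE counting_range.
rewrite counting_image.
  by rewrite -[#|predT|]/#|{: 'I_n * 'S_k.+1}| card_prod card_ord card_Sn -EFinM -natrM mulnC.
move=> [i s] [j s'] _ _ E.
have [h1 h2] := hpick _ (cc i); have [h1' h2'] := hpick _ (cc j).
have ij : i = j.
  apply: ic; rewrite -h2 -h2' -(crit_perm s h1).2 -(crit_perm s' h1').2.
  by congr ccenter.
subst j; congr pair; apply/permP => l.
have : row l (row_perm s (pick (c i))) = row l (row_perm s' (pick (c i))).
  by rewrite -[row_perm s _]/(F (i, s)) E.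
by rewrite !row_permK; move: h1 => /crit_tuplesP[[_ inj] _ _] /inj.
Qed.

End fixed_radius.
End critical_tuples.

(** * Increasing functions of counts *)

Section increasing_functions.
Variables (R : realType) (q : nat).
Implicit Types f g : 'rV[R]_q -> R.

(** Negative association applies to these functions; they are nonnegative because products
    of increasing functions are increasing only then. *)
Definition nice f := [/\ continuous f, increasing f &
  exists M, forall x, 0 <= f x <= M].

Lemma nice_cst (c : R) : 0 <= c -> nice (fun=> c).
Proof.
by move=> c0; split=> //; [exact: continuous_cstR|exists c => x; rewrite c0 lexx].
Qed.

Lemma niceD f g : nice f -> nice g -> nice (fun x => f x + g x).
Proof.
move=> [cf incf [M hM]] [cg incg [N hN]]; split.
- exact: continuousDR.
- by move=> x y xy; apply: lerD; [exact: incf|exact: incg].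
exists (M + N) => x; have /andP[h1 h2] := hM x; have /andP[h3 h4] := hN x.
by rewrite addr_ge0// lerD.
Qed.

Lemma niceM f g : nice f -> nice g -> nice (fun x => f x * g x).
Proof.
move=> [cf incf [M hM]] [cg incg [N hN]].
have f0 x : 0 <= f x by have /andP[] := hM x.
have g0 x : 0 <= g x by have /andP[] := hN x.
split.
- exact: continuousMR.
- by move=> x y xy; apply: ler_pM => //; [exact: incf|exact: incg].
exists (M * N) => x; have /andP[_ h2] := hM x; have /andP[_ h4] := hN x.
by rewrite mulr_ge0// ler_pM.
Qed.

Lemma nice_sum (I : Type) (s : seq I) (P : pred I) (F : I -> 'rV[R]_q -> R) :
  (forall i, nice (F i)) -> nice (fun x => \sum_(i <- s | P i) F i x).
Proof.
move=> nF; elim: s => [|i s IHs].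
  by under eq_fun do rewrite big_nil; exact: nice_cst.
under eq_fun do rewrite big_cons; case: (P i) => //; exact: niceD.
Qed.

Lemma nice_prod (I : Type) (s : seq I) (F : I -> 'rV[R]_q -> R) :
  (forall i, nice (F i)) -> nice (fun x => \prod_(i <- s) F i x).
Proof.
move=> nF; elim: s => [|i s IHs].
  by under eq_fun do rewrite big_nil; exact: nice_cst.
under eq_fun do rewrite big_cons; exact: niceM.
Qed.

Lemma nice_trunc (M : R) f : 0 <= M -> continuous f -> increasing f ->
  nice (fun x => Num.min M (Num.max 0 (f x))).
Proof.
move=> M0 cf incf; split.
- move=> x; apply: (@continuous_min _ _ (fun=> M) (fun y => Num.max 0 (f y))).
    exact: continuous_cstR.
  by apply: (@continuous_max _ _ (fun=> 0) f); [exact: continuous_cstR|exact: cf].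
- move=> x y /incf xy; rewrite le_min ge_min lexx/= ge_min ge_max !le_max lexx/= xy/=.
  by rewrite !orbT.
by exists M => x; rewrite le_min M0 le_max lexx/= ge_min lexx.
Qed.

Lemma nice_coord (M : R) i : 0 <= M ->
  nice (fun x : 'rV[R]_q => Num.min M (Num.max 0 (x ord0 i))).
Proof.
move=> M0; apply: nice_trunc => //.
  exact: coord_continuous.
Qed.

Lemma nice_min1 f : nice f -> nice (fun x => Num.min 1 (f x)).
Proof.
move=> [cf incf [M hM]].
have := nice_trunc (@ler01 R) cf incf; congr nice; apply/funext => x.
by congr Num.min; rewrite max_r//; have /andP[] := hM x.
Qed.

End increasing_functions.

Section counts.
Variables (R : realType) (d : nat) (disp : measure_display) (Omega : measurableType disp).
Variables (P : probability Omega R) (Phi : {RV P >-> config R d}).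
Hypothesis LF : forall w, locally_finite (Phi w).
Implicit Types A B : set 'rV[R]_d.

(** A configuration has finitely many points in a region, and their number is a random
    variable. *)
Definition region A := measurable A /\ bounded_set A.

Lemma bounded_coordP A : bounded_set A <->
  exists s : R, forall x, A x -> forall j, `|x ord0 j| <= s.
Proof.
split=> [[M [_ hM]]|[s hs]].
  exists (M + 1) => x Ax j.
  have /= := hM (M + 1) (ltr_pwDr ltr01 (lexx M)) x Ax.
  apply: le_trans; rewrite -[X in _ <= X]/(mx_norm x) mx_normrE.
  exact: (le_bigmax _ (fun ij => `|x ij.1 ij.2|) (ord0, j)).
exists (Num.max 0 s); split; first exact: num_real.
move=> M sM x Ax /=; apply: le_trans (ltW sM).
rewrite -[X in X <= _]/(mx_norm x) mx_normrE.
apply/bigmax_leP; split=> [|[i j] _ /=]; first by rewrite le_max lexx.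
by rewrite (ord1 i) le_max hs ?orbT.
Qed.

Lemma regionI A B : region A -> measurable B -> region (A `&` B).
Proof.
move=> [mA bA] mB; split; first exact: measurableI.
move: bA => [M [M0 hM]]; exists M; split=> // N MN x [Ax _]; exact: hM.
Qed.

Lemma finite_points A w : region A -> finite_set (Phi w `&` A).
Proof. by move=> [_]; exact: LF. Qed.

Definition npoints A w : R := fine (counting (Phi w `&` A)).

Lemma npointsE A w : region A -> (npoints A w)%:E = counting (Phi w `&` A).
Proof. by move=> rA; rewrite fineK//; apply/counting_fin_num/finite_points. Qed.

Lemma npoints_nat A w : region A -> exists n : nat, npoints A w = n%:R /\
  exists c : 'I_n -> 'rV[R]_d, injective c /\ Phi w `&` A = range c.
Proof.
move=> rA; have [n [c [ic cE]]] := finite_enum (finite_points w rA).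
exists n; split; last by exists c.
by rewrite /npoints cE counting_range.
Qed.

Lemma npoints_ge0 A w : 0 <= npoints A w.
Proof. by rewrite fine_ge0// counting_ge0. Qed.

Lemma npoints_le A B w : region B -> A `<=` B -> npoints A w <= npoints B w.
Proof.
move=> rB AB; have fB := finite_points w rB.
have AB' : Phi w `&` A `<=` Phi w `&` B by apply: setIS.
rewrite fine_le ?counting_le ?counting_fin_num//.
exact: sub_finite_set fB.
Qed.

Lemma measurable_counting B : measurable B ->
  measurable_fun setT (fun w => counting (Phi w `&` B) : \bar R).
Proof.
move=> mB _ U mU; rewrite setTI.
have -> : (fun w => counting (Phi w `&` B) : \bar R) @^-1` U =
  Phi @^-1` ((fun C => counting (C `&` B)) @^-1` U) by [].
rewrite -[X in measurable X]setTI; apply: (measurable_funP Phi) => //.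
by apply: sub_sigma_algebra; exists B => //; exists U.
Qed.

Lemma measurable_npoints B : measurable B -> measurable_fun setT (npoints B).
Proof.
by move=> mB; apply: measurableT_comp (measurable_counting mB).
Qed.

Lemma measurable_continuous_mx m n (f : 'M[R]_(m, n) -> R) : continuous f ->
  measurable_fun setT f.
Proof.
move=> cf; apply: (measurability _ (RGenOpens.measurableE R)).
move=> _ [_ [a [b ->]] <-]; rewrite setTI; apply: sub_sigma_algebra.
by apply: open_comp => [x _|]; [exact: cf | exact: interval_open].
Qed.

(** The random variables that negative association speaks of: bounded continuous
    increasing functions of the numbers of points in finitely many pieces of A. *)
Definition count_fun A (F : Omega -> R) := exists (I : finType)
  (B : I -> set 'rV[R]_d) (f : 'rV[R]_#|I| -> R),
  [/\ forall i, region (B i) /\ B i `<=` A, nice f &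
      forall w, F w = f (\row_i npoints (B (enum_val i)) w)].

Lemma count_fun_measurable A F : count_fun A F -> measurable_fun setT F.
Proof.
move=> [I [B [f [rB [cf _ _] FE]]]]; rewrite (funext FE).
apply: (measurableT_comp (measurable_continuous_mx cf)).
apply: measurable_mxP => i j; under eq_fun do rewrite mxE.
by apply: measurable_npoints; exact: (rB _).1.1.
Qed.

Lemma count_fun_bound A F : count_fun A F -> exists M, forall w, 0 <= F w <= M.
Proof.
by move=> [I [B [f [rB [_ _ [M hM]] FE]]]]; exists M => w; rewrite FE.
Qed.

Lemma count_fun_Lfun A F : count_fun A F -> F \in Lfun P 1.
Proof.
move=> cF; have mF := count_fun_measurable cF; have [M hM] := count_fun_bound cF.
apply/Lfun1_integrable => /=.
apply: (@le_integrable _ _ _ _ _ measurableT _ (fun=> M%:E)) => //.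
- exact/measurable_EFinP.
- by move=> w _; have /andP[h1 h2] := hM w; rewrite /= lee_fin !ger0_norm// (le_trans h1).
- exact: finite_measure_integrable_cst.
Qed.

Lemma na_count_fun A B F G : negatively_associated Phi -> A `&` B = set0 ->
  count_fun A F -> count_fun B G ->
  (\int[P]_w (F w * G w)%:E <= (\int[P]_w (F w)%:E) * (\int[P]_w (G w)%:E))%E.
Proof.
move=> na AB0 cF cG.
have mF := count_fun_measurable cF; have [M hM] := count_fun_bound cF.
have mG := count_fun_measurable cG; have [N hN] := count_fun_bound cG.
have LFF := count_fun_Lfun cF; have LG := count_fun_Lfun cG.
have LFG : (F * G)%R \in Lfun P 1.
  apply/Lfun1_integrable => /=.
  apply: (@le_integrable _ _ _ _ _ measurableT _ (fun=> (M * N)%:E)) => //.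
  - by apply/measurable_EFinP; exact: measurable_funM.
  - move=> w _; have /andP[h1 h2] := hM w; have /andP[h3 h4] := hN w.
    have M0 := le_trans h1 h2; have N0 := le_trans h3 h4.
    rewrite -[(_ \o _) w]/((F w * G w)%:E) !abse_EFin lee_fin !ger0_norm ?mulr_ge0//.
    exact: ler_pM.
  - exact: finite_measure_integrable_cst.
have cov : (covariance P F G <= 0)%E.
  move: cF cG => [I [B1 [f [rB1 [cf incf [Mf hf]] FE]]]] [J [B2 [g [rB2 [cg incg [Mg hg]] GE]]]].
  rewrite (funext FE) (funext GE).
  apply: (na #|I| #|J| (fun i => B1 (enum_val i)) (fun i => B2 (enum_val i)) f g) => //.
  - by move=> i; have [[? ?] _] := rB1 (enum_val i).
  - by move=> i; have [[? ?] _] := rB2 (enum_val i).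
  - rewrite -subset0 -AB0 => x [[i _ xi] [j _ xj]].
    by split; [exact: (rB1 _).2 xi|exact: (rB2 _).2 xj].
  - exists Mf; split; first exact: num_real.
    move=> N' hN' x _ /=; have /andP[? ?] := hf x.
    by rewrite ger0_norm// (le_trans _ (ltW hN')).
  - exists Mg; split; first exact: num_real.
    move=> N' hN' x _ /=; have /andP[? ?] := hg x.
    by rewrite ger0_norm// (le_trans _ (ltW hN')).
rewrite covarianceE// in cov.
have h1 := expectation_fin_num LFF; have h2 := expectation_fin_num LG.
move: cov; rewrite sube_le0 ?fin_numM//.
by rewrite unlock.
Qed.

End counts.

(** * Tuple counts as limits of functions of counts *)

Section discretisation.
Variables (R : realType) (d k : nat) (disp : measure_display) (Omega : measurableType disp).
Variables (P : probability Omega R) (Phi : {RV P >-> config R d}).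
Hypothesis LF : forall w, locally_finite (Phi w).
Implicit Types A B : set 'rV[R]_d.

(** Boundedness of A makes finitely many cells suffice, so that their counts can be the
    arguments of a single function. *)
Lemma exists_grid A (p : nat) : region A -> exists (G : finType) (pos : G -> 'rV[R]_d)
    (cell : 'rV[R]_d -> G), (forall g, measurable (A `&` cell @^-1` [set g])) /\
  forall x, A x -> ball x p.+1%:R^-1 (pos (cell x)).
Proof.
move=> [mA /bounded_coordP[s0 hs0]].
pose s := Num.max 0 s0.
have hs x : A x -> forall j, `|x ord0 j| <= s.
  by move=> Ax j; rewrite le_max hs0 ?orbT.
have s_ge0 : 0 <= s by rewrite le_max lexx.
pose n : R := p.+1%:R; have n0 : 0 < n by rewrite ltr0n.
pose z (x : 'rV[R]_d) (j : 'I_d) : R := (x ord0 j + s) * n.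
pose M := Num.truncn (2 * s * n).
pose cell (x : 'rV[R]_d) : {ffun 'I_d -> 'I_M.+1} := [ffun j => inord (Num.truncn (z x j))].
have z0 x j : A x -> 0 <= z x j.
  move=> /hs /(_ j); rewrite ler_norml => /andP[h _].
  by apply: mulr_ge0; [rewrite -lerBlDr sub0r|exact: ltW].
have zM x j : A x -> (Num.truncn (z x j) < M.+1)%N.
  move=> Ax; rewrite ltnS truncn_ge_nat; last first.
    by apply: mulr_ge0; [exact: mulr_ge0|exact: ltW].
  have /andP[h _] := truncn_itv (z0 _ j Ax); apply: (le_trans h).
  rewrite ler_pM2r// mulr2n mulrDl mul1r lerD2r.
  by have := hs _ Ax j; rewrite ler_norml => /andP[].
have cellE x j : A x -> (cell x j : nat) = Num.truncn (z x j).
  by move=> Ax; rewrite ffunE inordK// zM.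
exists {ffun 'I_d -> 'I_M.+1}, (fun g : {ffun 'I_d -> 'I_M.+1} => \row_j ((g j)%:R / n - s)), cell; split.
  move=> g.
  have -> : A `&` cell @^-1` [set g] = A `&`
      [set x : 'rV[R]_d | forall i j, [set t | (g j)%:R <= (t + s) * n < (g j).+1%:R] (x i j)].
    apply/seteqP; split=> x [Ax hx]; split=> //.
      move=> i j; rewrite (ord1 i) /=; rewrite -/(z x j).
      have -> : g j = Num.truncn (z x j) :> nat by rewrite -cellE// hx.
      exact: truncn_itv (z0 _ _ Ax).
    apply/ffunP => j; apply/val_inj => /=; rewrite cellE//.
    by apply: truncn_def; exact: (hx ord0 j).
  apply: measurableI => //.
  apply: (@measurable_entries R 1 d (fun i j => [set t | (g j)%:R <= (t + s) * n < (g j).+1%:R])) => _ j.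
  have -> : [set t : R | (g j)%:R <= (t + s) * n < (g j).+1%:R] =
    `[(g j)%:R / n - s, (g j).+1%:R / n - s[%classic.
    by apply/seteqP; split=> t /=; rewrite in_itv/= lerBlDr ltrBrDr ler_pdivrMr// ltr_pdivlMr.
  exact: measurable_itv.
move=> x Ax; split; first by rewrite invr_gt0.
move=> i j; rewrite (ord1 i) mxE cellE// /ball/=.
have /andP[h1 h2] := truncn_itv (z0 _ j Ax).
set t := (Num.truncn _)%:R in h1 *.
have zE : x ord0 j = z x j / n - s by rewrite /z mulfK ?gt_eqF// addrK.
rewrite zE opprB addrA subrK -mulrBl normrM [X in _ * X]gtr0_norm ?invr_gt0//.
rewrite ltr_pdivrMr// mulVf ?gt_eqF// ger0_norm ?subr_ge0//.
by rewrite ltrBlDr -natr1 addrC in h2 *.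
Qed.

Definition tup (T : Type) (c : T -> 'rV[R]_d) (t : 'I_k.+1 -> T) : 'M[R]_(k.+1, d) :=
  \matrix_(i < k.+1) c (t i).

(** Index version of [tupset]: the tuples of distinct indices of occupied positions. *)
Definition index_tuples (a : bool) (U : set 'M[R]_(k.+1, d)) (V : set 'M[R]_(k.+2, d))
    (T : finType) (c : T -> 'rV[R]_d) (occ : pred T) : {set {ffun 'I_k.+1 -> T}} :=
  [set t : {ffun 'I_k.+1 -> T} | [&& injectiveb t, `[< U (tup c t) >],
    [forall i, occ (t i)] &
    a || [exists y, [&& occ y, y \notin codom t & `[< V (consr (c y) (tup c t)) >]]]]]%SET.

Lemma counting_tupset a U V n (c : 'I_n -> 'rV[R]_d) : injective c ->
  counting (tupset a U V (range c)) = #|index_tuples a U V c predT|%:R%:E :> \bar R.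
Proof.
move=> ic.
have it (t : {ffun 'I_k.+1 -> 'I_n}) i : row i (tup c t) = c (t i) by rewrite rowK.
have -> : tupset a U V (range c) =
    [set tup c t | t in [set` index_tuples a U V c predT]].
  apply/seteqP; split=> X /=.
    move=> [[XC Xi] UX hX].
    have /choice[t ht] : forall i, exists j, c j = row i X.
      by move=> i; have [j _ <-] := XC i; exists j.
    have XE : X = tup c [ffun i => t i].
      by apply/row_matrixP => i; rewrite it ffunE ht.
    exists [ffun i => t i]; last by rewrite -XE.
    rewrite inE -XE; apply/and4P; split.
    - apply/injectiveP => i j; rewrite !ffunE => tij; apply: Xi => /=.
      by rewrite -(ht i) -(ht j) tij.
    - exact/asboolP.
    - exact/forallP.
    - case: hX => [->//|[y [[j _ cj] yX Vy]]]; apply/orP; right.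
      apply/existsP; exists j; rewrite /= cj; apply/andP; split; last exact/asboolP.
      apply/negP => /codomP[i]; rewrite ffunE => ji.
      by apply: (yX i); rewrite -cj ji ht.
  move=> [t]; rewrite inE => /and4P[/injectiveP ti /asboolP Ut _ ht] <-; split=> //.
    split=> [i|i j /=]; first by rewrite it; exists (t i).
    by rewrite !it => /ic /ti.
  case/orP: ht => [->|/existsP[y /and3P[_ yt /asboolP Vy]]]; [by left|right].
  exists (c y); split; [by exists y| |by []].
  by move=> i; rewrite it => /ic yti; move/negP: yt; apply; rewrite yti codom_f.
rewrite counting_image// => t t' _ _ /= E; apply/ffunP => i; apply: ic.
by rewrite -!it E.
Qed.

(** When the grid separates the points, e is the injection of the points into the cells,
    and the occupied cells carry the same tuples as the points. *)
Lemma index_tuples_transfer a U V U' V' (T T' : finType) (c : T -> 'rV[R]_d)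
    (c' : T' -> 'rV[R]_d) (e : T -> T') (occ' : pred T') :
  injective e -> (forall y, occ' y = (y \in codom e)) ->
  (forall t : {ffun 'I_k.+1 -> T}, U' (tup c' (e \o t)) <-> U (tup c t)) ->
  (forall y (t : {ffun 'I_k.+1 -> T}),
     V' (consr (c' (e y)) (tup c' (e \o t))) <-> V (consr (c y) (tup c t))) ->
  #|index_tuples a U' V' c' occ'| = #|index_tuples a U V c predT|.
Proof.
move=> ie occE hU hV.
pose E (t : {ffun 'I_k.+1 -> T}) : {ffun 'I_k.+1 -> T'} := [ffun i => e (t i)].
have tE t : tup c' (E t) = tup c' (e \o t).
  by apply/row_matrixP => i; rewrite !rowK ffunE.
have iE : injective E.
  by move=> t t' /ffunP tt'; apply/ffunP => i; have := tt' i; rewrite !ffunE => /ie.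
rewrite -(card_imset _ iE); apply: eq_card => t'.
apply/idP/imsetP => [|[t]].
  rewrite inE => /and4P[/injectiveP ti /asboolP Ut /forallP to ht].
  have /choice[t tt] : forall i, exists j, e j = t' i.
    by move=> i; have := to i; rewrite occE => /codomP[j ->]; exists j.
  have t'E : t' = E [ffun i => t i] by apply/ffunP => i; rewrite !ffunE tt.
  exists [ffun i => t i] => //; rewrite inE; apply/and4P; split.
  - by apply/injectiveP => i j; rewrite !ffunE => tij; apply: ti; rewrite -!tt tij.
  - by apply/asboolP/hU; rewrite -tE -t'E.
  - exact/forallP.
  - case/orP: ht => [->//|/existsP[y /and3P[]]].
    rewrite occE => /codomP[j ->] yt /asboolP Vy; apply/orP; right.
    apply/existsP; exists j; rewrite /=; apply/andP; split; last first.
      by apply/asboolP/hV; rewrite -tE -t'E.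
    apply: contra yt => /codomP[i ->]; rewrite ffunE tt; exact: codom_f.
rewrite inE => /and4P[/injectiveP ti /asboolP Ut _ ht] ->.
rewrite inE; apply/and4P; split.
- by apply/injectiveP => i j; rewrite !ffunE => /ie /ti.
- by apply/asboolP; rewrite tE; apply/hU.
- by apply/forallP => i; rewrite occE ffunE codom_f.
- case/orP: ht => [->//|/existsP[y /and3P[_ yt /asboolP Vy]]]; apply/orP; right.
  apply/existsP; exists (e y); rewrite occE codom_f /=; apply/andP; split; last first.
    by apply/asboolP; rewrite tE; apply/hV.
  by apply: contra yt => /codomP[i]; rewrite ffunE => /ie ->; exact: codom_f.
Qed.

Section one_grid.
Variables (A : set 'rV[R]_d) (G : finType) (pos : G -> 'rV[R]_d) (cell : 'rV[R]_d -> G).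
Hypotheses (rA : region A) (mcell : forall g, measurable (A `&` cell @^-1` [set g])).
Variables (a : bool) (U : set 'M[R]_(k.+1, d)) (V : set 'M[R]_(k.+2, d)).

Let Q g := A `&` cell @^-1` [set g].

Let rQ g : region (Q g).
Proof.
split; first exact: mcell.
apply/bounded_coordP; have /bounded_coordP[s hs] := rA.2.
by exists s => x [Ax _]; exact: hs.
Qed.

Let clamp g (x : 'rV[R]_#|G|) : R := Num.min 1 (Num.max 0 (x ord0 (enum_rank g))).

(* The number of tuples of occupied cells as a function of the counts of the cells: clamp
   is the indicator of an occupied cell, and the minimum with 1 turns the number of cells
   that complete a tuple into the truth value of the existence of such a cell. *)
Let value (x : 'rV[R]_#|G|) : R :=
  \sum_(t : {ffun 'I_k.+1 -> G} | injectiveb t && `[< U (tup pos t) >])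
    (\prod_i clamp (t i) x) * Num.min 1 (a%:R +
      \sum_(y | (y \notin codom t) && `[< V (consr (pos y) (tup pos t)) >]) clamp y x).

Let nice_value : nice value.
Proof.
apply: nice_sum => t; apply: niceM; first by apply: nice_prod => i; exact: nice_coord.
apply: nice_min1; apply: niceD; first exact: nice_cst.
by apply: nice_sum => y; exact: nice_coord.
Qed.

Lemma grid_count_fun : exists F, count_fun Phi A F /\
  forall w n (c : 'I_n -> 'rV[R]_d), injective c -> Phi w `&` A = range c ->
    F w = #|index_tuples a U V pos (fun g => g \in codom (cell \o c))|%:R.
Proof.
exists (fun w => value (\row_i npoints Phi (Q (enum_val i)) w)); split.
  by exists G, Q, value; split=> // g; split=> // x [].
move=> w n c ic cE; set x := \row_i _.
pose occ g := g \in codom (cell \o c).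
have clampE g : clamp g x = (occ g)%:R.
  rewrite /clamp mxE enum_rankK.
  have [m [-> [c' [_ c'E]]]] := npoints_nat LF w (rQ g).
  have -> : occ g = (0 < m)%N.
    apply/idP/idP.
      move=> /codomP[i gE]; have : (Phi w `&` Q g) (c i).
        have : range c (c i) by exists i.
        by rewrite -cE => -[? ?]; split=> //; split.
      by rewrite c'E => -[[j jm] _ _]; exact: leq_ltn_trans jm.
    move=> m0; have : range c' (c' (Ordinal m0)) by exists (Ordinal m0).
    rewrite -c'E; set y := c' _ => -[Py [Ay gy]].
    have : range c y by rewrite -cE.
    by case=> i _ ciy; apply/codomP; exists i; rewrite /= ciy gy.
  rewrite max_r ?ler0n//; case: m {c' c'E} => [|m]; first by rewrite min_r.
  by rewrite min_l// ler1n.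
rewrite /value -sum1_card natr_sum big_mkcond [RHS]big_mkcond.
apply: eq_bigr => t _; rewrite inE.
case: (injectiveb t) => //=; case: (`[< U _ >]) => //=.
have -> : \prod_i clamp (t i) x = [forall i, occ (t i)]%:R.
  have [/forallP h|/forallPn[i hi]] := boolP [forall i, occ (t i)].
    by rewrite big1// => i _; rewrite clampE h.
  by rewrite (bigD1 i)//= clampE (negbTE hi) mul0r.
case: [forall i, occ (t i)] => /=; rewrite ?mul0r// mul1r.
case: (a) => /=.
  rewrite min_l// lerDl sumr_ge0// => y _; rewrite clampE ler0n//.
rewrite add0r.
set E := [exists y, _].
have [/existsP[y /and3P[+ yt Vy]]|/existsPn h] := boolP E.
  rewrite -/(occ y) => oy.
  rewrite min_l// (bigD1 y) ?yt//= clampE oy lerDl sumr_ge0// => z _.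
  by rewrite clampE ler0n.
rewrite big1 ?min_r// => y /andP[yt Vy]; rewrite clampE; have := h y.
by rewrite -/(occ y) yt Vy !andbT => /negbTE ->.
Qed.

End one_grid.

Lemma eventually_separated n (c : 'I_n -> 'rV[R]_d) : injective c ->
  \forall p \near \oo, forall ij : 'I_n * 'I_n, ij.1 != ij.2 ->
    ~ (exists y, ball (c ij.1) p.+1%:R^-1 y /\ ball (c ij.2) p.+1%:R^-1 y).
Proof.
move=> ic.
have sep (i j : 'I_n) : \forall p \near \oo, i != j ->
    ~ (exists y, ball (c i) p.+1%:R^-1 y /\ ball (c j) p.+1%:R^-1 y).
  have [->|ij] := eqVneq i j; first by apply: nearW => p.
  have cij : c i <> c j by move=> /ic /eqP; rewrite (negbTE ij).
  have [l cl] : exists l, c i ord0 l != c j ord0 l.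
    apply: contrapT => /forallNP h; apply: cij; apply/rowP => l.
    by have /negP := h l; rewrite negbK => /eqP.
  have e0 : 0 < `|c i ord0 l - c j ord0 l| / 2 by rewrite divr_gt0// normr_gt0 subr_eq0.
  apply: filterS (near_infty_natSinv_lt (PosNum e0)) => p /= pe _ [y [[_ h1] [_ h2]]].
  have := h1 ord0 l; have := h2 ord0 l; rewrite /ball/= => h2' h1'.
  have : `|c i ord0 l - c j ord0 l| < p.+1%:R^-1 + p.+1%:R^-1.
    rewrite -(subrK (y ord0 l) (c i ord0 l)) -addrA.
    apply: le_lt_trans (ler_normD _ _) _; apply: ltrD => //.
    by rewrite distrC.
  by rewrite ltNge => /negP; apply; rewrite (splitr `|_|) lerD// ltW.
by apply: filter_forall => -[i j]; exact: sep.
Qed.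

(** Configurations are sampled on finer and finer grids: a tuple functional of the
    occupied cells is a function of counts, and for every configuration it eventually
    agrees with the functional itself because the sets U and V are approximable. *)
Lemma tupset_discretisation a (U : set 'M[R]_(k.+1, d)) V A : approximable U -> approximable V -> region A ->
  exists F : nat -> Omega -> R, [/\ forall p, count_fun Phi A (F p),
    forall p w, 0 <= F p w <= npoints Phi A w ^+ k.+1 &
    forall w, \forall p \near \oo,
      F p w = fine (counting (tupset a U V (Phi w `&` A)))].
Proof.
move=> [Up hU] [Vp hV] rA.
have /choice[F hF] : forall p, exists F, exists (G : finType) (pos : G -> 'rV[R]_d)
   (cell : 'rV[R]_d -> G), [/\ count_fun Phi A F,
   forall x, A x -> ball x p.+1%:R^-1 (pos (cell x)) &
   forall w n (c : 'I_n -> 'rV[R]_d), injective c -> Phi w `&` A = range c ->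
    F w = #|index_tuples a (Up p) (Vp p) pos (fun g => g \in codom (cell \o c))|%:R].
  move=> p; have [G [pos [cell [mcell bcell]]]] := exists_grid p rA.
  have [F [cF FE]] := grid_count_fun pos rA mcell a (Up p) (Vp p).
  by exists F, G, pos, cell.
exists F; split.
- by move=> p; have [G [pos [cell []]]] := hF p.
- move=> p w; have [G [pos [cell [_ _ FE]]]] := hF p.
  have [n [-> [c [ic cE]]]] := npoints_nat LF w rA.
  rewrite (FE _ _ _ ic cE) ler0n/= -natrX ler_nat.
  pose occ : pred G := fun g => g \in codom (cell \o c).
  have L1 : (#|index_tuples a (Up p) (Vp p) pos occ| <= #|ffun_on_mem 'I_k.+1 (mem occ)|)%N.
    apply: subset_leq_card; apply/fintype.subsetP => t; rewrite inE => /and4P[_ _ /forallP h _].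
    by apply/ffun_onP => i; exact: h.
  apply: (leq_trans L1); rewrite card_ffun_on card_ord leq_exp2r//.
  have L2 : (#|occ| <= #|codom (cell \o c)|)%N.
    by apply: subset_leq_card; apply/fintype.subsetP.
  apply: (leq_trans L2).
  by rewrite -[X in (_ <= X)%N](card_ord n) -(size_codom (cell \o c)); exact: card_size.
move=> w; have [n [nE [c [ic cE]]]] := npoints_nat LF w rA.
have Ac i : A (c i) by have : range c (c i) by [exists i]; rewrite -cE => -[].
have nU : \forall p \near \oo, forall t : {ffun 'I_k.+1 -> 'I_n}, forall X',
    ball (tup c t) p.+1%:R^-1 X' -> (Up p X' <-> U (tup c t)).
  by apply: filter_forall => t; exact: hU.
have nV : \forall p \near \oo, forall yt : 'I_n * {ffun 'I_k.+1 -> 'I_n}, forall X',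
    ball (consr (c yt.1) (tup c yt.2)) p.+1%:R^-1 X' ->
    (Vp p X' <-> V (consr (c yt.1) (tup c yt.2))).
  by apply: filter_forall => yt; exact: hV.
have nS := eventually_separated ic.
apply: filterS3 nU nV nS => p hUp hVp hSp.
have [G [pos [cell [_ bcell FE]]]] := hF p.
rewrite (FE _ _ _ ic cE) cE counting_tupset//=; congr (_%:R).
have bt (t : {ffun 'I_k.+1 -> 'I_n}) : ball (tup c t) p.+1%:R^-1 (tup pos ((cell \o c) \o t)).
  split; first by rewrite invr_gt0.
  move=> i l; rewrite !mxE /=.
  by have [_ /(_ ord0 l)] := bcell _ (Ac (t i)).
apply: (@index_tuples_transfer a U V (Up p) (Vp p) _ _ c pos (cell \o c)) => //.
- move=> i j /= cij; apply/eqP; apply: contraT => nij; exfalso.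
  apply: (hSp (i, j) nij); exists (pos (cell (c i))); split; first exact: bcell.
  by rewrite cij; exact: bcell.
- move=> t; exact: hUp.
- move=> y t; apply: (hVp (y, t)); split; first by rewrite invr_gt0.
  move=> i l; have [_ bl] := bt t; have [_ /(_ ord0 l) by0] := bcell _ (Ac y).
  case: (unliftP ord0 i) => [i' ->|->].
    by rewrite !mxE !liftK; have := bl i' l; rewrite !mxE.
  by rewrite !mxE !unlift_none.
Qed.

End discretisation.

(** * Moments under negative association *)

Section moments.
Variables (R : realType) (d : nat) (disp : measure_display) (Omega : measurableType disp).
Variables (P : probability Omega R) (Phi : {RV P >-> config R d}).
Hypothesis LF : forall w, locally_finite (Phi w).
Implicit Types A B : set 'rV[R]_d.
Implicit Types F G : Omega -> R.

Local Notation mean F := (\int[P]_w (F w)%:E)%E.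

Lemma mean_ge0 F : (forall w, 0 <= F w) -> (0 <= mean F)%E.
Proof. by move=> F0; apply: integral_ge0 => w _; rewrite lee_fin. Qed.

Lemma mean_le F G : (forall w, 0 <= F w) -> measurable_fun setT F -> measurable_fun setT G ->
  (forall w, F w <= G w) -> (mean F <= mean G)%E.
Proof.
move=> F0 mF mG FG; apply: ge0_le_integral => //.
- by move=> w _; rewrite lee_fin.
- exact/measurable_EFinP.
- exact/measurable_EFinP.
- by move=> w _; rewrite lee_fin.
Qed.

Lemma fatou_cvg (F_ : nat -> Omega -> R) F (v : nat -> \bar R) c :
  (forall n, measurable_fun setT (F_ n)) -> (forall n w, 0 <= F_ n w) ->
  (forall w, F_ n w @[n --> \oo] --> F w) -> (forall n, (mean (F_ n) <= v n)%E) ->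
  v n @[n --> \oo] --> c -> (mean F <= c)%E.
Proof.
move=> mF F0 FF Fv vc.
have -> : mean F = (\int[P]_w limn_einf (fun n => (F_ n w)%:E))%E.
  apply: eq_integral => w _.
  have cFw : (F_ n w)%:E @[n --> \oo] --> (F w)%:E by apply: cvg_EFin; [exact: nearW|exact: FF].
  by rewrite (cvg_limn_einf_sup cFw).1.
apply: (le_trans (fatou _ _ _ _)) => //.
- by move=> n; apply/measurable_EFinP.
- by move=> n w _; rewrite lee_fin.
rewrite limn_einf_lim -(cvg_lim _ vc)//; apply: lee_lim.
- exact: is_cvg_einfs.
- by apply/cvg_ex; exists c.
- apply: nearW => n; apply: le_trans (Fv n).
  by apply: ereal_inf_lbound; exists n => /=.
Qed.

(** Fatou's lemma on the left-hand side; on the right the convergent bounds u and v of the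
    means give the product of their limits. *)
Lemma na_limit A B (F_ G_ : nat -> Omega -> R) F G (u v : nat -> \bar R) (a b : R) :
  negatively_associated Phi -> A `&` B = set0 ->
  (forall p, count_fun Phi A (F_ p)) -> (forall p, count_fun Phi B (G_ p)) ->
  (forall w, F_ n w @[n --> \oo] --> F w) -> (forall w, G_ n w @[n --> \oo] --> G w) ->
  (forall p, (mean (F_ p) <= u p)%E) -> (forall p, (mean (G_ p) <= v p)%E) ->
  u n @[n --> \oo] --> a%:E -> v n @[n --> \oo] --> b%:E ->
  (mean (fun w => (F w * G w)%R) <= (a * b)%:E)%E.
Proof.
move=> na AB cF cG FF GG Fu Gv ua vb.
have F0 p w : 0 <= F_ p w by have [M hM] := count_fun_bound (cF p); have /andP[] := hM w.
have G0 p w : 0 <= G_ p w by have [M hM] := count_fun_bound (cG p); have /andP[] := hM w.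
apply: (@fatou_cvg (fun p w => F_ p w * G_ p w) _ (fun p => u p * v p)%E).
- move=> p; apply: measurable_funM; exact: count_fun_measurable (cF p) || exact: count_fun_measurable (cG p).
- by move=> p w; rewrite mulr_ge0.
- by move=> w; apply: cvgM; [exact: FF|exact: GG].
- move=> p; apply: (le_trans (na_count_fun na AB (cF p) (cG p))).
  by apply: lee_pmul => //; exact: mean_ge0.
- by rewrite EFinM; apply: cvgeM => //.
Qed.

(** A continuous increasing extension of the falling factorial, as required for a function
    of counts to which negative association applies. *)
Definition ffactR (m : nat) (x : R) := \prod_(i < m) Num.max 0 (x - i%:R).

Lemma ffactR_nat m n : ffactR m n%:R = (n ^_ m)%:R.
Proof.
elim: m => [|m IHm]; first by rewrite /ffactR big_ord0 ffactn0.
rewrite /ffactR big_ord_recr/= -/(ffactR m _) IHm ffactnSr natrM; congr (_ * _).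
have [nm|mn] := leqP n m.
  by rewrite max_l ?subr_le0 ?ler_nat// (eqP nm).
have mn' := ltnW mn; rewrite natrB//; apply: max_r.
by rewrite subr_ge0 ler_nat.
Qed.

Lemma ffactR_ge0 m x : 0 <= ffactR m x.
Proof. by apply: prodr_ge0 => i _; rewrite le_max lexx. Qed.

Lemma ffactR_le m x y : x <= y -> ffactR m x <= ffactR m y.
Proof.
move=> xy; apply: ler_prod => i _; rewrite le_max lexx/= ge_max !le_max lexx/=.
by rewrite lerD2r xy orbT.
Qed.

Lemma continuous_ffactR m : continuous (ffactR m).
Proof.
apply: continuous_bigprod => i; apply: continuous_maxR; first exact: continuous_cstR.
by apply: continuousBR; [move=> x; exact: cvg_id|exact: continuous_cstR].
Qed.

Lemma measurable_ffactR m : measurable_fun [set: R] (ffactR m).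
Proof. by apply: continuous_measurable_fun; exact: continuous_ffactR. Qed.

Definition fmoment m A := mean (fun w => ffactR m (npoints Phi A w)).

Let measurable_ff m A : measurable A -> measurable_fun setT (fun w => ffactR m (npoints Phi A w)).
Proof.
by move=> mA; apply: (measurableT_comp (measurable_ffactR m)); exact: measurable_npoints.
Qed.

Lemma fmoment_ge0 m A : (0 <= fmoment m A)%E.
Proof. by apply: mean_ge0 => w; exact: ffactR_ge0. Qed.

Lemma fmoment_le m A B : region A -> region B -> A `<=` B -> (fmoment m A <= fmoment m B)%E.
Proof.
move=> rA rB AB; apply: mean_le.
- by move=> w; exact: ffactR_ge0.
- exact: measurable_ff rA.1.
- exact: measurable_ff rB.1.
- by move=> w; apply: ffactR_le; exact: npoints_le.
Qed.

Lemma trunc_cvg (x : R) : 0 <= x -> Num.min p%:R (Num.max 0 x) @[p --> \oo] --> x.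
Proof.
move=> x0; apply: cvg_near_cst; exists (Num.truncn x).+1 => // p /= px.
rewrite max_r// min_r//; apply: (le_trans (ltW (truncnS_gt x))); by rewrite ler_nat.
Qed.

Lemma count_fun_trunc A B (h : R -> R) (p : nat) : region B -> B `<=` A ->
  continuous h -> {homo h : x y / x <= y} ->
  count_fun Phi A (fun w => Num.min p%:R (Num.max 0 (h (npoints Phi B w)))).
Proof.
move=> rB BA ch ih.
exists 'I_1, (fun=> B), (fun x => Num.min p%:R (Num.max 0 (h (x ord0 (enum_rank ord0))))); split.
- by [].
- apply: nice_trunc => //.
    move=> x; apply: continuous_comp; [exact: coord_continuous|exact: ch].
  by move=> x y xy; apply: ih.
- by move=> w; rewrite mxE.
Qed.

Section cells.
Variables (A : set 'rV[R]_d) (w : Omega) (G : finType) (cell : 'rV[R]_d -> G).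
Variables (g : G) (n : nat) (c : 'I_n -> 'rV[R]_d).
Hypotheses (ic : injective c) (cE : Phi w `&` A = range c).

Lemma npoints_cell : npoints Phi (A `&` cell @^-1` [set g]) w =
  #|[pred i | cell (c i) == g]|%:R.
Proof.
rewrite /npoints setIA cE.
have -> : range c `&` cell @^-1` [set g] = [set c i | i in [set` [pred i | cell (c i) == g]]].
  apply/seteqP; split=> x /=; first by move=> [[i _ <-] /eqP h]; exists i.
  by move=> [i /eqP h <-]; split=> //; exists i.
by rewrite counting_image// => i j _ _; exact: ic.
Qed.

Lemma npoints_cellC : npoints Phi (A `\` (A `&` cell @^-1` [set g])) w =
  n%:R - #|[pred i | cell (c i) == g]|%:R.
Proof.
rewrite /npoints setIDA cE.
have -> : range c `\` (A `&` cell @^-1` [set g]) = [set c i | i in [set` [pred i | cell (c i) != g]]].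
  apply/seteqP; split=> x /=.
    move=> [[i _ <-] h]; exists i => //; apply/eqP => cg; apply: h; split=> //.
    by have : range c (c i) by [exists i]; rewrite -cE => -[].
  by move=> [i /eqP h <-]; split; [exists i|move=> [_ /h]].
rewrite counting_image/=; last by move=> i j _ _; exact: ic.
rewrite -natrB; last by rewrite -[X in (_ <= X)%N](card_ord n) max_card.
by congr (_%:R); rewrite -[X in (X - _)%N](card_ord n) -(cardC [pred i | cell (c i) == g]) addKn.
Qed.

End cells.

Lemma sum_cells n (G : finType) (h : 'I_n -> G) :
  (\sum_g #|[pred i | h i == g]|)%N = n.
Proof.
under eq_bigr do rewrite -sum1_card.
rewrite -[RHS](card_ord n) -[RHS]sum1_card (partition_big h predT)//=.
Qed.

Section intensity.
Variable rho1 : 'M[R]_(1, d) -> R.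
Hypothesis rho1E : forall x, rho1 x = 1.
Hypothesis ji1 : joint_intensity Phi rho1.

Lemma mean_npoints A : region A -> mean (npoints Phi A) = lebesgue_mx A.
Proof.
move=> rA; have [_ _ h] := ji1; have := h A rA.1.
under [X in _ = X -> _]eq_integral do rewrite rho1E.
rewrite integral_cst//; last exact: rA.1.
rewrite mul1e => <-; apply: eq_integral => w _; rewrite npointsE//; congr counting.
apply/seteqP; split=> x [h1 h2]; split=> //; last first.
  by have := h1.1 ord0; rewrite [row _ _](_ : _ = x)//; apply/rowP => j; rewrite mxE.
split; last by move=> i j _; rewrite (ord1 i) (ord1 j).
by move=> i; rewrite [row _ _](_ : _ = x)//; apply/rowP => j; rewrite mxE (ord1 i).
Qed.

(** When every cell g holds at most one point, the falling factorial of order m+1 of the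
    number N of points is the sum over g of N(g) times the falling factorial of order m of
    N - N(g), and N(g) and N - N(g) depend on disjoint sets.  Negative association bounds
    each term by |g| times the m-th factorial moment; then the grid is refined until it
    separates the points. *)
Lemma fmomentS_le m A : negatively_associated Phi -> region A ->
  (fmoment m A < +oo)%E -> (lebesgue_mx A < +oo)%E ->
  (fmoment m.+1 A <= lebesgue_mx A * fmoment m A)%E.
Proof.
move=> na rA fm fA.
have cell_bound (B : set 'rV[R]_d) : measurable B -> B `<=` A ->
    (mean (fun w => (ffactR m (npoints Phi (A `\` B) w) * npoints Phi B w)%R) <=
     lebesgue_mx B * fmoment m A)%E.
  move=> mB BA.
  have rB : region B by rewrite -(setIidr BA); apply: regionI.
  have rD : region (A `\` B) by apply: regionI => //; exact: measurableC.
  have fB : (lebesgue_mx B < +oo)%E by apply: le_lt_trans fA; apply: lebesgue_mx_le => //; exact: rA.1.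
  rewrite -(@fineK _ (lebesgue_mx B)) ?ge0_fin_numE// -(@fineK _ (fmoment m A)) ?ge0_fin_numE ?fmoment_ge0//.
  rewrite muleC -EFinM.
  apply: (@na_limit (A `\` B) B
    (fun p w => Num.min p%:R (Num.max 0 (ffactR m (npoints Phi (A `\` B) w))))
    (fun p w => Num.min p%:R (Num.max 0 (npoints Phi B w)))
    _ _ (fun=> (fine (fmoment m A))%:E) (fun=> (fine (lebesgue_mx B))%:E)) => //.
  - by rewrite setDE -setIA setICl setI0.
  - by move=> p; apply: count_fun_trunc => //; [exact: continuous_ffactR|exact: ffactR_le].
  - by move=> p; apply: (count_fun_trunc (h := id)) => //; move=> x; exact: cvg_id.
  - by move=> w; apply: trunc_cvg; exact: ffactR_ge0.
  - by move=> w; apply: trunc_cvg; exact: npoints_ge0.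
  - move=> p; rewrite fineK ?ge0_fin_numE ?fmoment_ge0//.
    apply: le_trans (fmoment_le m rD rA _); last by move=> x [].
    apply: mean_le.
    + by move=> w; rewrite le_min ler0n le_max lexx.
    + apply: count_fun_measurable (count_fun_trunc (A := A) _ _ _ _ _) => //.
      * exact: continuous_ffactR.
      * exact: ffactR_le.
    + exact: measurable_ff rD.1.
    + by move=> w; rewrite ge_min ge_max ffactR_ge0 lexx orbT.
  - move=> p; rewrite fineK ?ge0_fin_numE// -mean_npoints//.
    apply: mean_le.
    + by move=> w; rewrite le_min ler0n le_max lexx.
    + apply: count_fun_measurable (count_fun_trunc (h := id) (A := A) _ _ _ _ _) => //.
      by move=> x; exact: cvg_id.
    + exact: measurable_npoints.
    + by move=> w; rewrite ge_min ge_max npoints_ge0 lexx orbT.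
  - exact: cvg_cst.
  - exact: cvg_cst.
have /choice[F hF] : forall p, exists F : Omega -> R,
    [/\ measurable_fun setT F, forall w, 0 <= F w,
     (mean F <= lebesgue_mx A * fmoment m A)%E &
     forall w n (c : 'I_n -> 'rV[R]_d), injective c -> Phi w `&` A = range c ->
       (forall i j, i != j -> ~ (exists y, ball (c i) p.+1%:R^-1 y /\ ball (c j) p.+1%:R^-1 y)) ->
       F w = ffactR m.+1 (npoints Phi A w)].
  move=> p; have [G [pos [cell [mcell bcell]]]] := exists_grid p rA.
  pose Q g := A `&` cell @^-1` [set g].
  have QA g : Q g `<=` A by move=> x [].
  have rQ g : region (Q g) by rewrite -(setIidr (QA g)); apply: regionI => //; exact: mcell.
  have rD g : region (A `\` Q g) by apply: regionI => //; apply: measurableC; exact: mcell.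
  have mFg g : measurable_fun setT (fun w => ffactR m (npoints Phi (A `\` Q g) w) * npoints Phi (Q g) w).
    apply: measurable_funM; first exact: measurable_ff (rD g).1.
    exact: measurable_npoints (mcell g).
  exists (fun w => \sum_g ffactR m (npoints Phi (A `\` Q g) w) * npoints Phi (Q g) w); split.
  - by apply: measurable_sum => g; exact: mFg.
  - by move=> w; apply: sumr_ge0 => g _; rewrite mulr_ge0 ?ffactR_ge0 ?npoints_ge0.
  - under eq_integral do rewrite -sumEFin.
    rewrite ge0_integral_sum//; last 2 first.
    + by move=> g; apply/measurable_EFinP; exact: mFg.
    + by move=> g w _; rewrite lee_fin mulr_ge0 ?ffactR_ge0 ?npoints_ge0.
    apply: (@le_trans _ _ (\sum_g lebesgue_mx (Q g) * fmoment m A)%E).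
      by apply: lee_sum => g _; exact: cell_bound (mcell g) (QA g).
    rewrite -ge0_sume_distrl; last by move=> g _; exact: measure_ge0.
    rewrite lee_wpmul2r ?fmoment_ge0//.
    rewrite -(mean_npoints rA).
    under eq_bigr do rewrite -(mean_npoints (rQ _)).
    rewrite -ge0_integral_sum//; last 2 first.
    + by move=> g; apply/measurable_EFinP; exact: measurable_npoints (mcell g).
    + by move=> g w _; rewrite lee_fin npoints_ge0.
    apply: ge0_le_integral => //.
    + by move=> w _; apply: sume_ge0 => g _; rewrite lee_fin npoints_ge0.
    + by apply: emeasurable_sum => g; apply/measurable_EFinP; exact: measurable_npoints (mcell g).
    + by apply/measurable_EFinP; exact: measurable_npoints rA.1.
    + move=> w _; rewrite sumEFin lee_fin.
      have [n [-> [c [ic cE]]]] := npoints_nat LF w rA.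
      under eq_bigr do rewrite (npoints_cell cell _ ic cE).
      by rewrite -natr_sum sum_cells.
  - move=> w n c ic cE sep.
    have nE : npoints Phi A w = n%:R by rewrite /npoints cE counting_range.
    rewrite nE.
    under eq_bigr do rewrite (npoints_cell cell _ ic cE) (npoints_cellC cell _ ic cE).
    have kle g : (#|[pred i | cell (c i) == g]| <= 1)%N.
      apply/card_le1_eqP => i j; rewrite !inE => /eqP gi /eqP gj.
      apply/eqP; apply: contraT => ij; exfalso; apply: (sep i j); first by rewrite eq_sym.
      have Ac l : A (c l) by have : range c (c l) by [exists l]; rewrite -cE => -[].
      exists (pos g); rewrite -{1}gi -gj; split; exact: bcell.
    rewrite (eq_bigr (fun g => ffactR m (n%:R - 1) * (#|[pred i | cell (c i) == g]|)%:R)); last first.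
      move=> g _; have := kle g; case: (#|_|) => [|[|//]] _; first by rewrite !mulr0.
      by [].
    rewrite -mulr_sumr -natr_sum sum_cells.
    case: n {c ic cE sep kle nE} => [|n]; first by rewrite mulr0 ffactR_nat ffact_small.
    by rewrite -{1}natr1 addrK !ffactR_nat ffactSS natrM mulrC.
apply: (@fatou_cvg F _ (fun=> lebesgue_mx A * fmoment m A)%E).
- by move=> p; have [] := hF p.
- by move=> p; have [] := hF p.
- move=> w; have [n [_ [c [ic cE]]]] := npoints_nat LF w rA.
  apply: cvg_near_cst; apply: filterS (eventually_separated ic) => p sep.
  have [_ _ _ FE] := hF p; apply: (FE w n c ic cE) => i j ij; exact: (sep (i, j)).
- by move=> p; have [] := hF p.
- exact: cvg_cst.
Qed.

Lemma region_lty A : region A -> (lebesgue_mx A < +oo)%E.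
Proof.
move=> [mA /bounded_coordP[s hs]].
pose t := Num.max 0 s + 1.
apply: (@le_lt_trans _ _ (lebesgue_mx (open_box (const_mx (- t)) (const_mx t : 'rV[R]_d)))).
  apply: lebesgue_mx_le => //; first exact: measurable_open_box.
  move=> x Ax i j; rewrite (ord1 i) !mxE -ltr_norml.
  by apply: (le_lt_trans (hs x Ax j)); rewrite /t ltr_pwDr// le_max lexx orbT.
by rewrite lebesgue_mx_open_box ltry.
Qed.

Lemma fmoment0 A : fmoment 0 A = 1%E.
Proof.
rewrite /fmoment; under eq_integral do rewrite /ffactR big_ord0.
by rewrite integral_cst// mul1e; exact: probability_setT.
Qed.

Hypothesis na : negatively_associated Phi.

Lemma fmoment_lty m A : region A -> (fmoment m A < +oo)%E.
Proof.
move=> rA; elim: m => [|m IHm]; first by rewrite fmoment0 ltry.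
apply: le_lt_trans (fmomentS_le na rA IHm (region_lty rA)) _.
by rewrite lte_mul_pinfty// ?ge0_fin_numE ?region_lty.
Qed.

Lemma fmomentS_le1 m A : region A -> (lebesgue_mx A <= 1)%E ->
  (fmoment m.+1 A <= fmoment m A)%E.
Proof.
move=> rA A1; apply: le_trans (fmomentS_le na rA (fmoment_lty m rA) (region_lty rA)) _.
by rewrite -[leRHS]mul1e lee_wpmul2r// fmoment_ge0.
Qed.

Lemma mul_ffact n m : (n * n ^_ m = n ^_ m.+1 + m * n ^_ m)%N.
Proof.
rewrite ffactnSr; have [mn|nm] := leqP m n; last by rewrite ffact_small// !muln0 mul0n.
by rewrite [(m * _)%N]mulnC -mulnDr subnK// mulnC.
Qed.

Definition pmoment j m A := mean (fun w => npoints Phi A w ^+ j * ffactR m (npoints Phi A w)).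

Lemma measurable_pmoment j m A : region A ->
  measurable_fun setT (fun w => npoints Phi A w ^+ j * ffactR m (npoints Phi A w)).
Proof.
move=> rA; apply: measurable_funM; last exact: measurable_ff rA.1.
by apply: measurable_funX; exact: measurable_npoints rA.1.
Qed.

Lemma pmomentS j m A : region A ->
  pmoment j.+1 m A = (pmoment j m.+1 A + m%:R%:E * pmoment j m A)%E.
Proof.
move=> rA; rewrite /pmoment -ge0_integralZl//; last 2 first.
- by apply/measurable_EFinP; exact: measurable_pmoment.
- by move=> w _; rewrite lee_fin mulr_ge0 ?exprn_ge0 ?npoints_ge0 ?ffactR_ge0.
rewrite -ge0_integralD//.
- apply: eq_integral => w _; have [n [-> _]] := npoints_nat LF w rA.
  rewrite !ffactR_nat -EFinM -EFinD; congr EFin.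
  have E : n%:R * (n ^_ m)%:R = (n ^_ m.+1)%:R + m%:R * (n ^_ m)%:R :> R.
    by rewrite -!natrM -natrD mul_ffact.
  rewrite exprSr -mulrA E; ring.
- by move=> w _; rewrite lee_fin mulr_ge0 ?exprn_ge0 ?npoints_ge0 ?ffactR_ge0.
- by apply/measurable_EFinP; exact: measurable_pmoment.
- by move=> w _; rewrite mule_ge0// lee_fin mulr_ge0 ?exprn_ge0 ?npoints_ge0 ?ffactR_ge0.
- by apply: measurable_funeM; apply/measurable_EFinP; exact: measurable_pmoment.
Qed.

Lemma pmoment0 m A : pmoment 0 m A = fmoment m A.
Proof. by apply: eq_integral => w _; rewrite expr0 mul1r. Qed.

Lemma pmoment_lty j m A : region A -> (pmoment j m A < +oo)%E.
Proof.
move=> rA; elim: j m => [|j IHj] m; first by rewrite pmoment0 fmoment_lty.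
by rewrite pmomentS// lte_add_pinfty// lte_mul_pinfty// ?lee_fin.
Qed.

(** Multiplying by the number N of points raises the order of the falling factorial by one,
    up to a multiple of the falling factorial itself, and in a region of volume at most 1
    the factorial moments decrease with the order. *)
Lemma pmoment_le j m : exists2 C : R, 0 <= C & forall A, region A -> (lebesgue_mx A <= 1)%E ->
  (pmoment j m A <= C%:E * fmoment m A)%E.
Proof.
elim: j m => [|j IHj] m; first by exists 1 => // A rA _; rewrite pmoment0 mul1e.
have [C C0 hC] := IHj m; have [D D0 hD] := IHj m.+1.
exists (D + m%:R * C); first by rewrite addr_ge0// mulr_ge0.
move=> A rA A1; rewrite pmomentS// EFinD ge0_muleDl ?lee_fin ?mulr_ge0//; apply: leeD.
  apply: (le_trans (hD A rA A1)); rewrite lee_wpmul2l ?lee_fin//.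
  exact: fmomentS_le1.
by rewrite EFinM -muleA lee_wpmul2l ?lee_fin// hC.
Qed.

Lemma mean_cvg_dominated (F_ : nat -> Omega -> R) F (j : nat) A : region A ->
  (forall p, measurable_fun setT (F_ p)) -> (forall p w, 0 <= F_ p w <= npoints Phi A w ^+ j) ->
  (forall w, F_ n w @[n --> \oo] --> F w) -> mean (F_ n) @[n --> \oo] --> mean F.
Proof.
move=> rA mF FB FF.
apply: (@dominated_cvg _ _ _ P setT measurableT (fun n w => (F_ n w)%:E) _ (fun w => (npoints Phi A w ^+ j)%:E)) => //.
- by move=> n; apply/measurable_EFinP.
- by move=> w _; apply: cvg_EFin; [exact: nearW|exact: FF].
- have mj : measurable_fun setT (fun w => npoints Phi A w ^+ j).
    by apply: measurable_funX; exact: measurable_npoints rA.1.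
  apply/integrableP; split; first exact/measurable_EFinP.
  have := pmoment_lty j 0 rA; congr (_ < _)%E; apply: eq_integral => w _.
  by rewrite /ffactR big_ord0 mulr1 gee0_abs// lee_fin exprn_ge0 ?npoints_ge0.
- move=> n w _; have /andP[h1 h2] := FB n w.
  by rewrite abse_EFin lee_fin ger0_norm.
Qed.

End intensity.

Section tuple_functionals.
Variable k : nat.
Implicit Types (U : set 'M[R]_(k.+1, d)) (V : set 'M[R]_(k.+2, d)).

Definition ntuples a U V A w : R := fine (counting (tupset a U V (Phi w `&` A))).

Lemma ntuples_bounds a U V A w : approximable U -> approximable V -> region A ->
  0 <= ntuples a U V A w <= npoints Phi A w ^+ k.+1.
Proof.
move=> aU aV rA; have [F [cF FB FE]] := tupset_discretisation LF a aU aV rA.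
have [N _ hN] := FE w; have := FB N w; rewrite (hN N)//=.
Qed.

Lemma measurable_ntuples a U V A : approximable U -> approximable V -> region A ->
  measurable_fun setT (ntuples a U V A).
Proof.
move=> aU aV rA; have [F [cF FB FE]] := tupset_discretisation LF a aU aV rA.
apply: (@measurable_fun_cvg _ _ _ setT F) => [p|w _].
  exact: count_fun_measurable (cF p).
by apply: cvg_near_cst; exact: FE.
Qed.

Variable rho1 : 'M[R]_(1, d) -> R.
Hypothesis rho1E : forall x, rho1 x = 1.
Hypothesis ji1 : joint_intensity Phi rho1.
Hypothesis na : negatively_associated Phi.

Lemma mean_ntuples_lty a U V A : approximable U -> approximable V -> region A ->
  (mean (ntuples a U V A) < +oo)%E.
Proof.
move=> aU aV rA; apply: le_lt_trans (pmoment_lty rho1E ji1 na k.+1 0 rA).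
apply: mean_le.
- by move=> w; have /andP[] := ntuples_bounds a w aU aV rA.
- exact: measurable_ntuples.
- exact: measurable_pmoment.
- move=> w; rewrite /ffactR big_ord0 mulr1.
  by have /andP[] := ntuples_bounds a w aU aV rA.
Qed.

(** The discretisations are functions of counts; they converge to the tuple counts, with
    means that converge by domination. *)
Lemma na_ntuples a U V U' V' A B : approximable U -> approximable V ->
  approximable U' -> approximable V' -> region A -> region B -> A `&` B = set0 ->
  (mean (fun w => (ntuples a U V A w * ntuples a U' V' B w)%R) <=
   mean (ntuples a U V A) * mean (ntuples a U' V' B))%E.
Proof.
move=> aU aV aU' aV' rA rB AB.
have [F [cF FB FE]] := tupset_discretisation LF a aU aV rA.
have [G [cG GB GE]] := tupset_discretisation LF a aU' aV' rB.
have FF w : F n w @[n --> \oo] --> ntuples a U V A w by apply: cvg_near_cst; exact: FE.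
have GG w : G n w @[n --> \oo] --> ntuples a U' V' B w by apply: cvg_near_cst; exact: GE.
have mF := mean_cvg_dominated rho1E ji1 na rA (fun p => count_fun_measurable (cF p)) FB FF.
have mG := mean_cvg_dominated rho1E ji1 na rB (fun p => count_fun_measurable (cG p)) GB GG.
have n0 a' U1 V1 A1 : (forall w, 0 <= ntuples a' U1 V1 A1 w).
  by move=> w; rewrite fine_ge0// counting_ge0.
have fF : mean (ntuples a U V A) \is a fin_num.
  by rewrite ge0_fin_numE ?mean_ntuples_lty//; exact: mean_ge0.
have fG : mean (ntuples a U' V' B) \is a fin_num.
  by rewrite ge0_fin_numE ?mean_ntuples_lty//; exact: mean_ge0.
rewrite -(fineK fF) -(fineK fG) -EFinM.
apply: (@na_limit A B F G _ _ (fun p => mean (F p)) (fun p => mean (G p))) => //.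
- by rewrite (fineK fF).
- by rewrite (fineK fG).
Qed.

End tuple_functionals.
End moments.

(** * Tuples of nearby points *)

Section window.
Variables (R : realType) (d : nat).

Lemma closed_boxE m n (a b : 'M[R]_(m, n)) :
  [set x : 'M[R]_(m, n) | forall i j, a i j <= x i j <= b i j] =
  [set x | forall i j, x i j \in Interval (BSide true (a i j)) (BSide false (b i j))].
Proof. by apply/seteqP; split=> x h i j; have := h i j; rewrite /= in_itv. Qed.

Lemma lebesgue_mx_closed_box m n (a b : 'M[R]_(m, n)) :
  lebesgue_mx [set x : 'M[R]_(m, n) | forall i j, a i j <= x i j <= b i j] =
  (\prod_(i < m) \prod_(j < n) Num.max 0 (b i j - a i j))%:E.
Proof. by rewrite closed_boxE lebesgue_mx_itv_box. Qed.

Lemma measurable_closed_box m n (a b : 'M[R]_(m, n)) :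
  measurable [set x : 'M[R]_(m, n) | forall i j, a i j <= x i j <= b i j].
Proof. by rewrite closed_boxE; exact: measurable_itv_box. Qed.

Definition cube (s : R) : set 'rV[R]_d := [set x | forall j, `|x ord0 j| <= s / 2].

Lemma cubeE s : cube s = [set x : 'rV[R]_d | forall i j,
  (const_mx (- (s / 2)) : 'rV[R]_d) i j <= x i j <= (const_mx (s / 2) : 'rV[R]_d) i j].
Proof.
apply/seteqP; split=> x /= h => [i j|j].
  by rewrite !mxE (ord1 i) -ler_norml; exact: h.
by have := h ord0 j; rewrite !mxE -ler_norml.
Qed.

Lemma lebesgue_cube s : 0 <= s -> lebesgue_mx (cube s) = (s ^+ d)%:E.
Proof.
move=> s0; rewrite cubeE lebesgue_mx_closed_box big_ord1; congr EFin.
under eq_bigr do rewrite !mxE opprK -splitr max_r//.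
by rewrite prodr_const card_ord.
Qed.

Lemma region_cube s : region (cube s).
Proof.
split; first by rewrite cubeE; exact: measurable_closed_box.
by apply/bounded_coordP; exists (s / 2).
Qed.

Lemma window_cube n : @window R d n = cube (n%:R `^ d%:R^-1).
Proof. by []. Qed.

Lemma region_window n : region (@window R d n).
Proof. by rewrite window_cube; exact: region_cube. Qed.

Lemma side_exp n : (0 < d)%N -> (n%:R `^ d%:R^-1 : R) ^+ d = n%:R.
Proof.
move=> d0; rewrite -powR_mulrn ?powR_ge0// -powRrM mulVf ?pnatr_eq0 -?lt0n//.
by rewrite powRr1.
Qed.

Lemma side_ge1 n : (0 < n)%N -> 1 <= (n%:R `^ d%:R^-1 : R).
Proof.
move=> n0; have : 1 `^ d%:R^-1 <= n%:R `^ d%:R^-1 :> R.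
  by rewrite ge0_ler_powR ?invr_ge0// ?nnegrE ?ler01// ler1n.
by rewrite powR1.
Qed.

End window.

Section diagonal.
Variables (R : realType) (d m : nat).

Lemma measurable_row n (i : 'I_n) : measurable_fun setT (fun X : 'M[R]_(n, d) => row i X).
Proof.
apply: measurable_mxP => i' j; under eq_fun do rewrite mxE; exact: measurable_coord.
Qed.

Lemma measurable_edges : measurable_fun setT (fun X : 'M[R]_(m.+1, d) => edges X).
Proof.
apply: measurable_mxP => i j; under eq_fun do rewrite !mxE.
by apply: measurable_funB; exact: measurable_coord.
Qed.

Lemma edges_shear y (a : 'rV[R]_d) : edges (shear 1 (y, a)) = y :> 'M[R]_(m, d).
Proof.
apply/row_matrixP => i; rewrite row_edges; apply/rowP => j.
have E1 : row (lift ord0 i) (shear 1 (y, a)) ord0 j = a ord0 j + y i j.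
  by rewrite mxE shearS mul1r.
have E0 : row ord0 (shear 1 (y, a)) ord0 j = a ord0 j by rewrite mxE shear0.
by rewrite mxE E1 [X in _ + X]mxE E0 [RHS]mxE addrAC subrr add0r.
Qed.

(** Seen from its first point, each further point of a tuple of D lies in a cube of side
    2t. *)
Lemma lebesgue_near_diagonal (t : R) (A : set 'rV[R]_d) (D : set 'M[R]_(m.+1, d)) :
  0 <= t -> measurable A -> measurable D ->
  (forall X, D X -> A (row ord0 X) /\ forall i, enorm (row i X - row ord0 X) <= t) ->
  (lebesgue_mx D <= lebesgue_mx A * ((2 * t) ^+ (m * d))%:E)%E.
Proof.
move=> t0 mA mD hD.
pose B := [set y : 'M[R]_(m, d) | forall i j, (const_mx (- t) : 'M[R]_(m, d)) i j <= y i j <=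
   (const_mx t : 'M[R]_(m, d)) i j].
have mB : measurable B by exact: measurable_closed_box.
pose E := [set X : 'M[R]_(m.+1, d) | A (row ord0 X) /\ B (edges X)].
have mE : measurable E.
  have -> : E = (fun X => row ord0 X) @^-1` A `&` (fun X => edges X) @^-1` B by [].
  apply: measurableI; rewrite -[X in measurable X]setTI.
    exact: measurable_row.
  exact: measurable_edges.
apply: (@le_trans _ _ (lebesgue_mx E)).
  apply: lebesgue_mx_le => // X /hD[AX hX]; split=> // i j.
  rewrite !mxE -ler_norml; apply: le_trans (hX (lift ord0 i)).
  by have := coord_le_enorm (row (lift ord0 i) X - row ord0 X) j; rewrite !mxE.
have -> : lebesgue_mx E = (\int[lebesgue_mx (n := d)]_X (\1_E X)%:E)%E.
  by rewrite integral_indic// setIT.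
rewrite (@integral_shear R m d 1)//; last by apply/measurable_EFinP; exact: measurable_indic.
rewrite expr1n mul1e.
under eq_integral => y _.
  under eq_integral => a _.
    have -> : \1_E (shear 1 (y, a)) = \1_B y * \1_A a :> R.
      rewrite !indicE -natrM mulnb; congr (_%:R); congr nat_of_bool.
      have r0 : row ord0 (shear 1 (y, a)) = a by apply/rowP => j; rewrite mxE shear0.
      have EE : E (shear 1 (y, a)) <-> B y /\ A a by rewrite /E/= edges_shear r0; split=> -[].
      apply/idP/andP => [/set_mem/EE[? ?]|[/set_mem ? /set_mem ?]]; last exact/mem_set/EE.
      by split; exact: mem_set.
    rewrite EFinM; over.
  rewrite ge0_integralZl//; last first.
    by apply/measurable_EFinP; exact: measurable_indic.
  rewrite integral_indic// setIT muleC; over.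
rewrite ge0_integralZl//; last first.
  by apply/measurable_EFinP; exact: measurable_indic.
rewrite integral_indic// setIT.
rewrite -[X in (_ * X <= _)%E]/(lebesgue_mx B) -[X in (X * _ <= _)%E]/(lebesgue_mx A).
have -> : lebesgue_mx B = ((2 * t) ^+ (m * d))%:E; last by [].
rewrite lebesgue_mx_closed_box; congr EFin.
under eq_bigr do under eq_bigr do rewrite !mxE opprK -mulr2n -mulr_natl max_r ?mulr_ge0//.
by under eq_bigr do rewrite prodr_const card_ord; rewrite prodr_const card_ord -exprM mulnC.
Qed.

End diagonal.

Section local_bounds.
Variables (R : realType) (d : nat) (disp : measure_display) (Omega : measurableType disp).
Variables (P : probability Omega R) (Phi : {RV P >-> config R d}).
Hypothesis LF : forall w, locally_finite (Phi w).
Variables (m : nat) (rho : 'M[R]_(m.+1, d) -> R).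
Hypothesis ji : joint_intensity Phi rho.
Hypothesis ti : translation_invariant rho.
Implicit Types (U : set 'M[R]_(m.+1, d)) (A : set 'rV[R]_d).

Definition rows_in A : set 'M[R]_(m.+1, d) := [set X | forall i, A (row i X)].

Lemma measurable_rows_in A : measurable A -> measurable (rows_in A).
Proof.
move=> mA; rewrite [X in measurable X](_ : _ = \bigcap_(i in [set: 'I_m.+1])
    ((fun X : 'M[R]_(m.+1, d) => row i X) @^-1` A)).
  apply: fin_bigcap_measurable => // i _; rewrite -[X in measurable X]setTI.
  exact: measurable_row.
by apply/seteqP; split=> [X h i _|X h i]; [exact: h|exact: (h i)].
Qed.

Lemma mean_distinct_tuples U A : region A -> measurable U ->
  (\int[P]_w (fine (counting (distinct_tuples (Phi w `&` A) `&` U)))%:E =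
   \int[lebesgue_mx (n := d)]_(X in U `&` rows_in A) (rho X)%:E)%E.
Proof.
move=> rA mU; have [_ _ h] := ji.
rewrite -h; last by apply: measurableI => //; apply: measurable_rows_in; exact: rA.1.
apply: eq_integral => w _; rewrite fineK.
  congr counting; apply/seteqP; split=> X.
    move=> [[XA Xi] UX]; split; last by split=> // i; exact: (XA i).2.
    by split=> // i; exact: (XA i).1.
  move=> [[XC Xi] [UX XA]]; split; last exact: UX.
  by split; [move=> i; split; [exact: XC|exact: XA]|exact: Xi].
apply: counting_fin_num; apply: (@sub_finite_set _ _ (distinct_tuples (Phi w `&` A))).
  by move=> X [].
by apply: finite_distinct_tuples; exact: finite_points.
Qed.

Lemma rho_ge0 X : 0 <= rho X. Proof. by have [] := ji. Qed.
Lemma measurable_rho : measurable_fun setT rho. Proof. by have [] := ji. Qed.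

Lemma rho_shear r y a : rho (shear r (y, a)) = rho (r *: cons0 y).
Proof. exact: ti. Qed.

(** Seen from its first point at scale s, a tuple is (0, y). *)
Lemma shear_tail (s : R) (X : 'M[R]_(m.+1, d)) : 0 < s ->
  X = shear s (\matrix_(i < m) (s^-1 *: (row (lift ord0 i) X - row ord0 X)), row ord0 X).
Proof.
move=> s0; apply/matrixP => i j; case: (unliftP ord0 i) => [i' ->|->].
  by rewrite shearS !mxE mulrA mulfV ?gt_eqF// mul1r addrCA subrr addr0.
by rewrite shear0 mxE.
Qed.

Lemma rho_local_le (s t C : R) X : 0 < s -> t <= m.+1%:R * s ->
  (forall y, balls m.+1%:R y -> rho (s *: cons0 y) <= C) ->
  (forall i, enorm (row i X - row ord0 X) <= t) -> rho X <= C.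
Proof.
move=> s0 ts hC hX; rewrite (shear_tail X s0) rho_shear; apply: hC => i.
rewrite rowK enorm_le// sqnZ -enorm_sqr -exprMn.
have h0 : 0 <= s^-1 * enorm (row (lift ord0 i) X - row ord0 X).
  by rewrite mulr_ge0 ?enorm_ge0// invr_ge0 ltW.
rewrite ler_pXn2r ?nnegrE//.
by rewrite mulrC ler_pdivrMr// (le_trans (hX _)).
Qed.

(** The density is bounded by C near the diagonal, and the volume of the tuples of diameter
    t is that of [lebesgue_near_diagonal].  The scale s at which the density is controlled
    need not be t, since only the tuples s (0,y) with y bounded are under control. *)
Lemma mean_local_le (s t C : R) U A : region A -> measurable U -> 0 < s -> 0 <= t ->
  t <= m.+1%:R * s -> 0 <= C ->
  (forall y, balls m.+1%:R y -> rho (s *: cons0 y) <= C) ->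
  (forall X, U X -> forall i, enorm (row i X - row ord0 X) <= t) ->
  (\int[P]_w (fine (counting (distinct_tuples (Phi w `&` A) `&` U)))%:E <=
   C%:E * (lebesgue_mx A * ((2 * t) ^+ (m * d))%:E))%E.
Proof.
move=> rA mU s0 t0 ts C0 hC hU; rewrite mean_distinct_tuples//.
have mD : measurable (U `&` rows_in A).
  by apply: measurableI => //; apply: measurable_rows_in; exact: rA.1.
apply: (@le_trans _ _ (\int[lebesgue_mx (n := d)]_(X in U `&` rows_in A) C%:E)%E).
  apply: ge0_le_integral => //.
  - by move=> X _; rewrite lee_fin rho_ge0.
  - by apply/measurable_EFinP; apply: measurable_funTS; exact: measurable_rho.
  - by move=> X [UX _]; rewrite lee_fin; apply: (rho_local_le s0 ts hC); exact: hU.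
rewrite integral_cst// lee_wpmul2l ?lee_fin//; apply: lebesgue_near_diagonal => //.
  exact: rA.1.
by move=> X [UX XA]; split; [exact: XA|exact: hU].
Qed.

End local_bounds.

(** * The limit of the first-moment integral *)

Section limit.
Variables (R : realType) (d k : nat).
Hypothesis kd : (0 < k <= d)%N.
Variables (rho : 'M[R]_(k.+1, d) -> R) (f : R -> R) (g : 'M[R]_(k.+1, d) -> R).
Hypothesis rho_ge0 : forall X, 0 <= rho X.
Hypothesis mrho : measurable_fun setT rho.
Hypothesis ti : translation_invariant rho.
Hypothesis sf : scaling_functions rho f g.
Variable r : nat -> R.
Hypothesis r_gt0 : forall n, 0 < r n.
Hypothesis r_cvg : r n @[n --> \oo] --> 0.

Lemma near_radius (Q : R -> Prop) : (\forall t \near 0^'+, Q t) -> \forall n \near \oo, Q (r n).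
Proof.
move=> h; have h' : \forall n \near \oo, 0 < r n -> Q (r n) := r_cvg h.
by apply: filterS h' => n; apply; exact: r_gt0.
Qed.

Lemma radius_at_right : r n @[n --> \oo] --> 0^'+.
Proof. by move=> Q hQ; exact: near_radius. Qed.

Let W n : set 'rV[R]_d := window n.
Let s n : R := n%:R `^ d%:R^-1.

Let d0 : (0 < d)%N. Proof. by case/andP: kd => k0; exact: leq_trans. Qed.

Let T n (y : 'M[R]_(k, d)) : set 'rV[R]_d := [set a | rows_in (W n) (shear (r n) (y, a))].

Let mT n y : measurable (T n y).
Proof.
have -> : T n y = (fun a => shear (r n) (y, a)) @^-1` rows_in (W n) by [].
rewrite -[X in measurable X]setTI; apply: (measurable_fun_pair2 (f := shear (r n))) => //.
  exact: measurable_shear.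
by apply: measurable_rows_in; exact: (region_window R d n).1.
Qed.

Let lebW n : lebesgue_mx (W n) = n%:R%:E.
Proof. by rewrite /W window_cube lebesgue_cube ?powR_ge0// side_exp. Qed.

Let TW n y : (lebesgue_mx (T n y) <= n%:R%:E)%E.
Proof.
rewrite -lebW; apply: lebesgue_mx_le => //; first exact: (region_window R d n).1.
move=> a /(_ ord0); rewrite [row _ _](_ : _ = a)//.
by apply/rowP => j; rewrite mxE shear0.
Qed.

(** The proportion of the window in which a tuple of shape r y can be placed. *)
Let theta n y : R := fine (lebesgue_mx (T n y)) / n%:R.

Let thetaE n y : (0 < n)%N -> lebesgue_mx (T n y) = (n%:R * theta n y)%:E.
Proof.
move=> n0; rewrite /theta mulrC divfK ?pnatr_eq0 -?lt0n// fineK//.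
by rewrite ge0_fin_numE// (le_lt_trans (TW n y)) ?ltry.
Qed.

Let theta_ge0 n y : 0 <= theta n y.
Proof. by rewrite divr_ge0// fine_ge0. Qed.

Let theta_le1 n y : (0 < n)%N -> theta n y <= 1.
Proof.
move=> n0; have := TW n y; rewrite thetaE// lee_fin -[leRHS]mulr1 ler_pM2l//.
by rewrite ltr0n.
Qed.

Let h (y : 'M[R]_(k, d)) : R := \1_(hset 1) (cons0 y).

Let hset_tails (y : 'M[R]_(k, d)) : hset 1 (cons0 y) -> forall i, enorm (row i y) <= 2.
Proof.
move=> hy i; have := hset_diam (lift ord0 i) ord0 kd (@ler01 R) hy.
have -> : row (lift ord0 i) (cons0 y) - row ord0 (cons0 y) = row i y.
  by rewrite -row_edges edges_cons0.
by rewrite mulr1.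
Qed.

Let hset_balls (y : 'M[R]_(k, d)) : hset 1 (cons0 y) -> balls k.+1%:R y.
Proof.
move=> /hset_tails hy i; apply: (le_trans (hy i)).
by rewrite ler_nat ltnS; case/andP: kd.
Qed.

(* Where h_1(0,y) = 1 all points of y have norm at most 2, so the tuple fits wherever its
   first point lies in the window shrunk by 2r on each side; the side s n of the window is
   at least 1. *)
Let theta_ge n y : (0 < n)%N -> hset 1 (cons0 y) ->
  Num.max 0 (1 - 4 * r n) ^+ d <= theta n y.
Proof.
move=> n0 hy; have sn1 : 1 <= s n by exact: side_ge1.
have sn0 : 0 < s n by exact: lt_le_trans sn1.
have n00 : 0 < n%:R :> R by rewrite ltr0n.
rewrite -(ler_pM2l n00) -lee_fin -thetaE//.
have -> : n%:R = s n ^+ d :> R by rewrite side_exp.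
rewrite -exprMn.
apply: (@le_trans _ _ (lebesgue_mx (cube (Num.max 0 (s n - 4 * r n)) : set 'rV[R]_d))).
  rewrite lebesgue_cube ?le_max ?lexx// lee_fin lerXn2r// ?nnegrE.
  - by apply: mulr_ge0; [exact: ltW|rewrite le_max lexx].
  - by rewrite le_max lexx.
  rewrite maxr_pMr; last exact: ltW.
  rewrite mulr0 ge_max !le_max lexx/= mulrBr mulr1 lerB ?orbT//.
  by rewrite ler_peMl// mulr_ge0// ltW.
have [neg|pos] := leP (s n - 4 * r n) 0.
  rewrite [leLHS](_ : _ = 0%E); last by rewrite lebesgue_cube// expr0n gtn_eqF.
  exact: measure_ge0.
apply: lebesgue_mx_le => //; first by case: (region_cube d (s n - 4 * r n)).
move=> a ha i j; rewrite mxE; have haj := ha j.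
have [i' ->|->] := unliftP ord0 i; last first.
  rewrite shear0 /=; apply: (le_trans haj); rewrite ler_pM2r ?invr_gt0//.
  by rewrite gerBl mulr_ge0// ltW.
rewrite shearS /=; apply: (le_trans (ler_normD _ _)).
have -> : n%:R `^ d%:R^-1 / 2 = (s n - 4 * r n) / 2 + r n * 2 by rewrite /s; field.
apply: lerD => //; rewrite normrM gtr0_norm// ler_pM2l//.
apply: le_trans (hset_tails hy i').
by have := coord_le_enorm (row i' y) j; rewrite mxE.
Qed.

Let theta_cvg y : hset 1 (cons0 y) -> theta n y @[n --> \oo] --> (1 : R).
Proof.
move=> hy; apply: (@squeeze_cvgr _ _ _ _ (fun n => Num.max 0 (1 - 4 * r n) ^+ d) (fun=> 1)).
- by exists 1%N => // n /= n0; rewrite theta_ge//= theta_le1.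
- have c2 : 1 - 4 * r n @[n --> \oo] --> (1 : R).
    have : 1 - 4 * r n @[n --> \oo] --> (1 - 4 * 0 : R).
      by apply: cvgB; [exact: cvg_cst|apply: cvgMr; exact: r_cvg].
    by rewrite mulr0 subr0.
  pose phi (x : R) := \prod_(i < d) Num.max 0 x.
  have cphi : continuous phi.
    apply: continuous_bigprod => i; apply: continuous_maxR; first exact: continuous_cstR.
    by move=> x; exact: cvg_id.
  have phiE x : Num.max 0 x ^+ d = phi x by rewrite /phi prodr_const card_ord.
  have H : phi (1 - 4 * r n) @[n --> \oo] --> phi 1 by exact: (cvg_comp _ phi c2 (cphi 1)).
  have phi1 : phi 1 = 1 by rewrite -phiE max_r ?ler01// expr1n.
  rewrite phi1 in H; have -> : (fun n => Num.max 0 (1 - 4 * r n) ^+ d) = (fun n => phi (1 - 4 * r n)).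
    by apply/funext => n; rewrite phiE.
  exact: H.
- exact: cvg_cst.
Qed.

Let mtheta n : measurable_fun setT (theta n).
Proof.
apply: measurable_funM => //; apply: measurableT_comp => //.
pose E := shear (r n) @^-1` (rows_in (W n) : set 'M[R]_(k.+1, d)).
have mE : measurable E.
  rewrite -[E]setTI; apply: measurable_shear => //.
  by apply: measurable_rows_in; exact: (region_window R d n).1.
have := measurable_fun_xsection (lebesgue_mx (R := R) (m := 1) (n := d)) mE.
congr measurable_fun; apply/funext => y /=; congr lebesgue_mx.
by apply/seteqP; split=> a; rewrite /xsection/=; [exact: set_mem|exact: mem_set].
Qed.

Let mcons0 : measurable_fun setT (fun y : 'M[R]_(k, d) => cons0 y).
Proof.
apply: measurable_mxP => i j; case: (unliftP ord0 i) => [i' ->|->].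
  by under eq_fun do rewrite cons0S; exact: measurable_coord.
by under eq_fun do rewrite cons00; exact: measurable_cst.
Qed.

Let mh : measurable_fun setT h.
Proof.
apply: (measurableT_comp _ mcons0); apply: measurable_indic.
exact: (regular_hset kd (@ler01 R)).2.
Qed.

Let mrho_scaled n : measurable_fun setT (fun y : 'M[R]_(k, d) => rho (r n *: cons0 y)).
Proof.
apply: (measurableT_comp mrho); apply: measurable_mxP => i j; under eq_fun do rewrite mxE.
apply: measurable_funM => //.
exact: (measurableT_comp (@measurable_coord R _ _ i j) mcons0).
Qed.

Let F n y := h y * (rho (r n *: cons0 y) / f (r n)) * theta n y.

Let F_ge0 n y : 0 < f (r n) -> 0 <= F n y.
Proof.
move=> f0; rewrite /F; apply: mulr_ge0 => //; apply: mulr_ge0 => //.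
by rewrite divr_ge0// ltW.
Qed.

Let mF n : measurable_fun setT (F n).
Proof.
apply: measurable_funM; last exact: mtheta.
by apply: measurable_funM; [exact: mh|apply: measurable_funM].
Qed.

Let in_sim n y a : (hset (r n) `&` rows_in (W n)) (shear (r n) (y, a)) <->
  hset 1 (cons0 y) /\ T n y a.
Proof.
have := hset_sim a (cons0 y) kd (r_gt0 n) (@ler01 R); rewrite mulr1 => H.
by split=> -[/H ? ?].
Qed.

Lemma integral_window n : (0 < n)%N -> 0 < f (r n) ->
  (\int[lebesgue_mx (n := d)]_(X in hset (r n) `&` rows_in (window n)) (rho X)%:E =
   (n%:R * r n ^+ (d * k) * f (r n))%:E * \int[lebesgue_mx (n := d)]_y (F n y)%:E)%E.
Proof.
move=> n0 f0; set U := _ `&` _.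
have mU : measurable U.
  apply: measurableI; first exact: (regular_hset kd (ltW (r_gt0 n))).2.
  by apply: measurable_rows_in; exact: (region_window R d n).1.
rewrite integral_mkcond.
have -> : ((fun X => (rho X)%:E) \_ U) = (fun X => (rho X * \1_U X)%:E).
  apply/funext => X; rewrite patchE indicE; case: (X \in U); rewrite ?mulr1//.
  by rewrite mulr0.
rewrite (@integral_shear R k d (r n))//; last 2 first.
- by apply/measurable_EFinP; apply: measurable_funM => //; exact: measurable_indic.
- by move=> X; rewrite lee_fin mulr_ge0.
have inner y : (\int[lebesgue_mx (n := d)]_a
    (rho (shear (r n) (y, a)) * \1_U (shear (r n) (y, a)))%:E =
    (n%:R * f (r n))%:E * (F n y)%:E)%E.
  transitivity (\int[lebesgue_mx (n := d)]_a ((h y * rho (r n *: cons0 y))%:E * (\1_(T n y) a)%:E))%E.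
    apply: eq_integral => a _; rewrite -EFinM; congr EFin.
    rewrite [rho (shear _ _)]ti mulrAC mulrC; congr (_ * _).
    rewrite /h !indicE -natrM mulnb; congr (_%:R); congr nat_of_bool.
    apply/idP/andP => [/set_mem/in_sim[? ?]|[/set_mem ? /set_mem ?]]; last exact/mem_set/in_sim.
    by split; exact: mem_set.
  rewrite ge0_integralZl//; last 2 first.
  - by apply/measurable_EFinP; exact: measurable_indic.
  - by rewrite lee_fin mulr_ge0.
  rewrite integral_indic// setIT -[X in (_ * X)%E]/(lebesgue_mx (T n y)) thetaE// -!EFinM.
  congr EFin; rewrite /F; field; by rewrite gt_eqF.
under eq_integral do rewrite inner.
rewrite ge0_integralZl//; last 3 first.
- by apply/measurable_EFinP; exact: mF.
- by move=> y _; rewrite lee_fin F_ge0.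
- by rewrite lee_fin mulr_ge0// ltW.
rewrite muleA -EFinM; congr (_ * _)%E; congr EFin.
by rewrite [(k * d)%N]mulnC; ring.
Qed.

Let box : set 'M[R]_(k, d) := [set y | forall i j,
  (const_mx (- 2) : 'M[R]_(k, d)) i j <= y i j <= (const_mx 2 : 'M[R]_(k, d)) i j].

Let mbox : measurable box. Proof. exact: measurable_closed_box. Qed.

Let h_box y : h y != 0 -> box y.
Proof.
rewrite /h indicE; case: (boolP (_ \in _)) => [/set_mem hy _ i j|]; last by rewrite eqxx.
rewrite !mxE -ler_norml; apply: le_trans (hset_tails hy i).
by have := coord_le_enorm (row i y) j; rewrite mxE.
Qed.

Let h01 y : h y = 0 \/ (h y = 1 /\ hset 1 (cons0 y)).
Proof.
rewrite /h indicE; case: (boolP (_ \in _)) => [/set_mem hy|_]; [by right|by left].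
Qed.

Let F_cvg y : F n y @[n --> \oo] --> h y * g (cons0 y).
Proof.
rewrite /F; have [->|[-> hy]] := h01 y.
  by under eq_fun do rewrite !mul0r; rewrite mul0r; exact: cvg_cst.
under eq_fun do rewrite mul1r.
rewrite mul1r -[g (cons0 y)]mulr1; apply: cvgM; last exact: theta_cvg.
apply: (cvg_comp _ (fun t => rho (t *: cons0 y) / f t) radius_at_right).
by apply: (scaling_cvg sf); exact: hset_balls.
Qed.

Lemma scaling_bound : exists2 C, 0 <= C & \forall t \near 0^'+,
  0 < f t /\ forall y, balls k.+1%:R y -> rho (t *: cons0 y) <= C * f t.
Proof.
have [C hC] := scaling_bigO sf.
exists (Num.max 0 C); first by rewrite le_max lexx.
apply: filterS2 (scaling_f_gt0 sf) hC => t ft ht; split=> // y hy.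
by apply: (le_trans (ht y hy)); rewrite ler_pM2r// le_max lexx orbT.
Qed.

(** Dominated convergence: the integrand vanishes outside a fixed box, where it is bounded
    by the constant of [scaling_bound]. *)
Lemma integral_window_cvg :
  (\int[lebesgue_mx (n := d)]_(X in hset (r n) `&` rows_in (window n)) (rho X)%:E *
    ((n%:R * r n ^+ (d * k) * f (r n))^-1)%:E)%E @[n --> \oo] -->
  (\int[lebesgue_mx (n := d)]_y (hfun 1 (cons0 y) * g (cons0 y))%:E)%E.
Proof.
have [C C0 hC] := scaling_bound.
have [N _ hN] := near_radius hC.
pose M := maxn N 1.
have hM n : (0 < n + M)%N /\ 0 < f (r (n + M)%N) /\
    forall y, balls k.+1%:R y -> rho (r (n + M)%N *: cons0 y) <= C * f (r (n + M)%N).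
  split; first by rewrite addn_gt0 leq_max orbT orbT || rewrite (leq_trans _ (leq_addl _ _))// leq_max orbT.
  by apply: hN => /=; rewrite (leq_trans _ (leq_addl _ _))// leq_max leqnn.
rewrite -(cvg_shiftn M).
apply: (@cvg_trans _ ((\int[lebesgue_mx (n := d)]_y (F (n + M)%N y)%:E)%E @[n --> \oo])).
  apply: near_eq_cvg; apply: nearW => n /=; have [n0 [f0 _]] := hM n.
  rewrite integral_window// muleAC -EFinM mulfV ?mul1e//.
  by rewrite !mulf_neq0 ?expf_neq0 ?pnatr_eq0 -?lt0n// gt_eqF.
apply: (@dominated_cvg _ _ _ _ setT measurableT (fun n y => (F (n + M)%N y)%:E)
   (fun y => (h y * g (cons0 y))%:E) (fun y => (C * \1_box y)%:E)) => //.
- by move=> n; apply/measurable_EFinP; exact: mF.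
- move=> y _; apply: cvg_EFin; first exact: nearW.
  have H : F (n + M)%N y @[n --> \oo] --> h y * g (cons0 y).
    by rewrite (cvg_shiftn M (fun n => F n y)); exact: F_cvg.
  exact: H.
- apply/integrableP; split.
    by apply/measurable_EFinP; apply: measurable_funM => //; exact: measurable_indic.
  under eq_integral do rewrite gee0_abs ?lee_fin ?mulr_ge0// EFinM.
  rewrite ge0_integralZl//; last by apply/measurable_EFinP; exact: measurable_indic.
  rewrite integral_indic// setIT -[X in (_ * X)%E]/(lebesgue_mx box) lebesgue_mx_closed_box.
  by rewrite -EFinM ltry.
- move=> n y _; have [n0 [f0 hr]] := hM n.
  have F0 : 0 <= F (n + M)%N y by exact: F_ge0.
  rewrite abse_EFin ger0_norm// lee_fin /F.
  have [h0|[h1 hy]] := h01 y; first by rewrite h0 !mul0r mulr_ge0.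
  rewrite h1 mul1r indicE mem_set; last by apply: h_box; rewrite h1 oner_eq0.
  apply: ler_pM => //; first by rewrite mulr_ge0// invr_ge0 ltW.
    by rewrite ler_pdivrMr//; apply: hr; exact: hset_balls.
  exact: theta_le1.
Qed.

Lemma measurable_limit_density :
  measurable_fun setT (fun y : 'M[R]_(k, d) => hfun 1 (cons0 y) * g (cons0 y)).
Proof.
by apply: (@measurable_fun_cvg _ _ _ setT F) => [n|y _]; [exact: mF|exact: F_cvg].
Qed.

End limit.

(** * Means of the tuple counts *)

Section expectation.
Variables (R : realType) (d k : nat).
Hypothesis kd : (0 < k <= d)%N.
Variables (disp : measure_display) (Omega : measurableType disp).
Variables (P : probability Omega R) (Phi : {RV P >-> config R d}).
Hypothesis LF : forall w, locally_finite (Phi w).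
Local Notation mean F := (\int[P]_w (F w)%:E)%E.

Lemma lebesgue_window n : lebesgue_mx (window n : set 'rV[R]_d) = n%:R%:E.
Proof.
have d0 : (0 < d)%N by case/andP: kd => k0; exact: leq_trans.
by rewrite window_cube lebesgue_cube ?powR_ge0// side_exp.
Qed.

Definition tuples a (t : R) (A : set 'rV[R]_d) := ntuples Phi a (@hset R k d t) (@circumball_set R k d) A.

Lemma tuples_ge0 a t A w : 0 <= tuples a t A w.
Proof. by rewrite fine_ge0// counting_ge0. Qed.

Lemma measurable_tuples a t A : 0 <= t -> region A -> measurable_fun setT (tuples a t A).
Proof.
move=> t0 rA; apply: measurable_ntuples => //; [exact: (regular_hset kd t0).1|].
exact: (regular_circumball _ _ _).1.
Qed.

Lemma num_criticalE t A w : 0 <= t -> region A ->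
  fine (num_critical k (Phi w `&` A) t) =
  ((k.+1)`!%:R)^-1 * (tuples true t A w - tuples false t A w).
Proof.
move=> t0 rA; have fC := finite_points LF w rA.
have [fc e] := num_critical_tuples kd t0 fC.
have fN : num_critical k (Phi w `&` A) t \is a fin_num by exact: counting_fin_num.
have fE : (counting (tupset false (@hset R k d t) (@circumball_set R k d) (Phi w `&` A)) : \bar R) \is a fin_num.
  by apply/counting_fin_num/finite_tupset.
have f0 : (k.+1)`!%:R != 0 :> R by rewrite pnatr_eq0 -lt0n fact_gt0.
rewrite /tuples /ntuples -e fineD//; last by rewrite fin_numM.
by rewrite fineM//= addrK mulKf.
Qed.

Lemma mean_tuples (rho : 'M[R]_(k.+1, d) -> R) t A : joint_intensity Phi rho -> 0 <= t -> region A ->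
  (mean (tuples true t A) =
   \int[lebesgue_mx (n := d)]_(X in hset t `&` rows_in A) (rho X)%:E)%E.
Proof.
move=> ji t0 rA; rewrite -(mean_distinct_tuples LF ji rA); last exact: (regular_hset kd t0).2.
apply: eq_integral => w _; congr (fine (counting _))%:E.
by apply/seteqP; split=> X; [case|case=> ? ?; split=> //; left].
Qed.

Lemma mean_tuples_le (rho : 'M[R]_(k.+1, d) -> R) (C t : R) A : joint_intensity Phi rho -> translation_invariant rho ->
  0 < t -> region A -> 0 <= C -> (forall y, balls k.+1%:R y -> rho (t *: cons0 y) <= C) ->
  (mean (tuples true t A) <= C%:E * (lebesgue_mx A * ((2 * (2 * t)) ^+ (k * d))%:E))%E.
Proof.
move=> ji ti t0 rA C0 hC; rewrite (mean_tuples ji (ltW t0) rA) -(mean_distinct_tuples LF ji rA); last first.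
  exact: (regular_hset kd (ltW t0)).2.
apply: (mean_local_le LF ji ti rA _ t0 _ _ C0 hC).
- exact: (regular_hset kd (ltW t0)).2.
- by rewrite mulr_ge0// ltW.
- by rewrite ler_pM2r// ler_nat ltnS; case/andP: kd.
- by move=> X hX i; exact: (hset_diam _ _ kd (ltW t0) hX).
Qed.

Let V t : set 'M[R]_(k.+2, d) := [set Z | hset t (tailr Z) /\ circumball_set Z].

Let regular_V t : 0 <= t -> regular (V t).
Proof.
move=> t0; have [[Up hU] mU] := regular_hset kd t0 (R := R).
have -> : V t = (fun Z => tailr Z) @^-1` hset t `&` @circumball_set R k d by [].
apply: regularI; last exact: regular_circumball.
split.
  exists (fun p => (fun Z => tailr Z) @^-1` Up p) => Z; apply: filterS (hU (tailr Z)) => p hp Z' [e0 ZZ'].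
  apply: hp; split=> // i j; rewrite !mxE; exact: ZZ'.
rewrite -[X in measurable X]setTI; apply: (_ : measurable_fun setT (fun Z : 'M[R]_(k.+2, d) => tailr Z)) => //.
by apply: measurable_mxP => i j; under eq_fun do rewrite !mxE; exact: measurable_coord.
Qed.

(** A tuple whose circumball contains a further point is part of a tuple of k+2 points
    within distance 2r of each other; this is what makes such tuples rare. *)
Lemma mean_spoiled_le (rho2 : 'M[R]_(k.+2, d) -> R) (C t : R) A : joint_intensity Phi rho2 -> translation_invariant rho2 ->
  0 < t -> region A -> 0 <= C -> (forall y, balls k.+2%:R y -> rho2 (t *: cons0 y) <= C) ->
  (mean (tuples false t A) <= C%:E * (lebesgue_mx A * ((2 * (2 * t)) ^+ (k.+1 * d))%:E))%E.
Proof.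
move=> ji ti t0 rA C0 hC; have t0' := ltW t0.
have le2 w : tuples false t A w <= fine (counting (distinct_tuples (Phi w `&` A) `&` V t)).
  have fin : finite_set (distinct_tuples (Phi w `&` A) `&` V t).
    apply: (@sub_finite_set _ _ (distinct_tuples (j := k.+2) (Phi w `&` A))); first by move=> X [].
    by apply: finite_distinct_tuples; exact: finite_points.
  apply: fine_le; [|exact: counting_fin_num|].
    by apply/counting_fin_num/finite_tupset; exact: finite_points.
  apply: le_trans (@counting_image_le R _ _ (@tailr R d k.+1) _); apply: counting_le.
  move=> X [[XC Xi] hX [//|[y [Cy yX hy]]]]; exists (consr y X); last exact: consrK.
  split; last by apply: conj; [rewrite consrK; exact: hX|exact: hy].
  split=> [i|i j]; first by case: (unliftP ord0 i) => [i' ->|->]; rewrite ?row_consrS ?row_consr0.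
  case: (unliftP ord0 i) => [i' ->|->]; case: (unliftP ord0 j) => [j' ->|->]; rewrite ?row_consrS ?row_consr0 //.
  - by move=> /Xi ->.
  - by move=> /esym/yX.
  - by move=> /yX.
apply: (@le_trans _ _ (\int[P]_w (fine (counting (distinct_tuples (j := k.+2) (Phi w `&` A) `&` V t)))%:E)%E).
  have e w : fine (counting (distinct_tuples (j := k.+2) (Phi w `&` A) `&` V t)) =
      ntuples Phi true (V t) setT A w.
    congr (fine (counting _)); apply/seteqP; split=> X; last by case.
    by case=> ? ?; split=> //; left.
  under [leRHS]eq_integral do rewrite e.
  apply: mean_le => //; first by move=> w; exact: tuples_ge0.
  - exact: measurable_tuples.
  - apply: measurable_ntuples => //; [exact: (regular_V t0').1|exact: (regularT _ _ _).1].
  - by move=> w; rewrite -e.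
apply: (mean_local_le LF ji ti rA _ t0 _ _ C0 hC); first exact: (regular_V t0').2.
- by rewrite mulr_ge0.
- by rewrite ler_pM2r// ler_nat.
- move=> Z [/(hset_center kd t0')[fX hr hE] [_ hZ]] i.
  case: (unliftP ord0 i) => [i' ->|->]; last first.
    rewrite subrr enorm_le ?mulr_ge0//; apply: (@le_trans _ _ 0); last by rewrite exprn_ge0// mulr_ge0.
    by rewrite /sqn big1// => j _; rewrite mxE expr0n.
  have -> : row (lift ord0 i') Z = row i' (tailr Z) by apply/rowP => j; rewrite !mxE.
  have -> : row i' (tailr Z) - row ord0 Z = (row i' (tailr Z) - ccenter (tailr Z)) - (row ord0 Z - ccenter (tailr Z)).
    by rewrite opprB addrA subrK.
  apply: enorm_le_2r => //; first by rewrite hE.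
  exact: le_trans hZ hr.
Qed.
End expectation.

(** * The limit of the expectation *)

Lemma mule_sub_div (R : realType) (x y : \bar R) (a b : R) :
  x \is a fin_num -> y \is a fin_num -> b != 0 ->
  (a%:E * (x * b^-1%:E - y * b^-1%:E) = a%:E * (x - y) / b%:E)%E.
Proof.
case: x => // x; case: y => // y _ _ b0; rewrite inver (negbTE b0) -!(EFinM, EFinB).
by congr EFin; ring.
Qed.

Section limits.
Variables (R : realType) (d k : nat).
Hypothesis kd : (0 < k <= d)%N.
Variables (disp : measure_display) (Omega : measurableType disp).
Variables (P : probability Omega R) (Phi : {RV P >-> config R d}).
Hypothesis LF : forall w, locally_finite (Phi w).
Variables (rho : 'M[R]_(k.+1, d) -> R) (f : R -> R) (g : 'M[R]_(k.+1, d) -> R).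
Variables (rho2 : 'M[R]_(k.+2, d) -> R) (f2 : R -> R) (g2 : 'M[R]_(k.+2, d) -> R).
Hypotheses (ji : joint_intensity Phi rho) (ti : translation_invariant rho)
  (sf : scaling_functions rho f g).
Hypotheses (ji2 : joint_intensity Phi rho2) (ti2 : translation_invariant rho2)
  (sf2 : scaling_functions rho2 f2 g2).
Hypothesis f2f : f2 =O_ (0^'+) f.
Variable r : nat -> R.
Hypothesis r_gt0 : forall n, 0 < r n.
Hypothesis r_cvg : r n @[n --> \oo] --> 0.
Local Notation mean F := (\int[P]_w (F w)%:E)%E.
Local Notation win := (@window R d).
Local Notation S n := (@tuples R d k _ _ P Phi true (r n) (win n)).
Local Notation E n := (@tuples R d k _ _ P Phi false (r n) (win n)).

Definition scale n : R := n%:R * r n ^+ (d * k) * f (r n).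

(** The spoiled tuples gain a factor r^d from their additional point. *)
Lemma near_means : exists2 C : R, 0 <= C & \forall n \near \oo,
  [/\ (0 < n)%N, 0 < f (r n), (mean (S n) <= (C * scale n)%:E)%E &
     (mean (E n) <= (C * r n ^+ d * scale n)%:E)%E].
Proof.
have [C1 C10 h1] := scaling_bound sf; have [C2 C20 h2] := scaling_bound sf2.
have /eqO_exP[D D0 hD] := f2f.
exists (C1 * 4 ^+ (k * d) + C2 * D * 4 ^+ (k.+1 * d)).
  by rewrite addr_ge0// !mulr_ge0// ?exprn_ge0// ltW.
near=> n.
have n0 : (0 < n)%N by near: n; exact: nbhs_infty_gt.
have [f0 hf] : 0 < f (r n) /\ forall y, balls k.+1%:R y -> rho (r n *: cons0 y) <= C1 * f (r n).
  by near: n; exact: near_radius h1.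
have [f20 hf2] : 0 < f2 (r n) /\ forall y, balls k.+2%:R y -> rho2 (r n *: cons0 y) <= C2 * f2 (r n).
  by near: n; exact: near_radius h2.
have ff : f2 (r n) <= D * f (r n).
  suff: `|f2 (r n)| <= D * `|f (r n)| by rewrite !gtr0_norm.
  by near: n; exact: near_radius hD.
have rn0 := r_gt0 n; have rn0' := ltW rn0; have Sc0 : 0 <= scale n.
  by rewrite /scale !mulr_ge0 ?exprn_ge0// ltW.
have e4 : 2 * (2 * r n) = 4 * r n by ring.
split=> //.
- apply: (le_trans (mean_tuples_le kd LF ji ti rn0 (region_window R d n) _ hf)).
    by rewrite mulr_ge0// ltW.
  rewrite (lebesgue_window _ kd) -!EFinM lee_fin e4 exprMn.
  have -> : C1 * f (r n) * (n%:R * (4 ^+ (k * d) * r n ^+ (k * d))) = C1 * 4 ^+ (k * d) * scale n.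
    by rewrite /scale [(d * k)%N]mulnC; ring.
  by rewrite ler_wpM2r// lerDl !mulr_ge0// ?exprn_ge0// ltW.
- apply: (le_trans (mean_spoiled_le kd LF ji2 ti2 rn0 (region_window R d n) _ hf2)).
    by rewrite mulr_ge0// ltW.
  rewrite (lebesgue_window _ kd) -!EFinM lee_fin e4 exprMn.
  apply: (@le_trans _ _ (C2 * D * 4 ^+ (k.+1 * d) * r n ^+ d * scale n)).
    have -> : C2 * D * 4 ^+ (k.+1 * d) * r n ^+ d * scale n =
      C2 * (D * f (r n)) * (n%:R * (4 ^+ (k.+1 * d) * r n ^+ (k.+1 * d))).
      by rewrite /scale [(d * k)%N]mulnC mulSn [r n ^+ (d + _)]exprD; ring.
    apply: ler_wpM2r; first by rewrite !mulr_ge0// exprn_ge0.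
    by rewrite ler_wpM2l.
  rewrite ler_wpM2r// ler_wpM2r ?exprn_ge0// lerDr.
  by rewrite !mulr_ge0// exprn_ge0.
Unshelve. all: by end_near.
Qed.

Let N n w := fine (num_critical k (Phi w `&` win n) (r n)).

Lemma expectation_N n : (mean (S n) < +oo)%E -> (mean (E n) < +oo)%E ->
  ('E_P[N n] = (k.+1)`!%:R^-1%:E * (mean (S n) - mean (E n)))%E.
Proof.
move=> S1 E1; rewrite unlock.
have rw := region_window R d n; have r0 := ltW (r_gt0 n).
have int a : (mean (@tuples R d k _ _ P Phi a (r n) (win n)) < +oo)%E ->
    P.-integrable setT (EFin \o @tuples R d k _ _ P Phi a (r n) (win n)).
  move=> h; apply/integrableP; split; first exact/measurable_EFinP/measurable_tuples.
  have := h; congr (_ < _)%E; apply: eq_integral => w _.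
  by rewrite gee0_abs// lee_fin; exact: tuples_ge0.
under eq_integral do rewrite /N (num_criticalE kd LF)// EFinM EFinB.
rewrite integralZl//; last by apply: integrableB => //; exact: int.
by rewrite integralB//; exact: int.
Qed.

Lemma expectation_limit :
  ('E_P[N n] / (scale n)%:E @[n --> \oo] --> nu g)%E.
Proof.
have [C C0 hC] := near_means.
have H1 : ((mean (S n) * (scale n)^-1%:E)%E @[n --> \oo] -->
   (\int[lebesgue_mx (n := d)]_y (hfun 1 (cons0 y) * g (cons0 y))%:E)%E).
  have := integral_window_cvg kd (rho_ge0 ji) (measurable_rho ji) ti sf r_gt0 r_cvg.
  apply: cvg_trans; apply: near_eq_cvg; apply: nearW => n.
  by rewrite -(mean_tuples kd LF ji (ltW (r_gt0 n)) (region_window R d n)).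
have H2 : ((mean (E n) * (scale n)^-1%:E)%E @[n --> \oo] --> 0%E).
  apply: (@squeeze_cvge _ _ _ _ (fun=> 0%E) _ (fun n => (C * r n ^+ d)%:E)).
  - near=> n.
    have [n0 f0 hS hE] : [/\ (0 < n)%N, 0 < f (r n), (mean (S n) <= (C * scale n)%:E)%E &
     (mean (E n) <= (C * r n ^+ d * scale n)%:E)%E] by near: n.
    have s0 : 0 < scale n by rewrite /scale !mulr_gt0 ?ltr0n ?exprn_gt0.
    rewrite mule_ge0 ?lee_fin ?invr_ge0 ?(ltW s0)//; last by apply: integral_ge0 => w _; rewrite lee_fin tuples_ge0.
    apply: (le_trans (lee_wpmul2r _ hE)); first by rewrite lee_fin invr_ge0 ltW.
    by rewrite -EFinM mulfK// gt_eqF.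
  - exact: cvg_cst.
  - apply: cvg_EFin; first exact: nearW.
    have : C * r n ^+ d @[n --> \oo] --> C * 0 ^+ d.
      by apply: cvgMr; apply: (@continuous_cvg _ _ _ _ _ _ (fun x : R => x ^+ d)) => //; exact: exprn_continuous.
    have d0 : (0 < d)%N by case/andP: kd => k0; exact: leq_trans.
    by rewrite expr0n gtn_eqF// mulr0; apply: cvg_trans.
have H : (((k.+1)`!%:R^-1%:E * (mean (S n) * (scale n)^-1%:E - mean (E n) * (scale n)^-1%:E))%E @[n --> \oo] --> nu g).
  rewrite /nu -[X in (_ * X)%E]sube0; apply: cvgeZl => //.
  by apply: cvgeB => //; rewrite fin_num_adde_defl.
apply: cvg_trans H; apply: near_eq_cvg; near=> n.
have [n0 f0 hS hE] : [/\ (0 < n)%N, 0 < f (r n), (mean (S n) <= (C * scale n)%:E)%E &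
     (mean (E n) <= (C * r n ^+ d * scale n)%:E)%E] by near: n.
have s0 : 0 < scale n by rewrite /scale !mulr_gt0 ?ltr0n ?exprn_gt0.
have lS := le_lt_trans hS (ltry _); have lE := le_lt_trans hE (ltry _).
have fS : mean (S n) \is a fin_num.
  by rewrite ge0_fin_numE; [exact: lS|]; apply: integral_ge0 => w _; rewrite lee_fin tuples_ge0.
have fE : mean (E n) \is a fin_num.
  by rewrite ge0_fin_numE; [exact: lE|]; apply: integral_ge0 => w _; rewrite lee_fin tuples_ge0.
rewrite (expectation_N lS lE) mule_sub_div; [reflexivity|exact: fS|exact: fE|].
by rewrite gt_eqF.
Unshelve. all: by end_near.
Qed.

End limits.

(** * Positivity of the limit and dilations of the scale *)

Lemma ae_open_box (R : realType) (m n : nat) (a b : 'M[R]_(m, n)) (Q : 'M[R]_(m, n) -> Prop) :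
  (forall i j, a i j < b i j) -> {ae lebesgue_mx (n := n), forall y, Q y} ->
  exists2 y, open_box a b y & Q y.
Proof.
move=> ab [N [mN N0 QN]]; apply: contrapT => h.
have sub : open_box a b `<=` N.
  by move=> y aby; apply: QN => Qy; apply: h; exists y.
have := lebesgue_mx_le (measurable_open_box a b) mN sub.
rewrite -[X in (_ <= X)%E]/(lebesgue_mx N) N0 lebesgue_mx_open_box lee_fin leNgt => /negP; apply.
by apply: prodr_gt0 => i _; apply: prodr_gt0 => j _; rewrite lt_max subr_gt0 ab orbT.
Qed.

Lemma dilation_cvg (R : realType) (L : R) (r : nat -> R) : r n @[n --> \oo] --> 0 ->
  L * r n @[n --> \oo] --> 0.
Proof. by move=> h; rewrite -[X in _ --> X](mulr0 L); apply: cvgMr. Qed.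

Section comparison.
Variables (R : realType) (d k : nat).
Hypothesis kd : (0 < k <= d)%N.
Variables (rho : 'M[R]_(k.+1, d) -> R) (f : R -> R) (g : 'M[R]_(k.+1, d) -> R).
Hypothesis rho_ge0 : forall X, 0 <= rho X.
Hypothesis mrho : measurable_fun setT rho.
Hypothesis ti : translation_invariant rho.
Hypothesis sf : scaling_functions rho f g.
Variable r : nat -> R.
Hypothesis r_gt0 : forall n, 0 < r n.
Hypothesis r_cvg : r n @[n --> \oo] --> 0.

Let d0 : (0 < d)%N. Proof. by case/andP: kd => k0; exact: leq_trans. Qed.

Let g_ge0 y : 0 <= hfun 1 (cons0 y) * g (cons0 y).
Proof.
rewrite /hfun -/(hset 1) indicE; case: (boolP (_ \in _)) => [/set_mem hy|_]; last by rewrite mul0r.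
rewrite mul1r; apply: (scaling_g_ge0 sf) => i.
have -> : row i (cons0 y) = row i (cons0 y) - row ord0 (cons0 y).
  by rewrite [row ord0 _](_ : _ = 0) ?subr0//; apply/rowP => j; rewrite mxE cons00 mxE.
apply: (le_trans (hset_diam i ord0 kd ler01 hy)).
by rewrite mulr1 ler_nat ltnS; case/andP: kd.
Qed.

(** On the box of [hset_box] the density h_1 g is positive almost everywhere, as the lower
    bound on rho / f passes to the limit g. *)
Lemma nu_gt0 : (0 < nu g)%E.
Proof.
rewrite /nu; apply: mule_gt0; first by rewrite lte_fin invr_gt0 ltr0n fact_gt0.
have mG : measurable_fun setT (fun y : 'M[R]_(k, d) => (hfun 1 (cons0 y) * g (cons0 y))%:E).
  by apply/measurable_EFinP; exact: (measurable_limit_density kd mrho sf r_gt0 r_cvg).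
rewrite lt_neqAle; apply/andP; split; last by apply: integral_ge0 => y _; rewrite lee_fin.
apply/eqP => I0; have [a [b [ab box]]] := hset_box R kd.
have ae0 : ae_eq (lebesgue_mx (n := d)) setT (fun y : 'M[R]_(k, d) => (hfun 1 (cons0 y) * g (cons0 y))%:E) (cst 0%E).
  apply/ae_eq_integral_abs => //; rewrite I0; apply: eq_integral => y _.
  by rewrite gee0_abs// lee_fin.
have [y aby [Fy]] := ae_open_box ab (filterI ae0 (scaling_bigOmega sf)).
have hy := box y aby.
have yb : balls k.+1%:R y.
  move=> i; have -> : row i y = row (lift ord0 i) (cons0 y) - row ord0 (cons0 y).
    by rewrite -row_edges edges_cons0.
  by apply: (le_trans (hset_diam _ _ kd ler01 hy)); rewrite mulr1 ler_nat ltnS; case/andP: kd.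
move=> /(_ yb)[c c0 hc].
have : c <= g (cons0 y).
  apply: (cvgr_to_ge (scaling_cvg sf yb)).
  by apply: filterS2 hc (scaling_f_gt0 sf) => t ht ft; rewrite ler_pdivlMr.
have := Fy I; rewrite /hfun -/(hset 1) indicE mem_set// mul1r => -[->].
by rewrite leNgt c0.
Qed.

(** A lower bound on rho at a single shape y at scale L r bounds f(L r), and the same tuple
    has the shape L y at scale r, where the upper bound applies if y is small enough.  The
    lower bound holds almost everywhere, hence at some small y. *)
Lemma scaling_dilation (L : R) : 1 <= L ->
  exists2 C, 0 <= C & \forall n \near \oo, f (L * r n) <= C * f (r n).
Proof.
move=> L1; have L0 : 0 < L by exact: lt_le_trans L1.
pose t : R := k.+1%:R / L / d%:R.
have t0 : 0 < t by rewrite !divr_gt0// ltr0n.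
have [|y yb] := @ae_open_box R k d (const_mx (- t)) (const_mx t) _ _ (scaling_bigOmega sf).
  by move=> i j; rewrite !mxE gtrN.
have yi i : enorm (row i y) <= k.+1%:R / L.
  have -> : k.+1%:R / L = d%:R * t by rewrite /t; field; apply/andP; split; rewrite ?pnatr_eq0 -?lt0n// gt_eqF.
  apply: enorm_le_coord; first exact: ltW.
  by move=> j; rewrite mxE ler_norml; have := yb i j; rewrite !mxE => /andP[/ltW -> /ltW ->].
have kL : k.+1%:R / L <= k.+1%:R :> R by rewrite ler_pdivrMr// ler_peMr.
case=> [i|c c0 hc]; first exact: le_trans (yi i) kL.
have LyB : balls k.+1%:R (L *: y).
  move=> i; have -> : row i (L *: y) = L *: row i y by apply/rowP => j; rewrite !mxE.
  rewrite enorm_le// sqnZ -enorm_sqr -exprMn ler_pXn2r// ?nnegrE ?mulr_ge0 ?enorm_ge0//; last exact: ltW.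
  by rewrite mulrC -ler_pdivlMr.
have [C C0 hC] := scaling_bound sf.
exists (C / c); first by rewrite divr_ge0// ltW.
have Lr0 n : 0 < L * r n by rewrite mulr_gt0.
have Lr := dilation_cvg L r_cvg.
apply: filterS2 (near_radius Lr0 Lr hc) (near_radius r_gt0 r_cvg hC) => n h1 [f0 h2].
rewrite mulrAC ler_pdivlMr// mulrC; apply: (le_trans h1).
have -> : (L * r n) *: cons0 y = r n *: cons0 (L *: y).
  apply/matrixP => i j; rewrite [LHS]mxE [RHS]mxE.
  case: (unliftP ord0 i) => [i' ->|->]; last by rewrite !cons00 !mulr0.
  by rewrite !cons0S mxE mulrA [L * _]mulrC.
exact: h2.
Qed.
End comparison.

(** * Variance of sums with negative correlations *)

Section variance_sums.
Variables (disp : measure_display) (T : measurableType disp) (R : realType) (P : probability T R).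
Implicit Types X Y : T -> R.
Local Notation L2 := (Lfun P 2%:E).

Lemma Lfun2P X : measurable_fun setT X -> (\int[P]_w (X w ^+ 2)%:E < +oo)%E -> X \in L2.
Proof.
move=> mX h; apply/andP; split; first exact: mem_set.
apply: mem_set => /=; rewrite /finite_norm unlock /Lnorm/= poweR_lty//.
move: h; congr (_ < _)%E; apply: eq_integral => w _.
by rewrite /= powR_mulrn// real_normK// num_real.
Qed.

Lemma Lfun2_1 X : X \in L2 -> X \in Lfun P 1.
Proof. by move=> X2; apply: Lfun_subset12 => //; exact: fin_num_measure. Qed.

Lemma Lfun2_sum (I : Type) (s : seq I) (F : I -> T -> R) :
  (forall i, F i \in L2) -> (fun w => \sum_(i <- s) F i w) \in L2.
Proof.
move=> h; have -> : (fun w => \sum_(i <- s) F i w) = \sum_(i <- s) F i.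
  by apply/funext => w; rewrite fct_sumE.
by apply: rpred_sum => //; rewrite lee_fin ler1n.
Qed.

Lemma variance_le_sqr X : X \in L2 -> (variance P X <= \int[P]_w (X w ^+ 2)%:E)%E.
Proof.
move=> X2; rewrite varianceE//.
have -> : (\int[P]_w (X w ^+ 2)%:E = 'E_P[(X ^+ 2)%R])%E by rewrite [in RHS]unlock.
rewrite leeBlDr; last by rewrite fin_numX// expectation_fin_num// Lfun2_1.
rewrite leeDl// -(fineK (expectation_fin_num (Lfun2_1 X2))) -EFin_expe lee_fin.
exact: sqr_ge0.
Qed.

(** The variance of X - Y is nonnegative. *)
Lemma varianceD_le (X Y : T -> R) : X \in L2 -> Y \in L2 ->
  (variance P (X \+ Y)%R <= 2%:E * (variance P X + variance P Y))%E.
Proof.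
move=> X2 Y2; have := variance_ge0 P (X \- Y)%R.
have vX := variance_fin_num X2; have vY := variance_fin_num Y2.
have cXY : covariance P X Y \is a fin_num.
  by apply: covariance_fin_num; [exact: Lfun2_1|exact: Lfun2_1|exact: Lfun2_mul_Lfun1].
rewrite varianceB// varianceD// -(fineK vX) -(fineK vY) -(fineK cXY).
rewrite -!EFinM -!EFinD !lee_fin; lra.
Qed.

Lemma variance_sum_le (I : Type) (s : seq I) (F : I -> T -> R) :
  (forall i, F i \in L2) ->
  (variance P (fun w => (\sum_(i <- s) F i w)%R) <=
   (2 ^+ size s)%:E * \sum_(i <- s) variance P (F i))%E.
Proof.
move=> h; elim: s => [|i s IHs].
  under [X in variance P X]eq_fun do rewrite big_nil.
  by rewrite variance_cst big_nil mule0.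
under [X in variance P X]eq_fun do rewrite big_cons.
apply: (le_trans (varianceD_le (h i) (Lfun2_sum s h))).
have S0 : (0 <= \sum_(j <- s) variance P (F j))%E by apply: sume_ge0 => j _; exact: variance_ge0.
rewrite big_cons /= exprS EFinM -muleA lee_wpmul2l// ge0_muleDr ?variance_ge0//.
apply: leeD => //; rewrite -[leLHS]mul1e lee_wpmul2r ?variance_ge0// lee_fin.
by rewrite exprn_ege1// ler1n.
Qed.

Lemma variance_sum_nc (I : eqType) (s : seq I) (F : I -> T -> R) : uniq s ->
  (forall i, F i \in L2) ->
  {in s &, forall i j, i != j -> (covariance P (F i) (F j) <= 0)%E} ->
  (variance P (fun w => (\sum_(i <- s) F i w)%R) <= \sum_(i <- s) variance P (F i))%E.
Proof.
move=> us h; elim: s us => [|i s IHs] /= us nc.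
  under [X in variance P X]eq_fun do rewrite big_nil.
  by rewrite variance_cst big_nil.
under [X in variance P X]eq_fun do rewrite big_cons.
case/andP: us => iNs us; rewrite big_cons varianceD//; last exact: Lfun2_sum.
rewrite -[leRHS]adde0; apply: leeD.
  apply: leeD => //; apply: IHs => // j l js ls.
  by apply: nc; rewrite inE ?js ?ls orbT.
rewrite mule_ge0_le0//.
have {nc} : {in s, forall j, (covariance P (F i) (F j) <= 0)%E}.
  move=> j js; apply: nc; rewrite ?inE ?eqxx ?js ?orbT//.
  by apply: contraNneq iNs => ->.
elim: s {IHs us iNs} => [|j s IHs] nc.
  under [X in covariance P _ X]eq_fun do rewrite big_nil.
  by rewrite covariance_cst_r.
under [X in covariance P _ X]eq_fun do rewrite big_cons.
rewrite covarianceDr//; last exact: Lfun2_sum.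
rewrite -[leRHS]adde0; apply: leeD; first by apply: nc; rewrite inE eqxx.
by apply: IHs => l ls; apply: nc; rewrite inE ls orbT.
Qed.

(** If the terms are negatively correlated within each of finitely many colours, the variance
    grows only linearly with the number of terms. *)
Lemma variance_coloured (Z K : finType) (col : Z -> K) (F : Z -> T -> R) (b : R) :
  (forall z, F z \in L2) ->
  (forall z z', z != z' -> col z = col z' -> (covariance P (F z) (F z') <= 0)%E) ->
  (forall z, (\int[P]_w (F z w ^+ 2)%:E <= b%:E)%E) ->
  (variance P (fun w => (\sum_z F z w)%R) <= (2 ^+ #|K| * (#|Z|%:R * b))%:E)%E.
Proof.
move=> h nc hb.
have -> : (fun w => \sum_z F z w) =
    (fun w => \sum_(c <- enum K) \sum_(z <- enum [pred z | col z == c]) F z w).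
  apply/funext => w; rewrite (partition_big col predT)//= big_enum.
  by apply: eq_bigr => c _; rewrite [RHS]big_enum.
apply: (le_trans (variance_sum_le _ _)) => [c|]; first exact: Lfun2_sum.
rewrite -cardE EFinM lee_wpmul2l ?lee_fin ?exprn_ge0//.
apply: (@le_trans _ _ (\sum_(c <- enum K) \sum_(z <- enum [pred z | col z == c]) variance P (F z))%E).
  apply: lee_sum => c _; apply: variance_sum_nc => //; first exact: enum_uniq.
  by move=> z z'; rewrite !mem_enum => /eqP zc /eqP zc' zz'; apply: nc => //; rewrite zc zc'.
rewrite big_enum (eq_bigr (fun c => \sum_(z | col z == c) variance P (F z))%E); last first.
  by move=> c _; rewrite big_enum.
rewrite -(partition_big (P := xpredT) col (fun c => c \in K))//=.
apply: (@le_trans _ _ (\sum_(z : Z) b%:E)%E).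
  by apply: lee_sum => z _; apply: le_trans (hb z); exact: variance_le_sqr.
by rewrite sumEFin sumr_const mulr_natl.
Qed.

End variance_sums.

(** * Decomposition of the window into cells *)

Lemma fine_counting_partition (R : realType) (T : choiceType) (Z : finType) (D : set T) (F : Z -> set T) :
  finite_set D -> (forall z, F z `<=` D) ->
  (forall x, D x -> exists z0, forall z, F z x <-> z = z0) ->
  fine (counting D : \bar R) = \sum_z fine (counting (F z)).
Proof.
move=> fD FD h; pose s : seq T := enum_fset (fset_set D).
have us : uniq s by exact: fset_uniq.
have DE : D = [set` s] by rewrite -[LHS](fset_setK fD).
have FE z : F z = [set` [seq x <- s | `[< F z x >]]].
  apply/seteqP; split=> x /=; rewrite mem_filter; last by case/andP => /asboolP.
  move=> Fx; apply/andP; split; first exact/asboolP.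
  by have := FD _ _ Fx; rewrite DE.
rewrite DE counting_seq//=.
under eq_bigr => z _ do rewrite FE counting_seq ?filter_uniq//= size_filter -sum1_count natr_sum big_mkcond/=.
rewrite exchange_big/= -sum1_size natr_sum !big_seq; apply: eq_bigr => x xs.
have [|z0 hz0] := h x; first by rewrite DE.
rewrite (bigD1 z0)//= asboolT ?big1 ?addr0//; last exact/hz0.
by move=> z zz; rewrite asboolF// => /hz0 e; rewrite e eqxx in zz.
Qed.

Section cells.
Variables (R : realType) (d k : nat).
Hypothesis kd : (0 < k <= d)%N.
Variables (disp : measure_display) (Omega : measurableType disp).
Variables (P : probability Omega R) (Phi : {RV P >-> config R d}).
Hypothesis LF : forall w, locally_finite (Phi w).
Variables (s t : R) (N : nat).
Hypotheses (s_ge0 : 0 <= s) (t_gt0 : 0 < t) (sN : s < N.+1%:R * t).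
Local Notation index := {ffun 'I_d -> 'I_N.+1}.
Local Notation mean F := (\int[P]_w (F w)%:E)%E.
Implicit Types (z : index) (x y : 'rV[R]_d).

Definition in_cell z x := forall j, (z j)%:R * t <= x ord0 j + s / 2 < (z j).+1%:R * t.

(** The cell with index z enlarged by the diameter 2t of the tuples that are counted. *)
Definition halo z : set 'rV[R]_d := cube s `&`
  [set x | forall j, ((z j)%:R - 2) * t <= x ord0 j + s / 2 < ((z j)%:R + 3) * t].

Definition locus z : set 'M[R]_(k.+1, d) := hset t `&` [set X | in_cell z (row ord0 X)].

Definition cell_tuples a z := ntuples Phi a (locus z) (@circumball_set R k d) (halo z).

Lemma in_cell_unique x : cube s x -> exists z0, forall z, in_cell z x <-> z = z0.
Proof.
move=> xs; pose u j := x ord0 j + s / 2.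
have u0 j : 0 <= u j by have := xs j; rewrite ler_norml => /andP[h _]; rewrite /u -lerBlDr sub0r.
have us j : u j <= s.
  by have := xs j; rewrite ler_norml => /andP[_ h]; rewrite /u [leRHS]splitr lerD2r.
have ut0 j : 0 <= u j / t by rewrite divr_ge0// ltW.
have uN j : (Num.truncn (u j / t) < N.+1)%N.
  by rewrite truncn_lt_nat// ltr_pdivrMr// (le_lt_trans (us j)).
exists [ffun j => Ordinal (uN j)] => z; split=> [h|->].
  apply/ffunP => j; apply/val_inj; rewrite ffunE/=; apply/esym/truncn_def.
  by rewrite ler_pdivlMr// ltr_pdivrMr//; exact: h.
move=> j; rewrite ffunE/= -/(u j) -ler_pdivlMr// -ltr_pdivrMr//.
exact: truncn_itv.
Qed.

Lemma regular_locus z : regular (locus z).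
Proof.
apply: regularI; first exact: (regular_hset kd (ltW t_gt0)).
apply: regular_forall => j.
have c0 : continuous (fun X : 'M[R]_(k.+1, d) => row ord0 X ord0 j + s / 2).
  under eq_fun do rewrite mxE.
  by apply: continuousDR; [exact: coord_continuous|exact: continuous_cstR].
have cc (c : R) : continuous (fun _ : 'M[R]_(k.+1, d) => c) by exact: continuous_cstR.
have := regularI (regular_le (cc ((z j)%:R * t)) c0) (regular_lt c0 (cc ((z j).+1%:R * t))).
by congr regular; apply/seteqP; split=> X /=; [case=> -> ->|move/andP].
Qed.

Let hbox z : halo z `<=` [set x | forall i j, ((const_mx (- (s / 2)) : 'rV[R]_d) + \row_j (((z j)%:R - 2) * t)) i j <= x i j <=
   ((const_mx (- (s / 2)) : 'rV[R]_d) + \row_j (((z j)%:R + 3) * t)) i j].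
Proof.
move=> x [_ hx] i j; rewrite (ord1 i) !mxE; have /andP[h1 h2] := hx j.
by apply/andP; split; lra.
Qed.

Lemma region_halo z : region (halo z).
Proof.
have [mC bC] := region_cube d s; split; last first.
  by apply/bounded_coordP; exists (s / 2) => x [xs _] j; exact: xs.
apply: measurableI => //.
have c0 j : continuous (fun x : 'rV[R]_d => x ord0 j + s / 2).
  by apply: continuousDR; [exact: coord_continuous|exact: continuous_cstR].
have cc (c : R) : continuous (fun _ : 'rV[R]_d => c) by exact: continuous_cstR.
have [_] := regular_forall (fun j => regularI (regular_le (cc (((z j)%:R - 2) * t)) (c0 j))
  (regular_lt (c0 j) (cc (((z j)%:R + 3) * t)))).
congr measurable; apply/seteqP; split=> x /= h j; have := h j; first by case=> -> ->.
by move/andP.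
Qed.

Lemma lebesgue_halo z : (lebesgue_mx (halo z) <= ((5 * t) ^+ d)%:E)%E.
Proof.
apply: le_trans (lebesgue_mx_le (region_halo z).1 (measurable_closed_box _ _) (@hbox z)) _.
rewrite lebesgue_mx_closed_box big_ord1 lee_fin.
have t0 := ltW t_gt0.
under eq_bigr => j _.
  rewrite !mxE (_ : _ - _ = 5 * t); last by ring.
  rewrite max_r; last by rewrite mulr_ge0.
  over.
by rewrite prodr_const card_ord.
Qed.

(** Cells of the same colour are at distance at least 4t, so their halos do not meet. *)
Lemma halo_disjoint z z' : z != z' -> (forall j, z j = z' j %[mod 5]) ->
  halo z `&` halo z' = set0.
Proof.
move=> zz' h; apply/seteqP; split=> x // -[[_ hx] [_ hx']].
case/negP: zz'; apply/eqP/ffunP => j; apply/val_inj.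
have /andP[a1 a2] := hx j; have /andP[b1 b2] := hx' j.
have H1 : ((z j)%:R - 2 < (z' j)%:R + 3 :> R) by rewrite -(ltr_pM2r t_gt0); exact: le_lt_trans b2.
have H2 : ((z' j)%:R - 2 < (z j)%:R + 3 :> R) by rewrite -(ltr_pM2r t_gt0); exact: le_lt_trans a2.
have {}H1 : (z j < z' j + 5)%N by rewrite -(ltr_nat R) natrD; lra.
have {}H2 : (z' j < z j + 5)%N by rewrite -(ltr_nat R) natrD; lra.
have := h j; rewrite /=; clear -H1 H2; lia.
Qed.

(** The points of a tuple, and those that spoil it, lie in a ball of diameter 2t together
    with its first point, hence in the halo of the cell of that point. *)
Lemma tuples_cells a w : tuples k Phi a t (cube s) w = \sum_z cell_tuples a z w.
Proof.
have t0 := ltW t_gt0.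
have sub z X : tupset a (locus z) (@circumball_set R k d) (Phi w `&` halo z) X <->
    tupset a (hset t) (@circumball_set R k d) (Phi w `&` cube s) X /\ in_cell z (row ord0 X).
  split=> [[[XC Xi] [hX cX] aX]|[[[XC Xi] hX aX] cX]].
    split=> //; split=> //; first by split=> // i; have [? []] := XC i.
    by case: aX => [?|[y [[Cy [cy _]] yX Vy]]]; [left|right; exists y; split].
  have near_row x : enorm (x - row ord0 X) <= 2 * t -> cube s x -> halo z x.
    move=> hx xs; split=> // j; have /andP[h1 h2] := cX j.
    have := le_trans (coord_le_enorm (x - row ord0 X) j) hx.
    rewrite !mxE ler_norml => /andP[g1 g2].
    rewrite mxE in h1; rewrite mxE -[(z j).+1%:R]natr1 mulrDl mul1r in h2.
    by rewrite mulrBl mulrDl; apply/andP; split; lra.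
  split.
  - split=> // i; have [XCi Xs] := XC i; split=> //; apply: near_row => //.
    exact: (hset_diam _ _ kd t0 hX).
  - by split.
  - case: aX => [?|[y [[Cy sy] yX Vy]]]; [by left|right; exists y; split=> //; split=> //].
    apply: near_row => //; have [fX hr hE] := hset_center kd t0 hX.
    have [_] := Vy; rewrite consrK row_consr0 /in_circumball/= => yc.
    have -> : y - row ord0 X = (y - ccenter X) - (row ord0 X - ccenter X).
      by rewrite opprB addrA subrK.
    by apply: enorm_le_2r => //; [exact: le_trans hr|rewrite hE].
rewrite /tuples /cell_tuples /ntuples; apply: fine_counting_partition.
- by apply: finite_tupset; apply: finite_points => //; exact: region_cube.
- by move=> z X /sub[].
- move=> X DX; have [|z0 hz0] := in_cell_unique (x := row ord0 X); first by have [[XC _] _ _] := DX; exact: (XC ord0).2.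
  by exists z0 => z; split=> [/sub[_ /hz0]|/hz0 ?]//; apply/sub; split.
Qed.
End cells.

(** * Second moments in a cell *)

Section factorial_moments.
Variables (R : realType) (d : nat).
Variables (disp : measure_display) (Omega : measurableType disp).
Variables (P : probability Omega R) (Phi : {RV P >-> config R d}).
Hypothesis LF : forall w, locally_finite (Phi w).

Lemma counting_distinct_tuples (k n : nat) (c : 'I_n -> 'rV[R]_d) : injective c ->
  counting (distinct_tuples (range c) : set 'M[R]_(k.+1, d)) = (n ^_ k.+1)%:R%:E :> \bar R.
Proof.
move=> ic; have -> : (distinct_tuples (range c) : set 'M[R]_(k.+1, d)) = tupset true setT setT (range c).
  by apply/seteqP; split=> X; [split=> //; left|case].
rewrite counting_tupset//; congr (_%:R%:E).
have := @card_inj_ffuns 'I_k.+1 'I_n; rewrite !card_ord => <-; apply: eq_card => h.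
rewrite /index_tuples !inE asboolT//=.
have -> : [forall i, predT (h i)] by apply/forallP.
by rewrite !andbT.
Qed.

Lemma ffact_npoints (k : nat) A w : region A -> ffactR k.+1 (npoints Phi A w) =
  fine (counting (distinct_tuples (Phi w `&` A) : set 'M[R]_(k.+1, d))).
Proof.
move=> rA; have [n [-> [c [ic ->]]]] := npoints_nat LF w rA.
by rewrite ffactR_nat counting_distinct_tuples.
Qed.

Lemma fmoment_local (k : nat) (rho : 'M[R]_(k.+1, d) -> R) (l C : R) A :
  joint_intensity Phi rho -> translation_invariant rho -> region A -> (0 < d)%N -> 0 < l -> 0 <= C ->
  (forall x y, A x -> A y -> forall j, `|x ord0 j - y ord0 j| <= l / d%:R) ->
  (forall y, balls k.+1%:R y -> rho (l *: cons0 y) <= C) ->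
  (fmoment Phi k.+1 A <= C%:E * (lebesgue_mx A * ((2 * l) ^+ (k * d))%:E))%E.
Proof.
move=> ji ti rA d0 l0 C0 hA hC.
have <- : (\int[P]_w (fine (counting (distinct_tuples (Phi w `&` A) `&` (rows_in A : set 'M[R]_(k.+1, d)))))%:E =
   fmoment Phi k.+1 A)%E.
  apply: eq_integral => w _; rewrite ffact_npoints//; congr (fine (counting _))%:E.
  apply/seteqP; split=> X; first by case.
  by move=> h; split=> // i; have [XC _] := h; exact: (XC i).2.
apply: (mean_local_le LF ji ti rA _ l0 _ _ C0 hC).
- by apply: measurable_rows_in; exact: rA.1.
- exact: ltW.
- by rewrite ler_peMl// ?ler1n// ltW.
- move=> X XA i; have -> : l = d%:R * (l / d%:R) by rewrite mulrC divfK// pnatr_eq0 -lt0n.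
  apply: enorm_le_coord; first by rewrite divr_ge0// ltW.
  by move=> j; have := hA _ _ (XA i) (XA ord0) j; rewrite !mxE.
Qed.
End factorial_moments.

Section cell_variance.
Variables (R : realType) (d k : nat).
Hypothesis kd : (0 < k <= d)%N.
Variables (disp : measure_display) (Omega : measurableType disp).
Variables (P : probability Omega R) (Phi : {RV P >-> config R d}).
Hypothesis LF : forall w, locally_finite (Phi w).
Variable rho1 : 'M[R]_(1, d) -> R.
Hypothesis rho1E : forall x, rho1 x = 1.
Hypothesis ji1 : joint_intensity Phi rho1.
Hypothesis na : negatively_associated Phi.
Variable rho : 'M[R]_(k.+1, d) -> R.
Hypotheses (ji : joint_intensity Phi rho) (ti : translation_invariant rho).
Variables (s t : R) (N : nat).
Hypotheses (s_ge0 : 0 <= s) (t_gt0 : 0 < t) (sN : s < N.+1%:R * t) (t_small : 5 * t <= 1).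
Local Notation mean F := (\int[P]_w (F w)%:E)%E.
Let l : R := 5 * d%:R * t.
Variables (C D : R).
Hypotheses (C_ge0 : 0 <= C) (hC : forall y, balls k.+1%:R y -> rho (l *: cons0 y) <= C).
Hypotheses (D_ge0 : 0 <= D) (hD : forall A, region A -> (lebesgue_mx A <= 1)%E ->
  (pmoment Phi k.+1 k.+1 A <= D%:E * fmoment Phi k.+1 A)%E).

Local Notation X a z := (@cell_tuples R d k _ _ P Phi s t N a z).
Let b : R := D * (C * ((5 * t) ^+ d * (2 * l) ^+ (k * d))).

Let t_ge0 : 0 <= t. Proof. exact: ltW. Qed.
Let d0 : (0 < d)%N. Proof. by case/andP: kd => k0; exact: leq_trans. Qed.
Let l_gt0 : 0 < l. Proof. by rewrite /l !mulr_gt0// ltr0n. Qed.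

Let aU z : approximable (@locus R d k s t N z). Proof. exact: (regular_locus kd s t_gt0 z).1. Qed.
Let aV : approximable (@circumball_set R k d). Proof. exact: (regular_circumball _ _ _).1. Qed.

Lemma measurable_cell_tuples a z : measurable_fun setT (X a z).
Proof. by apply: measurable_ntuples; [exact: LF|exact: aU|exact: aV|exact: region_halo]. Qed.

Lemma cell_tuples_ge0 a z w : 0 <= X a z w.
Proof. by rewrite fine_ge0// counting_ge0. Qed.

Let cell_tuples_le a z w : X a z w <= ffactR k.+1 (npoints Phi (halo s t z) w).
Proof.
have rH := region_halo s t z; have fH := finite_points LF w rH.
rewrite ffact_npoints//; apply: fine_le.
- by apply/counting_fin_num/finite_tupset.
- by apply/counting_fin_num/finite_distinct_tuples.
- by apply: counting_le => Y [].
Qed.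

(** The number T of tuples of a cell is at most the power k+1, and also at most the falling
    factorial of order k+1, of the number of points of the halo; T^2 is bounded by their
    product. *)
Lemma cell_second_moment a z : (mean (fun w => X a z w ^+ 2) <= b%:E)%E.
Proof.
have rH := region_halo s t z.
apply: (@le_trans _ _ (pmoment Phi k.+1 k.+1 (halo s t z))).
  apply: mean_le.
  - by move=> w; exact: sqr_ge0.
  - by apply: measurable_funX; exact: measurable_cell_tuples.
  - exact: measurable_pmoment.
  - move=> w; rewrite expr2; apply: ler_pM; rewrite ?cell_tuples_ge0//.
    by have /andP[] := ntuples_bounds LF a w (aU z) aV rH.
have H1 : (lebesgue_mx (halo s t z) <= 1)%E.
  by apply: le_trans (lebesgue_halo s t_gt0 z) _; rewrite lee_fin exprn_ile1// mulr_ge0.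
apply: (le_trans (hD rH H1)); rewrite /b EFinM lee_wpmul2l ?lee_fin//.
apply: le_trans (fmoment_local LF ji ti rH d0 l_gt0 C_ge0 _ hC) _.
  move=> x y [_ hx] [_ hy] j; have /andP[x1 x2] := hx j; have /andP[y1 y2] := hy j.
  have -> : l / d%:R = 5 * t by rewrite /l; field; rewrite pnatr_eq0 -lt0n.
  by rewrite ler_norml; apply/andP; split; lra.
rewrite EFinM lee_wpmul2l ?lee_fin// EFinM lee_wpmul2r ?lebesgue_halo//.
by rewrite lee_fin exprn_ge0// mulr_ge0// ltW.
Qed.

Lemma cell_tuples_L2 a z : X a z \in Lfun P 2%:E.
Proof.
apply: Lfun2P; first exact: measurable_cell_tuples.
by apply: le_lt_trans (cell_second_moment a z) _; rewrite ltry.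
Qed.

Lemma variance_tuples_le a : (variance P (tuples k Phi a t (cube s)) <=
  (2 ^+ (5 ^ d) * ((N.+1 ^ d)%:R * b))%:E)%E.
Proof.
have -> : tuples k Phi a t (cube s) = (fun w => \sum_z X a z w).
  by apply/funext => w; exact: tuples_cells.
pose col (z : {ffun 'I_d -> 'I_N.+1}) : {ffun 'I_d -> 'I_5} := [ffun j => inord (z j %% 5)].
apply: le_trans (variance_coloured (col := col) (cell_tuples_L2 a) _ (cell_second_moment a)) _.
  move=> z z' zz' cc; have H1 := Lfun2_1 (cell_tuples_L2 a z); have H2 := Lfun2_1 (cell_tuples_L2 a z').
  rewrite covarianceE//; last by apply: Lfun2_mul_Lfun1; exact: cell_tuples_L2.
  rewrite leeBlDr ?add0e; last by rewrite fin_numM// expectation_fin_num.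
  rewrite !unlock; apply: (na_ntuples LF rho1E ji1 na) => //.
  all: try exact: aU; try exact: aV; try exact: region_halo.
  apply: halo_disjoint => // j; have := congr1 (fun h : {ffun 'I_d -> 'I_5} => val (h j)) cc.
    by rewrite /= !ffunE !inordK ?ltn_mod.
by rewrite lee_fin !card_ffun !card_ord.
Qed.

Lemma tuples_L2 a : tuples k Phi a t (cube s) \in Lfun P 2%:E.
Proof.
have -> : tuples k Phi a t (cube s) = (fun w => \sum_z X a z w).
  by apply/funext => w; exact: tuples_cells.
by apply: Lfun2_sum => z; exact: cell_tuples_L2.
Qed.
End cell_variance.

(** * The variance bound *)

Section variance.
Variables (R : realType) (d k : nat).
Hypothesis kd : (0 < k <= d)%N.
Variables (disp : measure_display) (Omega : measurableType disp).
Variables (P : probability Omega R) (Phi : {RV P >-> config R d}).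
Hypothesis LF : forall w, locally_finite (Phi w).
Variable rho1 : 'M[R]_(1, d) -> R.
Hypothesis rho1E : forall x, rho1 x = 1.
Hypothesis ji1 : joint_intensity Phi rho1.
Hypothesis na : negatively_associated Phi.
Variables (rho : 'M[R]_(k.+1, d) -> R) (f : R -> R) (g : 'M[R]_(k.+1, d) -> R).
Hypotheses (ji : joint_intensity Phi rho) (ti : translation_invariant rho)
  (sf : scaling_functions rho f g).
Variable r : nat -> R.
Hypothesis r_gt0 : forall n, 0 < r n.
Hypothesis r_cvg : r n @[n --> \oo] --> 0.
Local Notation win := (@window R d).

Let d0 : (0 < d)%N. Proof. by case/andP: kd => k0; exact: leq_trans. Qed.

(** There are at most (2 n^(1/d) / r)^d cells, each with a second moment of order
    r^(d(k+1)) f(5dr), and f(5dr) = O(f(r)). *)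
Lemma near_variance_tuples : exists2 B : R, 0 <= B & \forall n \near \oo, forall a,
  tuples k Phi a (r n) (win n) \in Lfun P 2%:E /\
  (variance P (tuples k Phi a (r n) (win n)) <= (B * scale d k f r n)%:E)%E.
Proof.
pose L : R := 5 * d%:R.
have d1 : 1 <= d%:R :> R by rewrite ler1n.
have L1 : 1 <= L by rewrite /L; lra.
have L0 : 0 < L by exact: lt_le_trans L1.
have [C1 C10 h1] := scaling_bound sf.
have [C2 C20 h2] := scaling_dilation kd sf r_gt0 r_cvg L1.
have [D D0 hD] := pmoment_le LF rho1E ji1 na k.+1 k.+1.
exists (2 ^+ (5 ^ d) * (D * C1 * C2 * 5 ^+ d * (2 * L) ^+ (k * d) * 2 ^+ d)).
  by rewrite !mulr_ge0// exprn_ge0// mulr_ge0// ltW.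
have Lr0 n : 0 < L * r n by rewrite mulr_gt0.
have Lr := dilation_cvg L r_cvg.
near=> n => a.
have n0 : (0 < n)%N by near: n; exact: nbhs_infty_gt.
have r5 : r n < 5^-1 by near: n; apply: (cvgr_lt _ r_cvg); rewrite invr_gt0.
have [fL hf] : 0 < f (L * r n) /\ forall y, balls k.+1%:R y -> rho ((L * r n) *: cons0 y) <= C1 * f (L * r n).
  by near: n; exact: near_radius Lr0 Lr _ h1.
have fLr : f (L * r n) <= C2 * f (r n) by near: n.
have [f0 _] : 0 < f (r n) /\ forall y, balls k.+1%:R y -> rho (r n *: cons0 y) <= C1 * f (r n).
  by near: n; exact: near_radius r_gt0 r_cvg _ h1.
have rn0 := r_gt0 n; have rn0' := ltW rn0.
pose s : R := n%:R `^ d%:R^-1; pose N := Num.truncn (s / r n).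
have s1 : 1 <= s by exact: side_ge1.
have s0 : 0 <= s by exact: le_trans s1.
have sr0 : 0 <= s / r n by rewrite divr_ge0.
have sN : s < N.+1%:R * r n by rewrite -ltr_pdivrMr//; have /andP[] := truncn_itv sr0.
have r5' : 5 * r n <= 1 by lra.
have C0 : 0 <= C1 * f (L * r n) by rewrite mulr_ge0// ltW.
have H := variance_tuples_le kd LF rho1E ji1 na ji ti rn0 sN r5' C0 hf D0 hD a.
have H2 := tuples_L2 kd LF ji ti rn0 sN r5' C0 hf D0 hD a.
rewrite window_cube -/s; split=> //; apply: (le_trans H); rewrite lee_fin -[leRHS]mulrA -/L.
apply: ler_wpM2l; first by rewrite exprn_ge0.
have NN : (N.+1%:R * r n) ^+ d <= 2 ^+ d * n%:R.
  have -> : n%:R = s ^+ d :> R by rewrite side_exp.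
  rewrite -exprMn lerXn2r ?nnegrE ?mulr_ge0// -natr1 mulrDl mul1r.
  have : N%:R * r n <= s by rewrite -ler_pdivlMr// truncn_le.
  lra.
apply: (@le_trans _ _ (D * C1 * (C2 * f (r n)) * 5 ^+ d * (2 * L) ^+ (k * d) * r n ^+ (k * d) * (2 ^+ d * n%:R))).
  apply: (@le_trans _ _ (D * C1 * f (L * r n) * 5 ^+ d * (2 * L) ^+ (k * d) * r n ^+ (k * d) * (N.+1%:R * r n) ^+ d)).
    rewrite le_eqVlt; apply/orP; left; apply/eqP.
    by rewrite natrX mulrA !exprMn -/L; ring.
  apply: ler_pM => //.
  - by rewrite !mulr_ge0// ?exprn_ge0// ?mulr_ge0// ltW.
  - by rewrite exprn_ge0// mulr_ge0.
  - by rewrite !ler_wpM2r// ?exprn_ge0// ?mulr_ge0// ?(ltW L0)// ler_wpM2l// mulr_ge0.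
rewrite le_eqVlt; apply/orP; left; apply/eqP.
by rewrite /scale [(d * k)%N]mulnC; ring.
Unshelve. all: by end_near.
Qed.

Variables (rho2 : 'M[R]_(k.+2, d) -> R) (f2 : R -> R) (g2 : 'M[R]_(k.+2, d) -> R).
Hypotheses (ji2 : joint_intensity Phi rho2) (ti2 : translation_invariant rho2)
  (sf2 : scaling_functions rho2 f2 g2).
Hypothesis f2f : f2 =O_ (0^'+) f.
Let N n w := fine (num_critical k (Phi w `&` win n) (r n)).

Lemma near_expectation_ge : exists2 c : R, 0 < c & \forall n \near \oo,
  ((c * scale d k f r n)%:E <= 'E_P[N n])%E.
Proof.
have lim := expectation_limit kd LF ji ti sf ji2 ti2 sf2 f2f r_gt0 r_cvg.
have nu0 : (0 < nu g)%E.
  exact: (nu_gt0 kd (measurable_rho ji) sf r_gt0 r_cvg).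
have [c c0 cnu] : exists2 c : R, 0 < c & (c%:E < nu g)%E.
  case: (nu g) nu0 => [x| |]// x0; last by exists 1; rewrite ?ltry.
  by rewrite lte_fin in x0; exists (x / 2); [rewrite divr_gt0|rewrite lte_fin; lra].
exists c => //.
have near1 : \forall n \near \oo, (c%:E < 'E_P[N n] / (scale d k f r n)%:E)%E := lim _ (open_ereal_gt' cnu).
near=> n.
have n0 : (0 < n)%N by near: n; exact: nbhs_infty_gt.
have f0 : 0 < f (r n) by near: n; exact: near_radius r_gt0 r_cvg _ (scaling_f_gt0 sf).
have s0 : 0 < scale d k f r n by rewrite /scale !mulr_gt0 ?ltr0n ?exprn_gt0.
have : (c%:E < 'E_P[N n] / (scale d k f r n)%:E)%E by near: n.
by rewrite inver gt_eqF// lte_pdivlMr// -EFinM => /ltW.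
Unshelve. all: by end_near.
Qed.

Lemma variance_bound : exists2 C : R, 0 < C & \forall n \near \oo,
  (variance P (N n) <= C%:E * 'E_P[N n])%E.
Proof.
have [B B0 hB] := near_variance_tuples; have [c c0 hc] := near_expectation_ge.
pose q : R := ((k.+1)`!%:R)^-1; have q0 : 0 <= q by rewrite invr_ge0.
exists (q ^+ 2 * 4 * B / c + 1).
  by rewrite ltr_wpDl// divr_ge0 ?(ltW c0)// !mulr_ge0.
apply: filterS2 hB hc => n hB hc.
have [S2 VS] := hB true; have [E2 VE] := hB false.
have rw := region_window R d n.
have NE : N n = (q \o* (tuples k Phi true (r n) (win n) \+ (\- tuples k Phi false (r n) (win n))))%R.
  by apply/funext => w; rewrite /N (num_criticalE kd LF _ (ltW (r_gt0 n)) rw); exact: mulrC.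
have NE2 : (\- tuples k Phi false (r n) (win n))%R \in Lfun P 2%:E by rewrite rpredN.
rewrite [X in variance P X]NE varianceZ; last by rewrite rpredD ?lee1n.
have V := varianceD_le S2 NE2; rewrite varianceN// in V.
have E0 : (0 <= 'E_P[N n])%E.
  by apply: expectation_ge0 => w; rewrite fine_ge0// counting_ge0.
apply: (@le_trans _ _ ((q ^+ 2)%:E * (4 * B * scale d k f r n)%:E)%E).
  apply: lee_wpmul2l; first by rewrite lee_fin exprn_ge0// invr_ge0.
  apply: (le_trans V); apply: (@le_trans _ _ (2%:E * ((B * scale d k f r n)%:E + (B * scale d k f r n)%:E))%E).
    by apply: lee_wpmul2l => //; exact: leeD.
  by rewrite -EFinD -EFinM lee_fin; lra.
apply: (@le_trans _ _ ((q ^+ 2 * 4 * B / c)%:E * (c * scale d k f r n)%:E)%E).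
  rewrite -!EFinM lee_fin le_eqVlt; apply/orP; left; apply/eqP; field; exact: lt0r_neq0.
apply: (le_trans (lee_wpmul2l _ hc)).
  by rewrite lee_fin divr_ge0 ?(ltW c0)// !mulr_ge0.
by apply: lee_wpmul2r => //; rewrite lee_fin lerDl.
Qed.
End variance.

Unset Implicit Arguments.
Theorem theorem5p1 (R : realType) (d : nat) (disp : measure_display)
    (Omega : measurableType disp) (P : probability Omega R)
    (Phi : {RV P >-> config R d})
    (rho : forall j : nat, 'M[R]_(j, d) -> R)
    (f : nat -> R -> R)
    (g : forall j : nat, 'M[R]_(j, d) -> R)
    (r : nat -> R)
    (k : nat) :
  (forall w, locally_finite (Phi w)) ->
  stationary Phi ->
  (forall j, joint_intensity Phi (rho j.+1) /\
             translation_invariant (rho j.+1)) ->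
  (forall x, rho 1%N x = 1) ->
  (forall j, (1 <= j.+1 <= d.+1)%N ->
     {ae lebesgue_mx (n := d), forall x, {for x, continuous (rho j.+1)}}) ->
  (forall j, (1 <= j.+1 <= d.+2)%N ->
     scaling_functions (rho j.+1) (f j.+1) (g j.+1)) ->
  (forall j, (1 <= j.+1 <= d.+1)%N ->
     {ae lebesgue_mx (n := d), forall y, balls j.+1%:R y ->
        {for y, continuous (fun y => g j.+1 (cons0 y))}}) ->
  (forall j, (1 <= j <= d.+1)%N -> f j.+1 =O_ (0^'+) f j) ->
  (forall n, 0 < r n) ->
  r n @[n --> \oo] --> 0 ->
  (1 <= k <= d)%N ->
  let N n w := fine (num_critical k (Phi w `&` window n) (r n)) in
  ('E_P[N n] / (n%:R * r n ^+ (d * k) * f k.+1 (r n))%:E @[n --> \oo]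
     --> nu (g k.+1))%E /\
  (negatively_associated Phi ->
     exists2 C : R, 0 < C & \forall n \near \oo,
       (variance P (N n) <= C%:E * 'E_P[N n])%E).
Proof.
move=> LF st jit rho1E rho_cont sf g_cont fO r_gt0 r_cvg kd N.
have k1 : (k.+1 <= d.+1)%N by case/andP: kd.
have [ji ti] := jit k; have [ji2 ti2] := jit k.+1; have [ji1 _] := jit 0%N.
have sf1 : scaling_functions (rho k.+1) (f k.+1) (g k.+1).
  by apply: sf; rewrite /= ltnW.
have sf2 : scaling_functions (rho k.+2) (f k.+2) (g k.+2) by apply: sf.
have f2f : f k.+2 =O_ (0^'+) f k.+1 by apply: fO.
split; first exact: (expectation_limit kd LF ji ti sf1 ji2 ti2 sf2 f2f r_gt0 r_cvg).
by move=> na; exact: (variance_bound kd LF rho1E ji1 na ji ti sf1 r_gt0 r_cvg ji2 ti2 sf2 f2f).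
Qed.
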